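(* Let $a,b\in\mathbb{R}^N$ and let $q,p\in\mathcal{D}^{2\alpha}_Z(\mathbb{R}^N)$ be controlled paths with $q_{t_0}=a$ and $p_{t_1}=b$. Define the Type-II action functional $$\mathfrak{S}(q(\cdot),p(\cdot))=\langle p(t_1),q(t_1)\rangle-\int_{t_0}^{t_1}\langle p(t),dq(t)\rangle+\int_{t_0}^{t_1}H(q(t),p(t))\,dt+\int_{t_0}^{t_1}\mathcal{H}(q(t),p(t))\,d\mathbf{Z}_t .$$ For smooth paths $\delta q,\delta p\in C^\infty([t_0,t_1];\mathbb{R}^N)$ with $\delta q(t_0)=\delta p(t_1)=0$ and $\epsilon\in(-1,1)$, put $(q^\epsilon,p^\epsilon):=(q+\epsilon\,\delta q,\;p+\epsilon\,\delta p)$. If $(q,p)$ is a critical point of $\mathfrak{S}$, i.e. $$\delta\mathfrak{S}(q(\cdot),p(\cdot)):=\frac{d}{d\epsilon}\bigg|_{\epsilon=0}\mathfrak{S}(q^\epsilon(\cdot),p^\epsilon(\cdot))=0$$ for all such variations, then $(q,p)$ satisfies the rough Hamilton's equations $$q_t-q_{t_0}=\int_{t_0}^t\left(\frac{\partial H}{\partial p}(q_r,p_r)\,dr+\frac{\partial\mathcal{H}}{\partial p}(q_r,p_r)\,d\mathbf{Z}_r\right),\qquad p_{t_1}-p_t=-\int_t^{t_1}\left(\frac{\partial H}{\partial q}(q_r,p_r)\,dr+\frac{\partial\mathcal{H}}{\partial q}(q_r,p_r)\,d\mathbf{Z}_r\right)$$ for all $t\in[t_0,t_1]$. Conversely, every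 controlled path solution $(q,p)$ of these rough Hamilton's equations is a stationary point of $\mathfrak{S}$ under variations of the form $(q^\epsilon,p^\epsilon)=(q+\epsilon\,\delta q,\;p+\epsilon\,\delta p)$ with $\delta q,\delta p\in C^\infty([t_0,t_1];\mathbb{R}^N)$, $\delta q(t_0)=\delta p(t_1)=0$ and $\epsilon\in(-1,1)$.
   Context: Let $\alpha\in(\frac13,\frac12]$. $\mathcal{C}^\alpha_g([t_0,t_1],\mathbb{R}^K)$ is the space of geometric $\alpha$-Hölder rough paths: pairs $\mathbf{Z}=(Z,\mathbb{Z})$ with $Z:[t_0,t_1]\to\mathbb{R}^K$ $\alpha$-Hölder and $\mathbb{Z}:[t_0,t_1]^2\to\mathbb{R}^K\otimes\mathbb{R}^K$ with $|\mathbb{Z}_{s,t}|\lesssim|t-s|^{2\alpha}$, satisfying Chen's relation $\mathbb{Z}_{s,t}=\mathbb{Z}_{s,u}+\mathbb{Z}_{u,t}+Z_{s,u}\otimes Z_{u,t}$ and the symmetry condition $\mathbb{Z}_{s,t}+\mathbb{Z}_{s,t}^*=Z_{s,t}\otimes Z_{s,t}$, where $Z_{s,t}=Z_t-Z_s$. Fix such a $\mathbf{Z}$. For a Banach space $W$, $\mathcal{D}^{2\alpha}_Z(W)$ is the space of controlled paths: pairs $(Y,Y')$, $Y:[t_0,t_1]\to W$, with $Y':[t_0,t_1]\to\mathcal{L}(\mathbb{R}^K,W)$ (Gubinelli derivative) $\alpha$-Hölder and $|Y_t-Y_s-Y'_sZ_{s,t}|\lesssim|t-s|^{2\alpha}$;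 one writes $Y$ for the pair. For $Y\in\mathcal{D}^{2\alpha}_Z(\mathcal{L}(\mathbb{R}^K,W))$ the rough integral is $\int Y\,d\mathbf{Z}=\lim\sum_{[u,v]}(Y_uZ_{u,v}+Y'_u\mathbb{Z}_{u,v})$ along partitions with vanishing mesh; for controlled $p$ (viewed as linear-map valued) and $q$, $\int\langle p,dq\rangle=\lim\sum_{[u,v]}(\langle p_u,q_v-q_u\rangle+p'_uq'_u\mathbb{Z}_{u,v})$. For smooth $F$, $F(Y)$ is controlled with derivative $DF(Y)Y'$. Smooth paths are controlled with zero Gubinelli derivative (so $q^\epsilon,p^\epsilon$ have the same Gubinelli derivatives as $q,p$). The configuration space is $Q\cong\mathbb{R}^N$, $T^*Q\cong\mathbb{R}^N\times\mathbb{R}^N$ with coordinates $(q,p)$, and $\langle\cdot,\cdot\rangle$ is the Euclidean pairing. $H\in C^\infty(T^*Q,\mathbb{R})$ and $\mathcal{H}=(H_1,\dots,H_K)^T\in C^\infty(T^*Q,\mathbb{R}^K)$; $\mathcal{H}(q,p)$ is regarded as $\mathcal{L}(\mathbb{R}^K,\mathbb{R})$-valued in the integral against $\mathbf{Z}$, so $\mathcal{H}\,d\mathbf{Z}=\sum_jH_j\,d\mathbf{Z}^j$, and similarly for its derivatives. *)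

(* Defs.v *)
From HB Require Import structures.
From mathcomp Require Import all_boot all_order all_algebra.
From mathcomp Require Import all_classical all_reals all_analysis.
Set Implicit Arguments.
Unset Strict Implicit.
Unset Printing Implicit Defensive.
Import Order.TTheory GRing.Theory Num.Theory.
Import numFieldNormedType.Exports.
Local Open Scope classical_set_scope.
Local Open Scope ring_scope.

(* R^n is 'rV[R]_n. Rough and controlled paths are functions on all of R, but
   every condition and every integral only involves their values on [t0, t1]. *)

Section Smoothness.
Context {R : realType}.

(* Ck k f: f is of class C^k; recursively, f is differentiable and
   x |-> Df(x)v is of class C^(k-1) for every fixed direction v. This agrees
   with the usual notion because it is only used on finite-dimensional V. *)
Fixpoint Ck (V W : normedModType R) (k : nat) (f : V -> W) : Prop :=
  if k is k'.+1 then
    (forall x, differentiable f x) /\ (forall v, Ck k' (fun x => 'D_v f x))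
  else continuous f.

Definition smooth (V W : normedModType R) (f : V -> W) : Prop :=
  forall k, Ck k f.

(* f has derivatives of all orders on [t0, t1], one-sided at the endpoints:
   d n is the n-th derivative. *)
Definition smooth_on (W : normedModType R) (t0 t1 : R) (f : R -> W) : Prop :=
  exists d : nat -> R -> W,
    {in `[t0, t1], d 0%N =1 f} /\
    forall n t, t \in `[t0, t1] ->
      (s - t)^-1 *: (d n s - d n t) @[s --> within `[t0, t1] t^'] --> d n.+1 t.

End Smoothness.

Section RoughPaths.
Context {R : realType} {K : nat}.

(* rp_area s t i j is the (i, j) component of the second-level increment, the
   first index being that of the inner increment of the iterated integral. *)
Record rpath := RPath { rp_path :> R -> 'rV[R]_K; rp_area : R -> R -> 'M[R]_K }.

(* |A s t| <= C |t - s|^beta on [t0, t1]^2 *)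
Definition holder_bound (W : normedModType R) (beta t0 t1 : R)
    (A : R -> R -> W) : Prop :=
  exists C : R, forall s t, s \in `[t0, t1] -> t \in `[t0, t1] ->
    `|A s t| <= C * `|t - s| `^ beta.

Definition holder (W : normedModType R) (alpha t0 t1 : R) (f : R -> W) : Prop :=
  holder_bound alpha t0 t1 (fun s t => f t - f s).

(* The tensor x (x) y is the matrix x^T *m y, with entries x_i y_j. *)
Definition geometric_rough_path (alpha t0 t1 : R) (Z : rpath) : Prop :=
  [/\ holder alpha t0 t1 Z,
      holder_bound (2 * alpha) t0 t1 (rp_area Z),
      forall s u t, s \in `[t0, t1] -> u \in `[t0, t1] -> t \in `[t0, t1] ->
        rp_area Z s t =
          rp_area Z s u + rp_area Z u t + (Z u - Z s)^T *m (Z t - Z u) &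
      forall s t, s \in `[t0, t1] -> t \in `[t0, t1] ->
        rp_area Z s t + (rp_area Z s t)^T = (Z t - Z s)^T *m (Z t - Z s)].

(* A path with its Gubinelli derivative; a linear map R^K -> W is given by the
   images of the basis vectors, so cp_der i t is Y'_t e_i. *)
Record cpath (W : Type) := CPath { cp_path :> R -> W; cp_der : 'I_K -> R -> W }.

Definition controlled (W : normedModType R) (alpha t0 t1 : R) (Z : rpath)
    (Y : cpath W) : Prop :=
  (forall i, holder alpha t0 t1 (cp_der Y i)) /\
  holder_bound (2 * alpha) t0 t1
    (fun s t => Y t - Y s - \sum_i (Z t - Z s) 0 i *: cp_der Y i s).

Definition cpath_comp (V W : normedModType R) (F : V -> W) (Y : cpath V) :
    cpath W :=
  CPath (F \o Y) (fun i t => 'd F (Y t) (cp_der Y i t)).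

Definition cpath_pair (V W : Type) (X : cpath V) (Y : cpath W) :
    cpath (V * W)%type :=
  CPath (fun t => (X t, Y t)) (fun i t => (cp_der X i t, cp_der Y i t)).

(* Adding a smooth path leaves the Gubinelli derivative unchanged. *)
Definition cpath_shift (W : normedModType R) (Y : cpath W) (eps : R)
    (dY : R -> W) : cpath W :=
  CPath (fun t => Y t + eps *: dY t) (cp_der Y).

(* The filter of partitions a < s_1 < ... < s_n = b as the mesh tends to 0 *)
Definition vanishing_mesh (a b : R) : set_system (seq R) :=
  filter_from [set d : R | 0 < d] (fun d => [set s |
    itv_partition a b s /\ all (fun l => l < d) (pairmap (fun u v => v - u) a s)]).

(* lim of the sum of A u v over the intervals [u, v] of partitions of [a, b] *)
Definition sewing_lim (W : normedModType R) (a b : R) (A : R -> R -> W) : W :=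
  lim ((\sum_(x <- pairmap A a s) x) @[s --> vanishing_mesh a b]).

(* int_a^b Y dZ for Y with values in L(R^K, W), given by its K components
   Y j = Y(e_j): the second index of the area pairs with the argument of Y. *)
Definition rough_int (W : normedModType R) (Z : rpath) (a b : R)
    (Y : 'I_K -> cpath W) : W :=
  sewing_lim a b (fun u v =>
    \sum_j (Z v - Z u) 0 j *: Y j u +
    \sum_i \sum_j rp_area Z u v i j *: cp_der (Y j) i u).

Definition dotp (N : nat) (x y : 'rV[R]_N) : R := \sum_i x 0 i * y 0 i.

(* int_a^b <p, dq> *)
Definition rough_pairing_int (N : nat) (Z : rpath) (a b : R)
    (p q : cpath 'rV[R]_N) : R :=
  sewing_lim a b (fun u v =>
    dotp (p u) (q v - q u) +
    \sum_i \sum_j rp_area Z u v i j * dotp (cp_der p i u) (cp_der q j u)).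

End RoughPaths.
Arguments rpath : clear implicits.
Arguments cpath : clear implicits.

Section Hamilton.
Context {R : realType} {K N : nat}.
Local Notation V := 'rV[R]_N.
Local Notation mu := (@lebesgue_measure R).

(* A point of T*Q is the pair (q, p). *)
Definition grad_q (f : V * V -> R) (x : V * V) : V :=
  \row_i 'D_((delta_mx 0 i, 0) : V * V) f x.
Definition grad_p (f : V * V -> R) (x : V * V) : V :=
  \row_i 'D_((0, delta_mx 0 i) : V * V) f x.

Definition Hcomp (calH : V * V -> 'rV[R]_K) (j : 'I_K) : V * V -> R :=
  fun x => calH x 0 j.

Definition action (Z : rpath R K) (t0 t1 : R) (H : V * V -> R)
    (calH : V * V -> 'rV[R]_K) (q p : cpath R K V) : R :=
  dotp (p t1) (q t1)
  - rough_pairing_int Z t0 t1 p q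
  + \int[mu]_(t in `[t0, t1]) H (q t, p t)
  + rough_int Z t0 t1 (fun j => cpath_comp (Hcomp calH j) (cpath_pair q p)).

Definition stationary (Z : rpath R K) (t0 t1 : R) (H : V * V -> R)
    (calH : V * V -> 'rV[R]_K) (q p : cpath R K V) : Prop :=
  forall dq dp : R -> V,
    smooth_on t0 t1 dq -> smooth_on t0 t1 dp -> dq t0 = 0 -> dp t1 = 0 ->
    is_derive (0 : R) (1 : R)
      (fun eps : R =>
         action Z t0 t1 H calH (cpath_shift q eps dq) (cpath_shift p eps dp))
      (0 : R).

(* int_a^b (g(q_r, p_r) dr + G(q_r, p_r) dZ_r) *)
Definition drift_rough_int (Z : rpath R K) (a b : R) (g : V * V -> V)
    (G : 'I_K -> V * V -> V) (q p : cpath R K V) : V :=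
  \row_i \int[mu]_(r in `[a, b]) g (q r, p r) 0 i
  + rough_int Z a b (fun j => cpath_comp (G j) (cpath_pair q p)).

Definition rough_hamilton (Z : rpath R K) (t0 t1 : R) (H : V * V -> R)
    (calH : V * V -> 'rV[R]_K) (q p : cpath R K V) : Prop :=
  forall t, t \in `[t0, t1] ->
    q t - q t0 =
      drift_rough_int Z t0 t (grad_p H) (fun j => grad_p (Hcomp calH j)) q p /\
    p t1 - p t =
      - drift_rough_int Z t t1 (grad_q H) (fun j => grad_q (Hcomp calH j)) q p.

End Hamilton.

(* Main.v *)
Require Import Defs.
From HB Require Import structures.
From mathcomp Require Import all_boot all_order all_algebra.
From mathcomp Require Import all_classical all_reals all_analysis.
From mathcomp Require Import ring lra.
Import Order.TTheory GRing.Theory Num.Theory.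
Import numFieldNormedType.Exports.
Set Implicit Arguments.
Unset Strict Implicit.
Unset Printing Implicit Defensive.
Local Open Scope classical_set_scope.
Local Open Scope ring_scope.

(** The action is a boundary term plus the limit, along partitions of vanishing
    mesh, of the Riemann sums of a germ A(u, v) made of the pairing <p, dq>, of
    H dt and of calH dZ. Such limits are governed by the sewing lemma: if the
    defect A(u, v) - A(u, m) - A(m, v) is O(|v - u|^theta) with theta > 1, then
    A(u, v) is, up to O(|v - u|^theta), the increment of a path ([sewing]), and
    that path determines the limit ([germ_equiv_sewing_lim]). Here
    theta = 3 alpha, and the defect bound comes from Chen's relation and the
    Taylor expansion of the Hamiltonians along a controlled path
    ([ham_germ_additive], [pairing_additive]). Lebesgue integrals of Hoelder
    functions are limits of the same kind since 1 + alpha >= 3 alpha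
    ([primitive_germ_equiv]).

    If q and p are replaced by q + eps dq and p + eps dp, the germ is
    differentiable in eps, and its derivative is a germ of the same form, for
    the partial derivatives of the Hamiltonians: this uses the symmetry of
    second derivatives ([derive_comm], [ham_germ_is_derive]). As the defects of
    the germ and of its derivative are bounded uniformly in eps, the derivative
    passes to the limit ([sewing_lim_is_derive]).

    Let J_q and J_p be the integrals of the q- and p-gradients of H dt + calH dZ.
    Modulo superlinear errors, the derivative of the germ at eps = 0 is
      dq_u (J_q(v) - J_q(u)) + dp_u (J_p(v) - J_p(u))
        - p_u (dq_v - dq_u) - dp_u (q_v - q_u).
    Summation by parts in p dq, whose boundary terms cancel because dq vanishes
    at t0 and the action contains <p, q> at t1, turns the first variation into
    the integral of dq d(p + J_q) + dp d(J_p - q) ([action_is_derive]).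

    The rough Hamilton equations say exactly that p + J_q and J_p - q are
    constant ([rough_hamiltonP]). If they are, the first variation vanishes.
    Conversely, taking dq or dp to be a polynomial in one coordinate and
    integrating by parts, stationarity makes p + J_q and J_p - q orthogonal,
    after subtraction of a constant, to all polynomials, hence constant
    ([constant_of_stationary_pairing]). *)

(** * Partitions of an interval *)

Section Partitions.
Context {R : realType}.
Implicit Types (a b c d : R) (s : seq R).

Definition mesh_lt d a s := all (fun l => l < d) (pairmap (fun u v => v - u) a s).

Definition germ_sum (W : normedModType R) (A : R -> R -> W) a s : W :=
  \sum_(x <- pairmap A a s) x.

Lemma germ_sum_nil (W : normedModType R) (A : R -> R -> W) a :
  germ_sum A a [::] = 0.
Proof. by rewrite /germ_sum big_nil. Qed.

Lemma germ_sum_cons (W : normedModType R) (A : R -> R -> W) a x s :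
  germ_sum A a (x :: s) = A a x + germ_sum A x s.
Proof. by rewrite /germ_sum /= big_cons. Qed.

Lemma germ_sum_cat (W : normedModType R) (A : R -> R -> W) a s s' :
  germ_sum A a (s ++ s') = germ_sum A a s + germ_sum A (last a s) s'.
Proof. by rewrite /germ_sum pairmap_cat big_cat. Qed.

Lemma itv_partition_consP a b x s :
  itv_partition a b (x :: s) <-> a < x /\ itv_partition x b s.
Proof.
rewrite /itv_partition /=; split.
  by move=> [/andP[ax px] lb].
by move=> [ax [px lb]]; rewrite ax px.
Qed.

Lemma itv_partition_splitP a b s s' :
  itv_partition a b (s ++ s') ->
  itv_partition a (last a s) s /\ itv_partition (last a s) b s'.
Proof.
by rewrite /itv_partition cat_path last_cat => -[/andP[-> ->] ->].
Qed.

Lemma exists_fine_partition a b d : a <= b -> 0 < d ->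
  exists s, itv_partition a b s /\ mesh_lt d a s.
Proof.
move=> ab d0; pose e := d / 2.
have e0 : 0 < e by rewrite divr_gt0.
have ed : e < d by rewrite /e; lra.
have [n Hn] : exists n, b - a <= n%:R * e.
  exists (Num.truncn ((b - a) / e)).+1.
  by rewrite -ler_pdivrMr// ltW// truncnS_gt.
elim: n a ab Hn => [|n IHn] a ab Hn.
  have ->: a = b by apply/eqP; rewrite eq_le ab /=; lra.
  by exists [::]; split => //; split.
have [bae|eba] := leP (b - a) e.
  move: ab; rewrite le_eqVlt => /orP[/eqP->|ab]; first by exists [::]; split.
  exists [:: b]; split; first exact: itv_partition1.
  by rewrite /mesh_lt /= andbT; apply: le_lt_trans ed.
have /IHn[|s [ps fs]] : a + e <= b by lra.
  by move: Hn; rewrite -natr1 mulrDl mul1r; lra.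
exists (a + e :: s); split.
  by apply/itv_partition_consP; split => //; lra.
by rewrite /mesh_lt /= -/(mesh_lt _ _ _) fs andbT; lra.
Qed.

Lemma itv_partition_sortedP a b s : a < b ->
  sorted <%O s -> (forall x, x \in s -> a < x <= b) -> b \in s ->
  itv_partition a b s.
Proof.
case: s => [//|x s] ab ss sab bs; split => /=.
  by case/andP: (sab x (mem_head _ _)) => -> _.
rewrite eq_le; case/andP: (sab _ (mem_last x s)) => _ -> /=.
have := ss; rewrite /= => pxs.
have : path <=%O x s by apply: sub_path pxs => u v /ltW.
move: bs; rewrite inE => /orP[/eqP->|bs].
  move=> /(order_path_min le_trans) /allP h.
  by have := mem_last x s; rewrite inE => /orP[/eqP->//|]; apply: h.
elim: s x bs {pxs ss sab} => //= y s IH x; rewrite inE => /orP[/eqP->|bs].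
  move=> /andP[_] /(order_path_min le_trans) /allP h.
  by have := mem_last y s; rewrite inE => /orP[/eqP->//|]; apply: h.
by move=> /andP[_ py]; apply: IH.
Qed.

Lemma itv_partition_mem a b s x : itv_partition a b s -> x \in s -> a < x <= b.
Proof.
elim: s a => //= y s IH a /itv_partition_consP[ay ps].
rewrite inE => /orP[/eqP->|xs]; first by rewrite ay (itv_partition_le ps).
by case/andP: (IH _ ps xs) => yx ->; rewrite (lt_trans ay).
Qed.

Lemma itv_partition_common_refinement a b s s' :
  itv_partition a b s -> itv_partition a b s' ->
  exists r, [/\ itv_partition a b r, {subset s <= r} & {subset s' <= r}].
Proof.
move=> ps ps'; have := itv_partition_le ps; rewrite le_eqVlt => /orP[/eqP ab|ab].
  subst b; exists [::]; rewrite (itv_partitionxx ps) (itv_partitionxx ps').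
  by split => //; split.
exists (sort <=%O (undup (s ++ s'))).
split; last 2 first.
- by move=> x xs; rewrite mem_sort mem_undup mem_cat xs.
- by move=> x xs; rewrite mem_sort mem_undup mem_cat xs orbT.
apply: itv_partition_sortedP => //.
- by rewrite sort_lt_sorted undup_uniq.
- move=> x; rewrite mem_sort mem_undup mem_cat => /orP[] xs.
    exact: itv_partition_mem ps xs.
  exact: itv_partition_mem ps' xs.
- rewrite mem_sort mem_undup mem_cat; apply/orP; left.
  case: s ps => [[_ /=]|x s [_ /= /eqP<-]]; last exact: mem_last.
  by rewrite lt_eqF.
Qed.

End Partitions.

(** * Riemann sums of almost additive germs *)

Section Sewing.
Context {R : realType}.
Implicit Types (a b c d C theta : R) (s : seq R).

Lemma powR_le_mesh theta d x : 1 < theta -> 0 <= x -> x <= d ->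
  x `^ theta <= d `^ (theta - 1) * x.
Proof.
move=> th1 x0 xd.
have -> : x `^ theta = x `^ (theta - 1) * x.
  rewrite -{3}(powRr1 x0) -powRD ?subrK//.
  by apply/implyP => /eqP h; exfalso; lra.
by rewrite ler_wpM2r// ge0_ler_powR// ?nnegrE//; lra.
Qed.

(** The constant c solving c = 2 + 2 `^ (1 - theta) * c: in the bisection argument
    an interval loses two defects and leaves two halves, each of which costs
    2 `^ (- theta) times as much. It is finite because theta > 1. *)
Definition sewing_cst theta := 2 / (1 - 2 `^ (1 - theta)).

Lemma sewing_denominator_gt0 theta : 1 < theta -> 0 < 1 - 2 `^ (1 - theta).
Proof.
move=> th1; rewrite subr_gt0.
have h : 1 < 2 `^ (theta - 1) :> R.
  have := @gt0_ltr_powR R (theta - 1) ltac:(lra) 1 2.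
  by rewrite powR1 !nnegrE; apply; lra.
by rewrite -opprB powRN invf_lt1// (lt_trans ltr01).
Qed.


Lemma sewing_cst_ge0 theta : 1 < theta -> 0 <= sewing_cst theta.
Proof. by move=> /sewing_denominator_gt0 h; rewrite divr_ge0// ltW. Qed.

Lemma sewing_cst_eq theta : 1 < theta ->
  2 + 2 `^ (1 - theta) * sewing_cst theta = sewing_cst theta.
Proof.
move=> /sewing_denominator_gt0 h; rewrite /sewing_cst; field.
by rewrite gt_eqF.
Qed.

Lemma powR_half theta x : 0 <= x ->
  2 * (x / 2) `^ theta = 2 `^ (1 - theta) * x `^ theta.
Proof.
move=> x0; rewrite powRM// ?invr_ge0//.
have -> : (2 : R)^-1 = 2 `^ (-1) by rewrite powR_inv1.
rewrite -powRrM mulN1r mulrCA mulrC -{1}(powRr1 (ler0n R 2)) -powRD//.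
by apply/implyP => _; rewrite pnatr_eq0.
Qed.

(** The failure of additivity of a germ; in the rough paths literature it is
    written delta A. *)
Definition defect (A : R -> R -> R) u m v := A u v - A u m - A m v.

Definition almost_additive (A : R -> R -> R) C theta t0 t1 :=
  forall u m v, t0 <= u -> u <= m -> m <= v -> v <= t1 ->
    `|defect A u m v| <= C * (v - u) `^ theta.

(** Bisection instead of the removal of well-chosen points: the partition
    interval containing the midpoint splits the partition into two shorter
    partitions of intervals of at most half the length. Two defects are paid,
    and strong induction on the number of points handles the two halves, so the
    constant does not depend on the partition. *)
Lemma sewing_bound (A : R -> R -> R) C theta t0 t1 a b s :
  1 < theta -> 0 <= C -> almost_additive A C theta t0 t1 ->
  t0 <= a -> b <= t1 -> itv_partition a b s ->
  `|germ_sum A a s - A a b| <= sewing_cst theta * C * (b - a) `^ theta.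
Proof.
move=> th1 C0 hA; have K0 := sewing_cst_ge0 th1.
have th0 : 0 <= theta by lra.
have [n] := ubnP (size s); elim: n s a b => // n IHn s a b sn ta bt ps.
have := itv_partition_le ps; rewrite le_eqVlt => /orP[/eqP ab|ab].
  subst b; rewrite (itv_partitionxx ps) germ_sum_nil sub0r.
  have := hA a a a ta (lexx _) (lexx _) bt.
  rewrite /defect subrr sub0r => /le_trans; apply.
  rewrite subrr powR0 ?mulr0//; by apply/eqP; lra.
pose c := (a + b) / 2.
have bs : b \in s.
  case: s ps {sn} => [[_ /=]|x s [_ /= /eqP<-]]; last exact: mem_last.
  by rewrite lt_eqF.
(* m' is the first point beyond the midpoint c and m the one before it. *)
have hs : has (fun x => c < x) s.
  by apply/hasP; exists b => //; rewrite /c; lra.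
move: ps sn; case: (split_find hs) => m' s1 s2 cm' /hasPn hs1.
rewrite cat_rcons => ps sn.
have [p1 /itv_partition_consP[mm' p2]] := itv_partition_splitP ps.
set m := last a s1 in p1 mm' p2 *.
have am : a <= m by exact: itv_partition_le p1.
have m'b : m' <= b by exact: itv_partition_le p2.
have mc : m <= c.
  have := mem_last a s1; rewrite -/m inE => /orP[/eqP->|/hs1]; last by rewrite -leNgt.
  by rewrite /c; lra.
rewrite germ_sum_cat germ_sum_cons -/m.
move: sn; rewrite size_cat /= ltnS => sn.
have n1 : (size s1 < n)%N by apply: leq_trans sn; rewrite addnS ltnS leq_addr.
have n2 : (size s2 < n)%N by apply: leq_trans sn; rewrite addnS ltnS leq_addl.
have I1 := IHn _ _ _ n1 ta (_ : m <= t1) p1.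
have I2 := IHn _ _ _ n2 (_ : t0 <= m') bt p2.
have {I1} I1 := I1 ltac:(lra).
have {I2} I2 := I2 ltac:(lra).
have D1 := hA a m b ta am ltac:(lra) bt.
have D2 := hA m m' b ltac:(lra) ltac:(lra) m'b bt.
have half (u : R) : 0 <= u -> u <= (b - a) / 2 ->
    sewing_cst theta * C * u `^ theta <=
    sewing_cst theta * C * ((b - a) / 2) `^ theta.
  move=> u0 ub; apply: (ler_wpM2l (mulr_ge0 K0 C0)).
  by apply: (ge0_ler_powR th0); rewrite ?nnegrE// (le_trans u0).
have H1 := half (m - a) ltac:(lra) ltac:(rewrite /c in mc; lra).
have H2 := half (b - m') ltac:(lra) ltac:(rewrite /c in cm'; lra).
have H3 : C * (b - m) `^ theta <= C * (b - a) `^ theta.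
  apply: (ler_wpM2l C0); apply: (ge0_ler_powR th0).
  - by rewrite nnegrE subr_ge0 (le_trans (ltW mm')).
  - by rewrite nnegrE subr_ge0 ltW.
  - by rewrite lerD2l lerN2.
have -> : germ_sum A a s1 + (A m m' + germ_sum A m' s2) - A a b =
    (germ_sum A a s1 - A a m) + (germ_sum A m' s2 - A m' b)
    - (defect A a m b + defect A m m' b).
  by rewrite /defect; ring.
rewrite (le_trans (ler_normB _ _))//.
rewrite (le_trans (lerD (ler_normD _ _) (ler_normD _ _)))//.
have -> : sewing_cst theta * C * (b - a) `^ theta =
    2 * C * (b - a) `^ theta +
    sewing_cst theta * C * (2 `^ (1 - theta) * (b - a) `^ theta).
  by rewrite -[X in X * C * _ = _](sewing_cst_eq th1); ring.
rewrite -powR_half; last by lra.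
by lra.
Qed.

(** Superlinear terms are invisible in the limit: the sum is at most the mesh to
    the power theta - 1 times the length. *)
Lemma germ_sum_le (W : normedModType R) (B : R -> R -> W) C theta t0 t1 d a b s :
  1 < theta -> 0 <= C ->
  (forall u v, t0 <= u -> u <= v -> v <= t1 -> `|B u v| <= C * (v - u) `^ theta) ->
  t0 <= a -> b <= t1 -> itv_partition a b s -> mesh_lt d a s ->
  `|germ_sum B a s| <= C * d `^ (theta - 1) * (b - a).
Proof.
move=> th1 C0 hB; elim: s a => [|x s IHs] a ta bt ps.
  rewrite (itv_partition_nil ps) germ_sum_nil normr0.
  by rewrite subrr mulr0.
move: ps => /itv_partition_consP[ax ps] /= /andP[xd fs].
rewrite germ_sum_cons (le_trans (ler_normD _ _))//.
have xb := itv_partition_le ps.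
have := hB a x ta (ltW ax) ltac:(lra).
have := IHs x ltac:(lra) bt ps fs.
have := powR_le_mesh th1 (_ : 0 <= x - a) (ltW xd).
move=> /(_ ltac:(lra)) /(ler_wpM2l C0).
by lra.
Qed.

(** Each interval of the coarse partition is partitioned by the fine one, so
    the difference is a sum of the errors of [sewing_bound], which the mesh makes
    small. With a common refinement this gives the Cauchy property. *)
Lemma sewing_refine (A : R -> R -> R) C theta t0 t1 d a b s s' :
  1 < theta -> 0 <= C -> almost_additive A C theta t0 t1 ->
  t0 <= a -> b <= t1 -> itv_partition a b s -> mesh_lt d a s ->
  itv_partition a b s' -> {subset s <= s'} ->
  `|germ_sum A a s' - germ_sum A a s| <=
    sewing_cst theta * C * d `^ (theta - 1) * (b - a).
Proof.
move=> th1 C0 hA; have K0 := sewing_cst_ge0 th1.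
elim: s a s' => [|x s IHs] a s' ta bt ps.
  move=> _; move: bt; rewrite -(itv_partition_nil ps) => bt /itv_partitionxx -> _.
  by rewrite subrr normr0 subrr mulr0.
move: ps => /itv_partition_consP[ax ps] /= /andP[xd fs] ps' ss'.
have xs' : x \in s' by apply: ss'; exact: mem_head.
case/splitPr: xs' ps' ss' => s1 s2.
rewrite -cat_rcons => ps' ss'.
have [] := itv_partition_splitP ps'; rewrite last_rcons => p1 p2.
have xb := itv_partition_le ps.
have sub2 : {subset s <= s2}.
  move=> y ys; have := ss' y; rewrite inE ys orbT => /(_ isT).
  rewrite mem_cat => /orP[/(itv_partition_mem p1)|//].
  by have := itv_partition_mem ps ys; lra.
rewrite germ_sum_cat germ_sum_cons last_rcons.
have I2 := IHs x s2 ltac:(lra) bt ps fs p2 sub2.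
have I1 := sewing_bound th1 C0 hA ta (_ : x <= t1) p1.
have {I1} := I1 ltac:(lra).
have := powR_le_mesh th1 (_ : 0 <= x - a) (ltW xd).
move=> /(_ ltac:(lra)) /(ler_wpM2l (mulr_ge0 K0 C0)).
rewrite opprD addrACA => h1 h2.
rewrite (le_trans (ler_normD _ _))//.
by lra.
Qed.

End Sewing.

(** * The sewing lemma *)

Section SewingLimit.
Context {R : realType}.
Implicit Types (a b c d C theta : R) (s : seq R).

Lemma mesh_lt_cat d a s s' : mesh_lt d a (s ++ s') = mesh_lt d a s && mesh_lt d (last a s) s'.
Proof. by rewrite /mesh_lt pairmap_cat all_cat. Qed.

Lemma sub_mesh_lt d d' a s : d <= d' -> mesh_lt d a s -> mesh_lt d' a s.
Proof. by move=> dd'; apply: sub_all => x /lt_le_trans; apply. Qed.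

Lemma vanishing_mesh_filter a b : Filter (vanishing_mesh a b).
Proof.
apply: filter_from_filter; first by exists 1; exact: ltr01.
move=> d d' /= d0 d'0; exists (Num.min d d'); first by rewrite /= lt_min d0 d'0.
move=> s [ps fs]; split; split => //.
  by apply: sub_mesh_lt fs; rewrite ge_min lexx.
by apply: sub_mesh_lt fs; rewrite ge_min lexx orbT.
Qed.

Lemma vanishing_mesh_proper a b : a <= b -> ProperFilter (vanishing_mesh a b).
Proof.
move=> ab; apply: Build_ProperFilter_ex; last exact: vanishing_mesh_filter.
move=> P [d /= d0 dP]; have [s [ps fs]] := exists_fine_partition ab d0.
by exists s; apply: dP.
Qed.

Lemma cvg_vanishing_meshP (W : normedModType R) (A : R -> R -> W) a b (l : W) :
  germ_sum A a s @[s --> vanishing_mesh a b] --> l <->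
  forall e, 0 < e -> exists2 d, 0 < d &
    forall s, itv_partition a b s -> mesh_lt d a s -> `|l - germ_sum A a s| <= e.
Proof.
have FF := @vanishing_mesh_filter a b.
split=> [/cvgrPdist_le h e e0|h].
  have [d /= d0 dP] := h e e0.
  by exists d => // s ps fs; apply: dP.
apply/cvgrPdist_le => e e0; have [d d0 dP] := h e e0.
by exists d => // s [ps fs]; apply: dP.
Qed.

Lemma sewing_limE (W : normedModType R) (A : R -> R -> W) a b (l : W) :
  a <= b -> germ_sum A a s @[s --> vanishing_mesh a b] --> l ->
  sewing_lim a b A = l.
Proof.
by move=> ab; apply: cvg_lim => //; exact: vanishing_mesh_proper.
Qed.

Lemma mesh_small theta C e : 1 < theta -> 0 <= C -> 0 < e ->
  exists2 d, 0 < d & C * d `^ (theta - 1) <= e.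
Proof.
move=> th1 C0 e0; have C1 : 0 < C + 1 by lra.
exists ((e / (C + 1)) `^ (theta - 1)^-1); first by rewrite powR_gt0// divr_gt0.
rewrite -powRrM mulVf; last by rewrite gt_eqF; lra.
rewrite powRr1; last by rewrite divr_ge0 ?ltW.
rewrite mulrA ler_pdivrMr//; nra.
Qed.

Lemma sewing_cvg (A : R -> R -> R) C theta t0 t1 a b :
  1 < theta -> 0 <= C -> almost_additive A C theta t0 t1 ->
  t0 <= a -> a <= b -> b <= t1 ->
  cvg (germ_sum A a s @[s --> vanishing_mesh a b]).
Proof.
move=> th1 C0 hA ta ab bt.
have FF := vanishing_mesh_proper ab.
apply/cauchy_cvgP/cauchy_exP => e e0.
have K0 := sewing_cst_ge0 th1.
have M0 : 0 <= 2 * (sewing_cst theta * C * (b - a)).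
  apply: mulr_ge0 => //; apply: mulr_ge0; last by lra.
  exact: mulr_ge0.
have e2 : 0 < e / 2 by lra.
have [d d0 Hd] := mesh_small th1 M0 e2.
have [s [ps fs]] := exists_fine_partition ab d0.
exists (germ_sum A a s); exists d => // s' [ps' fs'] /=.
have [r [pr sr s'r]] := itv_partition_common_refinement ps ps'.
have h := sewing_refine th1 C0 hA ta bt ps fs pr sr.
have h' := sewing_refine th1 C0 hA ta bt ps' fs' pr s'r.
rewrite -ball_normE /=.
have -> : germ_sum A a s - germ_sum A a s' =
  (germ_sum A a r - germ_sum A a s') - (germ_sum A a r - germ_sum A a s) by ring.
rewrite (le_lt_trans (ler_normB _ _))//; lra.
Qed.

(** Concatenating partitions of two adjacent intervals gives one of their union,
    so limits of Riemann sums are additive in the interval. *)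
Lemma sewing_cvg_add (W : normedModType R) (A : R -> R -> W) a b c (l l' l'' : W) :
  a <= b -> b <= c ->
  germ_sum A a s @[s --> vanishing_mesh a b] --> l ->
  germ_sum A b s @[s --> vanishing_mesh b c] --> l' ->
  germ_sum A a s @[s --> vanishing_mesh a c] --> l'' -> l'' = l + l'.
Proof.
move=> ab bc /cvg_vanishing_meshP h /cvg_vanishing_meshP h' /cvg_vanishing_meshP h''.
apply/eqP; rewrite -subr_eq0 -normr_le0; apply/ler_addgt0Pr => e e0; rewrite add0r.
have e3 : 0 < e / 3 by lra.
have [d d0 hd] := h _ e3; have [d' d'0 hd'] := h' _ e3; have [d'' d''0 hd''] := h'' _ e3.
pose m := Num.min d (Num.min d' d'').
have m0 : 0 < m by rewrite !lt_min d0 d'0 d''0.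
have [s [ps fs]] := exists_fine_partition ab m0.
have [s' [ps' fs']] := exists_fine_partition bc m0.
have lb : last a s = b by case: ps => _ /eqP.
have H := hd s ps (sub_mesh_lt _ fs).
have H' := hd' s' ps' (sub_mesh_lt _ fs').
have H'' := hd'' (s ++ s') (itv_partition_cat ps ps').
rewrite mesh_lt_cat lb (sub_mesh_lt _ fs) ?(sub_mesh_lt _ fs') in H''; last 2 first.
- by rewrite /m !ge_min lexx !orbT.
- by rewrite /m !ge_min lexx !orbT.
have {H''} := H'' isT; have {H'} := H' ltac:(by rewrite /m !ge_min lexx !orbT).
have {H} := H ltac:(by rewrite /m !ge_min lexx).
rewrite germ_sum_cat lb => H H' H''.
have -> : l'' - (l + l') = (l'' - (germ_sum A a s + germ_sum A b s'))
   - ((l - germ_sum A a s) + (l' - germ_sum A b s')).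
  by rewrite (addrACA l) -(opprD (germ_sum A a s)) opprB subrKA.
rewrite (le_trans (ler_normB _ _))// (le_trans (lerD (lexx _) (ler_normD _ _)))//.
lra.
Qed.

(** Germs at distance O(|v - u|^theta), theta > 1, have the same sewing limit.
    A limit is computed by finding a path whose increments are equivalent to the
    germ. *)
Definition germ_equiv (W : normedModType R) theta t0 t1 (A B : R -> R -> W) :=
  exists C, 0 <= C /\ forall u v, t0 <= u -> u <= v -> v <= t1 ->
    `|A u v - B u v| <= C * (v - u) `^ theta.

Definition incr (W : normedModType R) (J : R -> W) (u v : R) : W := J v - J u.

(** The sewing lemma: up to a superlinear error, an almost additive germ is the
    increment of a path, namely of its sewing limit from the left endpoint. *)
Lemma sewing (A : R -> R -> R) C theta t0 t1 :
  1 < theta -> 0 <= C -> almost_additive A C theta t0 t1 ->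
  exists J : R -> R, forall u v, t0 <= u -> u <= v -> v <= t1 ->
    `|A u v - incr J u v| <= sewing_cst theta * C * (v - u) `^ theta.
Proof.
move=> th1 C0 hA; exists (fun t => sewing_lim t0 t A) => u v tu uv vt.
have cv (x y : R) : t0 <= x -> x <= y -> y <= t1 ->
  germ_sum A x s @[s --> vanishing_mesh x y] --> sewing_lim x y A.
  by move=> *; apply: sewing_cvg th1 C0 hA _ _ _.
rewrite /incr (sewing_cvg_add tu uv (cv _ _ _ _ _) (cv _ _ _ _ _) (cv _ _ _ _ _)) //; try lra.
rewrite addrAC subrr add0r.
have /cvg_vanishing_meshP h := cv u v tu uv vt.
apply/ler_addgt0Pr => e e0; have [d d0 hd] := h e e0.
have [s [ps fs]] := exists_fine_partition uv d0.
have := hd s ps fs; have := sewing_bound th1 C0 hA tu vt ps.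
rewrite distrC => h1 h2.
have -> : A u v - sewing_lim u v A =
  (A u v - germ_sum A u s) - (sewing_lim u v A - germ_sum A u s) by ring.
by rewrite (le_trans (ler_normB _ _))// lerD.
Qed.

Lemma germ_sum_incr (W : normedModType R) (J : R -> W) a b s :
  itv_partition a b s -> germ_sum (incr J) a s = J b - J a.
Proof.
elim: s a => [|x s IHs] a ps.
  by rewrite (itv_partition_nil ps) germ_sum_nil subrr.
move: ps => /itv_partition_consP[_ ps].
by rewrite germ_sum_cons IHs // /incr addrC subrKA.
Qed.

Lemma germ_sumD (W : normedModType R) (A B : R -> R -> W) a s :
  germ_sum (fun u v => A u v + B u v) a s = germ_sum A a s + germ_sum B a s.
Proof.
elim: s a => [|x s IHs] a; first by rewrite !germ_sum_nil addr0.
by rewrite !germ_sum_cons IHs addrACA.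
Qed.

Lemma germ_sumZ (W : normedModType R) k (A : R -> R -> W) a s :
  germ_sum (fun u v => k *: A u v) a s = k *: germ_sum A a s.
Proof.
elim: s a => [|x s IHs] a; first by rewrite !germ_sum_nil scaler0.
by rewrite !germ_sum_cons IHs scalerDr.
Qed.

Lemma germ_sum_incr_le (W : normedModType R) (A : R -> R -> W) J C theta t0 t1 d a b s :
  1 < theta -> 0 <= C ->
  (forall u v, t0 <= u -> u <= v -> v <= t1 ->
    `|A u v - incr J u v| <= C * (v - u) `^ theta) ->
  t0 <= a -> b <= t1 -> itv_partition a b s -> mesh_lt d a s ->
  `|germ_sum A a s - (J b - J a)| <= C * d `^ (theta - 1) * (b - a).
Proof.
move=> th1 C0 hA ta bt ps fs.
rewrite -(germ_sum_incr J ps) -scaleN1r -germ_sumZ -germ_sumD.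
apply: (germ_sum_le th1 C0 _ ta bt ps fs) => u v tu uv vt.
by rewrite scaleN1r; exact: hA.
Qed.

Lemma germ_equiv_cvg (W : normedModType R) (A : R -> R -> W) J theta t0 t1 a b :
  1 < theta -> germ_equiv theta t0 t1 A (incr J) ->
  t0 <= a -> a <= b -> b <= t1 ->
  germ_sum A a s @[s --> vanishing_mesh a b] --> J b - J a.
Proof.
move=> th1 [C [C0 hA]] ta ab bt; apply/cvg_vanishing_meshP => e e0.
have M0 : 0 <= C * (b - a) by rewrite mulr_ge0// subr_ge0.
have [d d0 Hd] := mesh_small th1 M0 e0.
exists d => // s ps fs; rewrite distrC.
have := germ_sum_incr_le th1 C0 hA ta bt ps fs => /le_trans; apply.
by rewrite mulrAC.
Qed.

(** The converse of [sewing]: the errors along a partition add up to a positive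
    power of the mesh, so an approximating path determines the limit on every
    subinterval. *)
Lemma germ_equiv_sewing_lim (W : normedModType R) (A : R -> R -> W) J theta t0 t1 a b :
  1 < theta -> germ_equiv theta t0 t1 A (incr J) ->
  t0 <= a -> a <= b -> b <= t1 -> sewing_lim a b A = J b - J a.
Proof.
move=> th1 hA ta ab bt; apply: sewing_limE => //.
exact: germ_equiv_cvg th1 hA ta ab bt.
Qed.

End SewingLimit.

(** * Differentiating a sewing limit with respect to a parameter *)

Section SewingDerivative.
Context {R : realType}.
Implicit Types (a b c d C theta : R) (s : seq R).

(** An epsilon-delta form of differentiability at 0, needed because in
    [sewing_lim_is_derive] the remainder is estimated in two pieces. *)
Lemma is_derive_near0P (f : R -> R) (l : R) :
  is_derive (0 : R) (1 : R) f l <->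
  forall e, 0 < e -> exists2 d, 0 < d &
    forall h, `|h| < d -> `|f h - f 0 - h * l| <= e * `|h|.
Proof.
split=> [[df dl] e e0|hf].
  have /cvg_ex [/= m hm] := df; move: (hm).
  have -> : m = l by rewrite -dl; apply/esym; apply: cvg_lim hm.
  move=> /cvgrPdist_le /(_ e e0) [d /= d0 hd].
  exists d => // h hhd; have [->|h0] := eqVneq h 0.
    by rewrite mul0r subr0 subrr !normr0 mulr0.
  have := hd h; rewrite /= sub0r normrN => /(_ hhd h0).
  rewrite addr0 /GRing.scale /= mulr1 => H.
  have -> : f h - f 0 - h * l = - (h * (l - h^-1 * (f h - f 0))).
    by field.
  by rewrite normrN normrM mulrC ler_wpM2r.
have H : h^-1 *: (f (h *: 1 + 0) - f 0) @[h --> (0 : R)^'] --> l.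
  apply/cvgrPdist_le => e e0; have [d d0 hd] := hf e e0.
  exists d => // h /=; rewrite sub0r normrN => hhd h0.
  rewrite addr0 /GRing.scale /= mulr1.
  have -> : l - h^-1 * (f h - f 0) = - (h^-1 * (f h - f 0 - h * l)) by field.
  rewrite normrN normrM normfV -ler_pdivlMl ?invr_gt0 ?normr_gt0//.
  by rewrite invrK [leRHS]mulrC; exact: hd.
apply: DeriveDef; first by apply/cvg_ex; exists l.
exact: cvg_lim H.
Qed.

Lemma is_derive_mulr (k x : R) : is_derive x (1 : R) (fun e => e * k) k.
Proof.
have -> : (fun e : R => e * k) = k \*: (id : R -> R).
  by apply/funext => e; rewrite /GRing.scale /= mulrC.
by apply: trigger_derive; rewrite /GRing.scale /= mulr1.
Qed.

Lemma norm_le_derive (f df : R -> R) (M r h : R) :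
  (forall x, `|x| < r -> is_derive x (1 : R) f (df x)) ->
  (forall x, `|x| < r -> `|df x| <= M) ->
  `|h| < r -> `|f h - f 0| <= M * `|h|.
Proof.
move=> hf hM hr.
have cf (x y : R) : `|x| < r -> `|y| < r -> {within `[x, y], continuous f}.
  move=> xr yr; apply: derivable_within_continuous => z.
  rewrite in_itv /= => /andP[xz zy].
  suff /hf[] : `|z| < r by [].
  by move: xr yr; rewrite !ltr_norml => /andP[? ?] /andP[? ?]; apply/andP; split; lra.
have r0 : `|0 : R| < r by rewrite normr0 (le_lt_trans _ hr).
have inr (x y z : R) : `|x| < r -> `|y| < r -> z \in `[x, y] -> `|z| < r.
  move=> xr yr; rewrite in_itv /= => /andP[xz zy].
  by move: xr yr; rewrite !ltr_norml => /andP[? ?] /andP[? ?]; apply/andP; split; lra.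
have [h0|h0] := leP 0 h.
  have [|c hc ->] := @MVT_segment R f df 0 h h0 _ (cf _ _ r0 hr).
    by move=> x /subset_itv_oo_cc hx; apply: hf; exact: inr hx.
  by rewrite subr0 normrM ler_wpM2r// hM//; exact: inr hc.
have [|c hc] := @MVT_segment R f df h 0 (ltW h0) _ (cf _ _ hr r0).
  by move=> x /subset_itv_oo_cc hx; apply: hf; exact: inr hx.
rewrite distrC => ->.
by rewrite sub0r normrM normrN ler_wpM2r// hM//; exact: inr hc.
Qed.

Lemma sewing_lim_dist (A : R -> R -> R) C theta t0 t1 d a b s :
  1 < theta -> 0 <= C -> almost_additive A C theta t0 t1 ->
  t0 <= a -> b <= t1 -> itv_partition a b s -> mesh_lt d a s ->
  `|germ_sum A a s - sewing_lim a b A| <=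
    sewing_cst theta * C * d `^ (theta - 1) * (b - a).
Proof.
move=> th1 C0 hA ta bt ps fs; have K0 := sewing_cst_ge0 th1.
have [J hJ] := sewing th1 C0 hA.
rewrite (germ_equiv_sewing_lim th1 _ ta (itv_partition_le ps) bt (J := J)); last first.
  by exists (sewing_cst theta * C); split => //; exact: mulr_ge0.
by apply: germ_sum_incr_le th1 (mulr_ge0 K0 C0) hJ ta bt ps fs.
Qed.

Lemma germ_sum_is_derive (A : R -> R -> R -> R) (B : R -> R -> R) t0 t1 (x : R) a b s :
  (forall u v, t0 <= u -> u <= v -> v <= t1 ->
     is_derive x (1 : R) (fun e => A e u v) (B u v)) ->
  t0 <= a -> b <= t1 -> itv_partition a b s ->
  is_derive x (1 : R) (fun e => germ_sum (A e) a s) (germ_sum B a s).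
Proof.
move=> hA; elim: s a => [|y s IHs] a ta bt ps.
  rewrite germ_sum_nil; under eq_fun do rewrite germ_sum_nil.
  exact: is_derive_cst.
move: ps => /itv_partition_consP[ay ps]; have yb := itv_partition_le ps.
rewrite germ_sum_cons; under eq_fun do rewrite germ_sum_cons.
apply: is_deriveD; first by apply: hA; lra.
by apply: IHs => //; lra.
Qed.

(** The remainder A h - A 0 - h B 0 has a defect of size O(|h|), by the mean
    value theorem applied to the defect as a function of the parameter. Its
    Riemann sum along a partition therefore differs from its limit by |h| times a
    power of the mesh, uniformly in h; fix a partition for which this is a small
    multiple of |h|, and use that the Riemann sum along that one partition is
    differentiable. *)
Lemma sewing_lim_is_derive (A B : R -> R -> R -> R) C theta t0 t1 :
  1 < theta -> 0 <= C -> t0 <= t1 ->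
  (forall e, `|e| < 1 -> almost_additive (A e) C theta t0 t1) ->
  (forall e, `|e| < 1 -> almost_additive (B e) C theta t0 t1) ->
  (forall e u v, `|e| < 1 -> t0 <= u -> u <= v -> v <= t1 ->
     is_derive e (1 : R) (fun e => A e u v) (B e u v)) ->
  is_derive (0 : R) (1 : R) (fun e => sewing_lim t0 t1 (A e)) (sewing_lim t0 t1 (B 0)).
Proof.
move=> th1 C0 t01 hA hB dA; have K0 := sewing_cst_ge0 th1.
have n01 : `|0 : R| < 1 by rewrite normr0.
(* The germ of the first-order Taylor remainder in the parameter. *)
pose Q h u v := A h u v + ((-1) *: A 0 u v + (- h) *: B 0 u v).
have hQ h : `|h| < 1 -> almost_additive (Q h) (2 * C * `|h|) theta t0 t1.
  move=> h1 u m v tu um mv vt.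
  pose f e := defect (A e) u m v - e * defect (B 0) u m v.
  have -> : defect (Q h) u m v = f h - f 0.
    by rewrite /f /Q /defect /GRing.scale /=; ring.
  have -> : 2 * C * `|h| * (v - u) `^ theta = 2 * C * (v - u) `^ theta * `|h| by ring.
  apply: (@norm_le_derive f
    (fun e => defect (B e) u m v - defect (B 0) u m v) _ 1) => // x x1.
    have d1 := dA x u v x1 tu ltac:(lra) vt.
    have d2 := dA x u m x1 tu um ltac:(lra).
    have d3 := dA x m v x1 ltac:(lra) mv vt.
    rewrite /f /defect; apply: is_deriveB.
    exact: is_derive_mulr.
  rewrite (le_trans (ler_normB _ _))//.
  have := hB x x1 u m v tu um mv vt; have := hB 0 n01 u m v tu um mv vt.
  lra.
have limQ h : `|h| < 1 -> sewing_lim t0 t1 (Q h) =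
    sewing_lim t0 t1 (A h) - sewing_lim t0 t1 (A 0) - h * sewing_lim t0 t1 (B 0).
  move=> h1; have cv (G : R -> R -> R) : almost_additive G C theta t0 t1 ->
      germ_sum G t0 s @[s --> vanishing_mesh t0 t1] --> sewing_lim t0 t1 G.
    by move=> hG; apply: sewing_cvg th1 C0 hG _ _ _.
  have PF := vanishing_mesh_proper t01.
  apply: sewing_limE => //.
  rewrite /Q; under eq_fun do rewrite !germ_sumD !germ_sumZ.
  have -> : sewing_lim t0 t1 (A h) - sewing_lim t0 t1 (A 0) - h * sewing_lim t0 t1 (B 0)
    = sewing_lim t0 t1 (A h) + ((-1) *: sewing_lim t0 t1 (A 0)
        + (- h) *: sewing_lim t0 t1 (B 0)).
    by rewrite /GRing.scale /=; ring.
  apply: cvgD; first exact/cv/hA.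
  by apply: cvgD; apply: cvgZr; apply: cv; [exact: hA|exact: hB].
apply/is_derive_near0P => e e0.
have M0 : 0 <= sewing_cst theta * (2 * C) * (t1 - t0).
  apply: mulr_ge0; last by lra.
  by apply: mulr_ge0 => //; lra.
have e2 : 0 < e / 2 by lra.
have [d d0 Hd] := mesh_small th1 M0 e2.
have [s [ps fs]] := exists_fine_partition t01 d0.
have /is_derive_near0P/(_ _ e2)[r r0 hr] :=
  germ_sum_is_derive (fun u v => dA 0 u v n01) (lexx t0) (lexx t1) ps.
exists (Num.min r 1); first by rewrite lt_min r0 ltr01.
move=> h; rewrite lt_min => /andP[hhr h1].
rewrite -limQ//.
have hC0 : 0 <= 2 * C * `|h| by rewrite !mulr_ge0.
have D1 := sewing_lim_dist th1 hC0 (hQ h h1) (lexx t0) (lexx t1) ps fs.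
have := hr h hhr.
have -> : germ_sum (A h) t0 s - germ_sum (A 0) t0 s - h * germ_sum (B 0) t0 s =
   germ_sum (Q h) t0 s.
  by rewrite /Q !germ_sumD !germ_sumZ /GRing.scale /=; ring.
move=> D2.
have D3 := ler_wpM2r (normr_ge0 h) Hd.
have -> : sewing_lim t0 t1 (Q h) =
  germ_sum (Q h) t0 s - (germ_sum (Q h) t0 s - sewing_lim t0 t1 (Q h)) by ring.
rewrite (le_trans (ler_normB _ _))//; lra.
Qed.

End SewingDerivative.

(** * Taylor estimates and symmetry of second derivatives *)

Section Calculus.
Context {R : realType} {E : normedModType R}.
Implicit Types (F G : E -> R) (x y z v w : E).

Lemma smooth_differentiable F x : smooth F -> differentiable F x.
Proof. by move=> /(_ 1%N)[]. Qed.

Lemma smooth_derivable F x v : smooth F -> derivable F x v.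
Proof. by move=> hF; exact/diff_derivable/smooth_differentiable. Qed.

Lemma smooth_continuous F : smooth F -> continuous F.
Proof. by move=> /(_ 0%N). Qed.

Lemma smooth_derive F v : smooth F -> smooth (fun x => 'D_v F x).
Proof. by move=> hF k; case: (hF k.+1) => _; apply. Qed.

Lemma is_derive_sumf (V : normedModType R) (I : finType) (h : I -> V -> R)
    (dh : I -> R) (a u : V) :
  (forall i, is_derive a u (h i) (dh i)) ->
  is_derive a u (fun b => \sum_i h i b) (\sum_i dh i).
Proof.
move=> hd.
have -> : (fun b => \sum_i h i b) = \sum_i h i by apply/funext => b; rewrite fct_sumE.
by elim/big_ind2 : _ => // [|] *; [exact: is_derive_cst|exact: is_deriveD].
Qed.

(** The difference quotient of the restriction of F to a line is literally that
    of the directional derivative. *)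
Lemma is_derive_line F x y (s : R) : derivable F (x + s *: y) y ->
  is_derive s (1 : R) (fun r : R => F (x + r *: y)) ('D_y F (x + s *: y)).
Proof.
move=> dF.
have e : (fun h : R => h^-1 *: (F (x + (h *: (1 : R) + s) *: y) - F (x + s *: y))) =
    (fun h : R => h^-1 *: (F (h *: y + (x + s *: y)) - F (x + s *: y))).
  apply/funext => h; congr (_ *: (F _ - _)).
  by rewrite -[h *: (1 : R)]/(h * 1) mulr1 scalerDl addrCA.
apply: DeriveDef; first by rewrite /derivable /= e.
by rewrite /derive /= e.
Qed.

Lemma mean_value_line F x y (s : R) : (forall z, differentiable F z) -> 0 <= s ->
  exists r, [/\ 0 <= r, r <= s & F (x + s *: y) - F x = s * 'D_y F (x + r *: y)].
Proof.
move=> dF s0; pose f (r : R) := F (x + r *: y).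
have df (r : R) : is_derive r (1 : R) f ('D_y F (x + r *: y)).
  exact/is_derive_line/diff_derivable/dF.
have cf : {within `[0, s], continuous f}.
  by apply: derivable_within_continuous => r _; have [] := df r.
have [r] := MVT_segment s0 (fun r _ => df r) cf.
rewrite in_itv /= => /andP[r0 rs]; rewrite /f scale0r addr0 subr0 => ->.
by exists r; split => //; rewrite mulrC.
Qed.

(** The mean value theorem applied twice, first in the direction v to the
    increment of F in the direction w. *)
Lemma mixed_difference F x v w (s : R) : smooth F -> 0 <= s ->
  exists r r', [/\ 0 <= r <= s, 0 <= r' <= s &
    F (x + s *: w + s *: v) - F (x + s *: w) - (F (x + s *: v) - F x) =
    s * (s * 'D_w (fun z => 'D_v F z) (x + r *: v + r' *: w))].
Proof.
move=> hF s0; pose G z := F (z + s *: w) - F z.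
have dsh z u : is_derive z u (fun z => F (z + s *: w)) ('D_u F (z + s *: w)).
  have e : (fun h : R => h^-1 *: (F (h *: u + z + s *: w) - F (z + s *: w))) =
      (fun h : R => h^-1 *: (F (h *: u + (z + s *: w)) - F (z + s *: w))).
    by apply/funext => h; rewrite addrA.
  apply: DeriveDef.
    by rewrite /derivable /= e; exact: smooth_derivable.
  by rewrite /derive /= e.
have dG z : differentiable G z.
  apply: differentiableB; last exact: smooth_differentiable.
  by apply: differentiable_comp; [exact: differentiableD|exact: smooth_differentiable].
have [r [r0 rs hr]] := mean_value_line x v dG s0.
have [r' [r'0 r's hr']] := mean_value_line (x + r *: v) w
   (fun z => smooth_differentiable z (smooth_derive v hF)) s0.
exists r, r'; rewrite r0 rs r'0 r's; split=> //.
rewrite -hr'; move: hr.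
have -> : 'D_v G (x + r *: v) = 'D_v F (x + r *: v + s *: w) - 'D_v F (x + r *: v).
  have d1 := dsh (x + r *: v) v.
  have d2 : is_derive (x + r *: v) v F ('D_v F (x + r *: v)).
    exact/derivableP/smooth_derivable.
  exact: derive_val.
rewrite /G => <-; rewrite (addrAC x (s *: w)).
by move: (F _) (F _) (F _) (F _) => *; ring.
Qed.

(** Schwarz's theorem: the second difference of F is symmetric in v and w and,
    by [mixed_difference], equals s^2 times either mixed derivative at points
    converging to x. It is what makes the derivative in eps of the Gubinelli
    derivative of F(X) equal to the Gubinelli derivative of the derivative. *)
Lemma derive_comm F x v w : smooth F ->
  'D_w (fun z => 'D_v F z) x = 'D_v (fun z => 'D_w F z) x.
Proof.
move=> hF; apply/eqP; rewrite -subr_eq0 -normr_le0; apply/ler_addgt0Pr => e e0.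
rewrite add0r.
have cvw := smooth_continuous (smooth_derive w (smooth_derive v hF)).
have cwv := smooth_continuous (smooth_derive v (smooth_derive w hF)).
have e2 : 0 < e / 2 by lra.
have /cvgrPdist_le/(_ _ e2)/nbhs_ballP[d /= d0 hd] := cvw x.
have /cvgrPdist_le/(_ _ e2)/nbhs_ballP[d' /= d'0 hd'] := cwv x.
(* A step for which the intermediate points of both expansions lie within
   the two moduli of continuity of x. *)
pose s := Num.min d d' / (2 * (`|v| + `|w| + 1)).
have n0 : 0 < 2 * (`|v| + `|w| + 1).
  by have := normr_ge0 v; have := normr_ge0 w; lra.
have m0 : 0 < Num.min d d' by rewrite lt_min d0.
have s0 : 0 < s by rewrite divr_gt0.
have close r r' : 0 <= r <= s -> 0 <= r' <= s ->
    `|r *: v + r' *: w| < Num.min d d'.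
  move=> /andP[r0 rs] /andP[r'0 r's].
  rewrite (le_lt_trans (ler_normD _ _))// !normrZ !ger0_norm//.
  have -> : Num.min d d' = s * (2 * (`|v| + `|w| + 1)).
    by rewrite /s divfK// gt_eqF.
  have := ler_wpM2r (normr_ge0 v) rs; have := ler_wpM2r (normr_ge0 w) r's.
  have := mulr_ge0 (ltW s0) (normr_ge0 v); have := mulr_ge0 (ltW s0) (normr_ge0 w).
  lra.
have [r [r' [hr hr' E1]]] := mixed_difference x v w hF (ltW s0).
have [q [q' [hq hq' E2]]] := mixed_difference x w v hF (ltW s0).
have {E1 E2} E12 : 'D_w (fun z => 'D_v F z) (x + r *: v + r' *: w) =
    'D_v (fun z => 'D_w F z) (x + q *: w + q' *: v).
  have sn0 : s != 0 by rewrite gt_eqF.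
  apply: (mulfI sn0); apply: (mulfI sn0).
  apply: etrans (esym E1) (etrans _ E2); rewrite (addrAC x (s *: w)).
  by move: (F _) (F _) (F _) (F _) => *; ring.
have inb (u : E) (rr : R) : `|u| < rr -> ball x rr (x + u).
  by rewrite -ball_normE /= opprD addNKr normrN.
have B1 : `|'D_w (fun z => 'D_v F z) x -
    'D_w (fun z => 'D_v F z) (x + r *: v + r' *: w)| <= e / 2.
  apply: hd; rewrite -addrA; apply: inb.
  by apply: lt_le_trans (close _ _ hr hr') _; rewrite ge_min lexx.
have B2 : `|'D_v (fun z => 'D_w F z) x -
    'D_v (fun z => 'D_w F z) (x + q *: w + q' *: v)| <= e / 2.
  apply: hd'; rewrite -addrA (addrC (q *: w)); apply: inb.
  by apply: lt_le_trans (close _ _ hq' hq) _; rewrite ge_min lexx orbT.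
rewrite -E12 in B2.
apply: le_trans (ler_distD _ _ _) _; rewrite [leRHS]splitr.
by apply: lerD; [exact: B1|rewrite distrC].
Qed.




(** The bounds on F that control the composition with a controlled path:
    they are linear in the direction(s), with one constant on the whole ball. *)
Definition C2_bounded F (r M : R) := 0 <= M /\ forall x, `|x| <= r ->
  (forall y, `|'D_y F x| <= M * `|y|) /\
  (forall y z, `|'D_z (fun x' => 'D_y F x') x| <= M * `|y| * `|z|).

Lemma ball_segment (r : R) x y (s : R) : `|x| <= r -> `|x + y| <= r ->
  0 <= s -> s <= 1 -> `|x + s *: y| <= r.
Proof.
move=> xr xyr s0 s1.
have -> : x + s *: y = (1 - s) *: x + s *: (x + y).
  by rewrite scalerDr addrA -scalerDl subrK scale1r.
rewrite (le_trans (ler_normD _ _))// !normrZ !ger0_norm ?subr_ge0//.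
have := ler_wpM2l s0 xyr; have := ler_wpM2l (_ : 0 <= 1 - s) xr.
by move=> /(_ ltac:(lra)); lra.
Qed.

Lemma C2_bounded_increment F (r M : R) x y : smooth F -> C2_bounded F r M ->
  `|x| <= r -> `|x + y| <= r -> `|F (x + y) - F x| <= M * `|y|.
Proof.
move=> hF [M0 hM] xr xyr.
have [s [s0 s1]] := mean_value_line x y (fun z => smooth_differentiable z hF) ler01.
rewrite scale1r mul1r => ->.
by have [h _] := hM _ (ball_segment xr xyr s0 s1); exact: h.
Qed.

Lemma C2_bounded_derive_increment F (r M : R) x y w : smooth F -> C2_bounded F r M ->
  `|x| <= r -> `|x + y| <= r ->
  `|'D_w F (x + y) - 'D_w F x| <= M * `|w| * `|y|.
Proof.
move=> hF [M0 hM] xr xyr.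
have [s [s0 s1]] := mean_value_line x y
  (fun z => smooth_differentiable z (smooth_derive w hF)) ler01.
rewrite scale1r mul1r => ->.
by have [_ h] := hM _ (ball_segment xr xyr s0 s1); exact: h.
Qed.

Lemma C2_bounded_taylor F (r M : R) x y : smooth F -> C2_bounded F r M ->
  `|x| <= r -> `|x + y| <= r ->
  `|F (x + y) - F x - 'D_y F x| <= M * `|y| * `|y|.
Proof.
move=> hF hM xr xyr.
have [s [s0 s1]] := mean_value_line x y (fun z => smooth_differentiable z hF) ler01.
rewrite scale1r mul1r => ->.
have := C2_bounded_derive_increment y hF hM xr (ball_segment xr xyr s0 s1).
move=> /le_trans; apply; rewrite normrZ ger0_norm//.
have h := mulr_ge0 (mulr_ge0 (proj1 hM) (normr_ge0 y)) (normr_ge0 y).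
by have := ler_wpM2l h s1; lra.
Qed.

End Calculus.

(** * Coordinates and local bounds on phase space *)

Section PhaseSpace.
Context {R : realType} {N : nat}.
Local Notation V := 'rV[R]_N.
Implicit Types (F G : V * V -> R) (x y z : V * V).

Lemma row_coord_le (n : nat) (x : 'rV[R]_n) i : `|x 0 i| <= `|x|.
Proof.
rewrite [leRHS]/Num.Def.normr /= mx_normrE.
exact: (le_bigmax _ (fun ij : 'I_1 * 'I_n => `|x ij.1 ij.2|) (0, i)).
Qed.

Lemma row_norm_le (n : nat) (x : 'rV[R]_n) c : 0 <= c ->
  (forall i, `|x 0 i| <= c) -> `|x| <= c.
Proof.
move=> c0 h; rewrite [leLHS]/Num.Def.normr /= mx_normrE.
by apply: bigmax_le => // -[i j] _ /=; rewrite (ord1 i).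
Qed.

Lemma fst_norm_le x : `|x.1| <= `|x|.
Proof. by rewrite prod_normE le_max lexx. Qed.

Lemma snd_norm_le x : `|x.2| <= `|x|.
Proof. by rewrite prod_normE le_max lexx orbT. Qed.

(** The canonical basis of phase space; inl indexes positions, inr momenta. *)
Definition pbasis (k : 'I_N + 'I_N) : V * V :=
  match k with inl i => (delta_mx 0 i, 0) | inr i => (0, delta_mx 0 i) end.

Definition pcoord (k : 'I_N + 'I_N) x : R :=
  match k with inl i => x.1 0 i | inr i => x.2 0 i end.

Lemma pcoord_le k x : `|pcoord k x| <= `|x|.
Proof.
case: k => i /=.
  exact: le_trans (row_coord_le _ _) (fst_norm_le _).
exact: le_trans (row_coord_le _ _) (snd_norm_le _).
Qed.

Lemma pbasis_sum x : x = \sum_k pcoord k x *: pbasis k.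
Proof.
rewrite big_sumType /=.
have -> : \sum_i x.1 0 i *: ((delta_mx 0 i, 0) : V * V) = (x.1, 0).
  rewrite {2}(row_sum_delta x.1).
  elim/big_ind2 : _ => // [u v u' v' -> ->|i _].
    by congr (_, _); rewrite addr0.
  by congr (_, _); rewrite /= scaler0.
have -> : \sum_i x.2 0 i *: ((0, delta_mx 0 i) : V * V) = (0, x.2).
  rewrite {2}(row_sum_delta x.2).
  elim/big_ind2 : _ => // [u v u' v' -> ->|i _].
    by congr (_, _); rewrite addr0.
  by congr (_, _); rewrite /= scaler0.
by case: x => a b; congr (_, _); rewrite /= ?addr0 ?add0r.
Qed.

Lemma derive_pcoord F x y : differentiable F x ->
  'D_y F x = \sum_k pcoord k y * 'D_(pbasis k) F x.
Proof.
move=> dF; rewrite deriveE// {1}(pbasis_sum y) linear_sum.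
by apply: eq_bigr => k _; rewrite linearZ /= deriveE.
Qed.

Lemma continuous_bounded_ball F (r : R) : continuous F ->
  exists2 M, 0 <= M & forall x, `|x| <= r -> `|F x| <= M.
Proof.
move=> cF; pose A := [set v : V | forall i, v ord0 i \in `[(- r), r]%R].
have cA : compact A.
  apply: (@rV_compact _  _ (fun=> `[(- r), r]%classic)) => _.
  exact: segment_compact.
have /compact_bounded[M [_ hM]] : compact (F @` (A `*` A)).
  apply: continuous_compact; last exact: compact_setX.
  exact: continuous_subspaceT.
exists (`|M| + 1) => [|x xr]; first by have := normr_ge0 M; lra.
apply: (hM (`|M| + 1)); first by have := ler_norm M; lra.
exists x => //; split => i; rewrite in_itv /= -ler_norml.
  by apply: le_trans xr; exact: le_trans (row_coord_le _ _) (fst_norm_le _).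
by apply: le_trans xr; exact: le_trans (row_coord_le _ _) (snd_norm_le _).
Qed.

(** Expanding the directions in the canonical basis reduces the claim to finitely
    many continuous functions on a compact ball. *)
Lemma smooth_C2_bounded F (r : R) : smooth F -> exists M, C2_bounded F r M.
Proof.
move=> hF.
have h1 k := continuous_bounded_ball r
  (smooth_continuous (smooth_derive (pbasis k) hF)).
have h2 k l := continuous_bounded_ball r
  (smooth_continuous (smooth_derive (pbasis l) (smooth_derive (pbasis k) hF))).
pose M1 k := sval (cid2 (h1 k)); pose M2 k l := sval (cid2 (h2 k l)).
have M1P k : 0 <= M1 k /\ forall x, `|x| <= r -> `|'D_(pbasis k) F x| <= M1 k.
  by rewrite /M1; case: cid2.
have M2P k l : 0 <= M2 k l /\ forall x, `|x| <= r ->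
    `|'D_(pbasis l) (fun z => 'D_(pbasis k) F z) x| <= M2 k l.
  by rewrite /M2; case: cid2.
have S1 : 0 <= \sum_k M1 k by apply: sumr_ge0 => k _; case: (M1P k).
have S2 : 0 <= \sum_k \sum_l M2 k l.
  by apply: sumr_ge0 => k _; apply: sumr_ge0 => l _; case: (M2P k l).
exists (\sum_k M1 k + \sum_k \sum_l M2 k l); split; first exact: addr_ge0.
move=> x xr; split=> [y|y z].
  rewrite derive_pcoord; last exact: smooth_differentiable.
  apply: (@le_trans _ _ ((\sum_k M1 k) * `|y|)); last first.
    by rewrite ler_wpM2r// lerDl.
  rewrite mulr_suml (le_trans (ler_norm_sum _ _ _))// ler_sum// => k _.
  rewrite normrM mulrC ler_pM// ?pcoord_le//.
  by have [_] := M1P k; apply.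
have -> : 'D_z (fun x' => 'D_y F x') x =
    \sum_k pcoord k y * \sum_l pcoord l z * 'D_(pbasis l) (fun x' => 'D_(pbasis k) F x') x.
  have -> : (fun x' => 'D_y F x') = (fun x' => \sum_k pcoord k y * 'D_(pbasis k) F x').
    by apply/funext => x'; apply: derive_pcoord; exact: smooth_differentiable.
  have hd k : is_derive x z (fun x' => pcoord k y * 'D_(pbasis k) F x')
      (pcoord k y * 'D_z (fun x' => 'D_(pbasis k) F x') x).
    apply: is_deriveZ; apply/derivableP/smooth_derivable; exact: smooth_derive.
  rewrite (derive_val (is_derive := is_derive_sumf hd)).
  apply: eq_bigr => k _; congr (_ * _).
  by apply: derive_pcoord; apply/smooth_differentiable/smooth_derive.
apply: (@le_trans _ _ ((\sum_k \sum_l M2 k l) * `|y| * `|z|)); last first.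
  by rewrite ler_wpM2r// ler_wpM2r// lerDr.
rewrite -mulrA mulr_suml (le_trans (ler_norm_sum _ _ _))// ler_sum// => k _.
rewrite normrM mulrCA ler_pM// ?pcoord_le//.
rewrite mulr_suml (le_trans (ler_norm_sum _ _ _))// ler_sum// => l _.
rewrite normrM mulrC ler_pM// ?pcoord_le//.
by have [_] := M2P k l; apply.
Qed.

End PhaseSpace.

(** * Orders of smallness *)

Section Orders.
Context {R : realType}.
Variables (t0 t1 : R).

(** Estimates for defects quantify over a parameter in (-1, 1) and three ordered
    times. Packing them in one record lets orders of smallness be computed by
    rules on functions of a single argument, uniformly in the parameter. *)
Record triple := Triple { tr_eps : R; tr_u : R; tr_m : R; tr_v : R }.

Definition admissible (x : triple) := [/\ `|tr_eps x| < 1,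
  t0 <= tr_u x, tr_u x <= tr_m x, tr_m x <= tr_v x & tr_v x <= t1].

(** f is O(|v - u|^b), uniformly over admissible triples. *)
Definition has_order (W : normedModType R) (b : R) (f : triple -> W) :=
  exists C, 0 <= C /\
    forall x, admissible x -> `|f x| <= C * (tr_v x - tr_u x) `^ b.

Section Rules.
Context {W : normedModType R}.
Implicit Types (f g : triple -> W) (b c : R).

Lemma has_order_dominated (W' : normedModType R) b f (g : triple -> W') (k : R) :
  0 <= k -> (forall x, admissible x -> `|f x| <= k * `|g x|) ->
  has_order b g -> has_order b f.
Proof.
move=> k0 fg [C [C0 hC]]; exists (k * C); split; first exact: mulr_ge0.
move=> x hx; rewrite (le_trans (fg x hx))// -mulrA ler_wpM2l//; exact: hC.
Qed.

Lemma has_order_ext b f g : (forall x, admissible x -> f x = g x) ->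
  has_order b g -> has_order b f.
Proof.
move=> fg; apply: (@has_order_dominated _ _ _ _ 1) => // x hx.
by rewrite fg// mul1r.
Qed.

Lemma has_orderD b f g : has_order b f -> has_order b g ->
  has_order b (fun x => f x + g x).
Proof.
move=> [C [C0 hC]] [C' [C'0 hC']]; exists (C + C'); split; first exact: addr_ge0.
move=> x hx; rewrite (le_trans (ler_normD _ _))// mulrDl lerD//; [exact: hC|exact: hC'].
Qed.

Lemma has_orderN b f : has_order b f -> has_order b (fun x => - f x).
Proof.
by apply: (@has_order_dominated _ _ _ _ 1) => // x hx; rewrite normrN mul1r.
Qed.

Lemma has_orderB b f g : has_order b f -> has_order b g ->
  has_order b (fun x => f x - g x).
Proof. by move=> hf hg; apply: has_orderD => //; exact: has_orderN. Qed.

Lemma has_order_sum (I : finType) b (f : I -> triple -> W) :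
  (forall i, has_order b (f i)) -> has_order b (fun x => \sum_i f i x).
Proof.
move=> hf; have [C hC] := choice hf.
exists (\sum_i C i); split; first by apply: sumr_ge0 => i _; case: (hC i).
move=> x hx; rewrite mulr_suml (le_trans (ler_norm_sum _ _ _))// ler_sum// => i _.
by have [_ ->] := hC i.
Qed.

Lemma has_order_weaken b c f : 0 <= c -> c <= b -> has_order b f -> has_order c f.
Proof.
move=> c0 cb [C [C0 hC]]; exists (C * (t1 - t0) `^ (b - c)); split.
  by rewrite mulr_ge0// powR_ge0.
move=> x hx; rewrite (le_trans (hC x hx))// -mulrA ler_wpM2l//.
case: hx => _ h1 h2 h3 h4.
move: cb; rewrite le_eqVlt => /orP[/eqP<-|cb].
  by rewrite subrr powRr0 mul1r.
have -> : (tr_v x - tr_u x) `^ b =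
    (tr_v x - tr_u x) `^ (b - c) * (tr_v x - tr_u x) `^ c.
  rewrite -powRD subrK//; by apply/implyP => /eqP b0; exfalso; lra.
rewrite ler_wpM2r ?powR_ge0//; apply: ge0_ler_powR; rewrite ?nnegrE; lra.
Qed.

End Rules.

Lemma has_orderZ (W : normedModType R) b c (f : triple -> R) (g : triple -> W) :
  0 <= b -> 0 <= c -> has_order b f -> has_order c g ->
  has_order (b + c) (fun x => f x *: g x).
Proof.
move=> b0 c0 [C [C0 hC]] [C' [C'0 hC']]; exists (C * C'); split; first exact: mulr_ge0.
move=> x hx; rewrite normrZ.
have -> : (tr_v x - tr_u x) `^ (b + c) =
    (tr_v x - tr_u x) `^ b * (tr_v x - tr_u x) `^ c.
  have [w0|w0] := eqVneq (tr_v x - tr_u x) 0; last by rewrite powRD// w0 implybT.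
  rewrite w0; have [->|bn] := eqVneq b 0; first by rewrite add0r powRr0 mul1r.
  have bp : 0 < b by rewrite lt_def bn.
  have bc : b + c != 0 by rewrite gt_eqF//; lra.
  by rewrite (powR0 bn) (powR0 bc) mul0r.
by rewrite mulrACA ler_pM//; [exact: hC|exact: hC'].
Qed.

Lemma has_orderM b c (f g : triple -> R) : 0 <= b -> 0 <= c ->
  has_order b f -> has_order c g -> has_order (b + c) (fun x => f x * g x).
Proof. exact: has_orderZ. Qed.

Lemma has_order_coord b (n : nat) (f : triple -> 'rV[R]_n) i :
  has_order b f -> has_order b (fun x => f x 0 i).
Proof.
apply: (@has_order_dominated _ _ _ _ _ 1) => // x _.
by rewrite mul1r; exact: row_coord_le.
Qed.

Lemma has_order_entry b (n m : nat) (f : triple -> 'M[R]_(n, m)) i j :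
  has_order b f -> has_order b (fun x => f x i j).
Proof.
apply: (@has_order_dominated _ _ _ _ _ 1) => // x _.
rewrite mul1r [leRHS]/Num.Def.normr /= mx_normrE.
exact: (le_bigmax _ (fun ij : 'I_n * 'I_m => `|f x ij.1 ij.2|) (i, j)).
Qed.

Lemma has_order_pair (V W : normedModType R) b (f : triple -> V) (g : triple -> W) :
  has_order b f -> has_order b g -> has_order b (fun x => (f x, g x)).
Proof.
move=> [C [C0 hC]] [C' [C'0 hC']]; exists (C + C'); split; first exact: addr_ge0.
move=> x hx; rewrite prod_normE /= mulrDl.
have := hC x hx; have := hC' x hx.
have : 0 <= C * (tr_v x - tr_u x) `^ b by rewrite mulr_ge0// powR_ge0.
have : 0 <= C' * (tr_v x - tr_u x) `^ b by rewrite mulr_ge0// powR_ge0.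
by move=> h1 h2 h3 h4; rewrite ge_max; apply/andP; split; lra.
Qed.

(** Selects the interval between two of the three times. Bounds on the
    subinterval are bounds in terms of the full gap v - u. *)
Definition subinterval (s t : triple -> R) := forall x, admissible x ->
  [/\ tr_u x <= s x, s x <= t x & t x <= tr_v x].

Lemma subinterval_um : subinterval tr_u tr_m.
Proof. by move=> x []. Qed.
Lemma subinterval_mv : subinterval tr_m tr_v.
Proof. by move=> x []. Qed.
Lemma subinterval_uv : subinterval tr_u tr_v.
Proof. by move=> x [_ _ h1 h2 _]; split => //; exact: le_trans h1 h2. Qed.

Lemma holder_bound_has_order (W : normedModType R) b (A : R -> R -> W) s t :
  0 <= b -> subinterval s t -> holder_bound b t0 t1 A ->
  has_order b (fun x => A (s x) (t x)).
Proof.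
move=> b0 st [C hC]; exists `|C|; split => // x hx.
have [h1 h2 h3] := st x hx; case: hx => _ h4 h5 h6 h7.
rewrite (le_trans (hC (s x) (t x) _ _))//.
- by rewrite in_itv /=; apply/andP; split; lra.
- by rewrite in_itv /=; apply/andP; split; lra.
apply: (@le_trans _ _ (`|C| * `|t x - s x| `^ b)).
  by rewrite ler_wpM2r ?powR_ge0// ler_norm.
rewrite ler_wpM2l// ger0_norm ?subr_ge0//.
by apply: ge0_ler_powR; rewrite ?nnegrE; lra.
Qed.

Lemma holder_has_order0 (W : normedModType R) b (f : R -> W) s t : 0 <= b ->
  t0 <= t1 -> subinterval s t -> holder b t0 t1 f ->
  has_order 0 (fun x => f (s x)) /\ has_order 0 (fun x => f (t x)).
Proof.
move=> b0 t01 st [C hC].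
have key (r : triple -> R) : (forall x, admissible x -> t0 <= r x <= t1) ->
    has_order 0 (fun x => f (r x)).
  move=> hr; exists (`|f t0| + `|C| * (t1 - t0) `^ b); split.
    by rewrite addr_ge0// mulr_ge0// powR_ge0.
  move=> x hx; rewrite powRr0 mulr1; have /andP[r0 r1] := hr x hx.
  have -> : f (r x) = f t0 + (f (r x) - f t0) by rewrite addrC subrK.
  rewrite (le_trans (ler_normD _ _))// lerD2l.
  rewrite (le_trans (hC t0 (r x) _ _))// ?in_itv /= ?lexx ?r0 ?r1 ?t01//.
  apply: (@le_trans _ _ (`|C| * `|r x - t0| `^ b)).
    by rewrite ler_wpM2r ?powR_ge0// ler_norm.
  rewrite ler_wpM2l// ger0_norm ?subr_ge0//.
  by apply: ge0_ler_powR; rewrite ?nnegrE; lra.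
by split; apply: key => x hx; have [h1 h2 h3] := st x hx;
  case: hx => _ h4 h5 h6 h7; apply/andP; split; lra.
Qed.

Definition unif_additive (b : R) (A : R -> R -> R -> R) :=
  has_order b (fun x => defect (A (tr_eps x)) (tr_u x) (tr_m x) (tr_v x)).

Lemma unif_additiveP b A : unif_additive b A <-> exists C, 0 <= C /\
  forall e, `|e| < 1 -> almost_additive (A e) C b t0 t1.
Proof.
split=> [[C [C0 hC]]|[C [C0 hC]]]; exists C; split => //.
  by move=> e e1 u m v *; apply: (hC (Triple e u m v)); split.
by move=> [e u m v] [/= e1 *]; apply: hC.
Qed.

Lemma germ_equivP (W : normedModType R) b (A B : R -> R -> W) :
  germ_equiv b t0 t1 A B <->
  has_order b (fun x => A (tr_u x) (tr_v x) - B (tr_u x) (tr_v x)).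
Proof.
split=> [[C [C0 hC]]|[C [C0 hC]]]; exists C; split => //.
  by move=> x [_ h1 h2 h3 h4]; apply: hC => //; exact: le_trans h2 h3.
move=> u v tu uv vt; apply: (hC (Triple 0 u u v)).
by split; rewrite ?normr0.
Qed.

Lemma unif_additiveD b A B : unif_additive b A -> unif_additive b B ->
  unif_additive b (fun e u v => A e u v + B e u v).
Proof.
move=> hA hB; apply: has_order_ext (has_orderD hA hB) => x _.
by rewrite /defect; ring.
Qed.

Lemma unif_additiveN b A : unif_additive b A ->
  unif_additive b (fun e u v => - A e u v).
Proof.
move=> hA; apply: has_order_ext (has_orderN hA) => x _.
by rewrite /defect; ring.
Qed.

Lemma unif_additive_eps b A : unif_additive b A ->
  unif_additive b (fun e u v => e * A e u v).
Proof.
apply: (has_order_dominated ler01) => x [e1 _ _ _ _].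
have -> : defect (fun u v => tr_eps x * A (tr_eps x) u v) (tr_u x) (tr_m x) (tr_v x) =
    tr_eps x * defect (A (tr_eps x)) (tr_u x) (tr_m x) (tr_v x).
  by rewrite /defect; ring.
by rewrite normrM ler_wpM2r// ltW.
Qed.

Lemma unif_additive_sum (I : finType) b (A : I -> R -> R -> R -> R) :
  (forall i, unif_additive b (A i)) ->
  unif_additive b (fun e u v => \sum_i A i e u v).
Proof.
move=> hA; apply: has_order_ext (has_order_sum hA) => x _.
by rewrite /defect !sumrB.
Qed.

End Orders.

(** * Controlled paths and the pairing germ *)

Section Germs.
Context {R : realType} {K N : nat}.
Variables (alpha t0 t1 : R).
Hypotheses (alpha_gt0 : 0 < alpha) (alpha_le : alpha <= 2^-1) (ht : t0 <= t1).
Variable Z : rpath R K.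
Hypothesis hZ : geometric_rough_path alpha t0 t1 Z.
Local Notation has_order := (has_order t0 t1).
Local Notation subinterval := (subinterval t0 t1).
Local Notation unif_additive := (unif_additive t0 t1).
Local Notation E := ('rV[R]_N * 'rV[R]_N)%type.

Let alpha_ge0 : 0 <= alpha. Proof. exact: ltW. Qed.

Lemma rough_path_order s t i : subinterval s t ->
  has_order alpha (fun x => (Z (t x) - Z (s x)) 0 i).
Proof.
move=> st; case: hZ => h _ _ _; apply: has_order_coord.
exact: (holder_bound_has_order alpha_ge0 st h).
Qed.

Lemma rough_area_order s t i j : subinterval s t ->
  has_order (2 * alpha) (fun x => rp_area Z (s x) (t x) i j).
Proof.
move=> st; case: hZ => _ h _ _; apply: has_order_entry.
by apply: (holder_bound_has_order _ st h); rewrite mulr_ge0.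
Qed.

Lemma rough_area_chen x i j : admissible t0 t1 x ->
  rp_area Z (tr_u x) (tr_v x) i j =
  rp_area Z (tr_u x) (tr_m x) i j + rp_area Z (tr_m x) (tr_v x) i j +
  (Z (tr_m x) - Z (tr_u x)) 0 i * (Z (tr_v x) - Z (tr_m x)) 0 j.
Proof.
move=> [_ h1 h2 h3 h4]; case: hZ => _ _ h _.
rewrite (h (tr_u x) (tr_m x) (tr_v x)).
- by rewrite !mxE big_ord1 !mxE.
- by rewrite in_itv /=; apply/andP; split; lra.
- by rewrite in_itv /=; apply/andP; split; lra.
- by rewrite in_itv /=; apply/andP; split; lra.
Qed.

Lemma has_order_holder_family (W : normedModType R) b (f : R -> R -> W) e :
  has_order b (fun x => f (tr_eps x) (tr_m x) - f (tr_eps x) (tr_u x)) ->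
  `|e| < 1 -> holder b t0 t1 (f e).
Proof.
move=> [C [C0 hC]] e1; exists C => s t.
rewrite !in_itv /= => /andP[s0 s1] /andP[r0 r1].
have [st|/ltW ts] := leP s t.
  have := hC (Triple e s t t); rewrite /= ger0_norm ?subr_ge0//; apply.
  by split.
have := hC (Triple e t s s); rewrite /= (distrC (f e s)) (distrC t s).
by rewrite (@ger0_norm _ (s - t)) ?subr_ge0//; apply; split.
Qed.

Lemma has_order_holder (W : normedModType R) b (f : R -> W) :
  has_order b (fun x => f (tr_m x) - f (tr_u x)) -> holder b t0 t1 f.
Proof.
by move=> h; apply: (has_order_holder_family (f := fun=> f) h (e := 0)); rewrite normr0.
Qed.

Section ControlledPaths.
Context {W : normedModType R}.
Implicit Types Y : cpath R K W.

Lemma controlled_der_order Y i s t : controlled alpha t0 t1 Z Y ->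
  subinterval s t -> has_order alpha (fun x => cp_der Y i (t x) - cp_der Y i (s x)).
Proof.
by move=> [h _] st; exact: (holder_bound_has_order alpha_ge0 st (h i)).
Qed.

Lemma controlled_der_bounded Y i s t : controlled alpha t0 t1 Z Y ->
  subinterval s t ->
  has_order 0 (fun x => cp_der Y i (s x)) /\ has_order 0 (fun x => cp_der Y i (t x)).
Proof. by move=> [h _] st; exact: (holder_has_order0 alpha_ge0 ht st (h i)). Qed.

Lemma controlled_remainder_order Y s t : controlled alpha t0 t1 Z Y ->
  subinterval s t -> has_order (2 * alpha) (fun x => Y (t x) - Y (s x) -
    \sum_i (Z (t x) - Z (s x)) 0 i *: cp_der Y i (s x)).
Proof.
move=> [_ h] st.
apply: (holder_bound_has_order _ st h).
by rewrite mulr_ge0.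
Qed.

(** The Gubinelli expansion: a bounded derivative times an increment of Z, plus
    a remainder of twice the order. *)
Lemma controlled_increment_order Y s t : controlled alpha t0 t1 Z Y ->
  subinterval s t -> has_order alpha (fun x => Y (t x) - Y (s x)).
Proof.
move=> hY st.
apply: (has_order_ext (g := fun x => (Y (t x) - Y (s x) -
    \sum_i (Z (t x) - Z (s x)) 0 i *: cp_der Y i (s x)) +
    \sum_i (Z (t x) - Z (s x)) 0 i *: cp_der Y i (s x))).
  by move=> x _; rewrite subrK.
apply: has_orderD.
  apply: has_order_weaken (controlled_remainder_order hY st) => //.
  by have := alpha_ge0; lra.
apply: has_order_sum => i; rewrite -[alpha]addr0; apply: has_orderZ => //.
  exact: rough_path_order.
by have [] := controlled_der_bounded i hY st.
Qed.

Lemma controlled_holder Y : controlled alpha t0 t1 Z Y -> holder alpha t0 t1 Y.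
Proof.
move=> hY; apply: has_order_holder.
by apply: (controlled_increment_order hY); exact: subinterval_um.
Qed.

End ControlledPaths.

Lemma controlled_pair (V W : normedModType R) (X : cpath R K V) (Y : cpath R K W) :
  controlled alpha t0 t1 Z X -> controlled alpha t0 t1 Z Y ->
  controlled alpha t0 t1 Z (cpath_pair X Y).
Proof.
have bound (b : R) (A : R -> R -> V) (B : R -> R -> W) : holder_bound b t0 t1 A ->
    holder_bound b t0 t1 B -> holder_bound b t0 t1 (fun s t => (A s t, B s t)).
  move=> [C hC] [C' hC']; exists (Num.max C C') => s t hs hr.
  rewrite prod_normE /= ge_max; apply/andP; split.
    by rewrite (le_trans (hC s t hs hr))// ler_wpM2r ?powR_ge0// le_max lexx.
  by rewrite (le_trans (hC' s t hs hr))// ler_wpM2r ?powR_ge0// le_max lexx orbT.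
move=> [hX hX2] [hY hY2]; split=> [i|]; first exact: (bound _ _ _ (hX i) (hY i)).
have [C hC] := bound _ _ _ hX2 hY2; exists C => s t hs hr.
apply: le_trans (hC s t hs hr).
suff -> : \sum_i (Z t - Z s) 0 i *: cp_der (cpath_pair X Y) i s =
  (\sum_i (Z t - Z s) 0 i *: cp_der X i s, \sum_i (Z t - Z s) 0 i *: cp_der Y i s) by [].
by elim/big_rec3 : _ => // i a b c _ ->.
Qed.

(** Young's condition: the defect of f dg is minus a product of increments of f
    and of g. *)
Lemma holder_product_additive (a b : R) (f g : R -> R) :
  0 <= a -> 0 <= b -> 3 * alpha <= a + b ->
  holder a t0 t1 f -> holder b t0 t1 g ->
  unif_additive (3 * alpha) (fun _ u v => f u * (g v - g u)).
Proof.
move=> a0 b0 ab hf hg.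
apply: (has_order_ext (g := fun x => - ((f (tr_m x) - f (tr_u x)) *
   (g (tr_v x) - g (tr_m x))))).
  by move=> x _; rewrite /defect; ring.
apply: has_orderN; apply: (@has_order_weaken _ _ _ _ (a + b)) => //.
  by rewrite mulr_ge0.
apply: has_orderM => //.
  exact: (holder_bound_has_order a0 (@subinterval_um _ t0 t1) hf).
exact: (holder_bound_has_order b0 (@subinterval_mv _ t0 t1) hg).
Qed.

(** As in [holder_product_additive], the defect of f A is f times that of A up to
    a product of increments; since f is Lipschitz that product has
    order 1 + alpha, which is at least 3 alpha. *)
Lemma additive_scale (f : R -> R) (A : R -> R -> R -> R) :
  holder 1 t0 t1 f -> unif_additive (3 * alpha) A ->
  has_order alpha (fun x => A (tr_eps x) (tr_m x) (tr_v x)) ->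
  unif_additive (3 * alpha) (fun e u v => f u * A e u v).
Proof.
move=> hf hA hA1.
have a3 : 0 <= 3 * alpha by rewrite mulr_ge0.
apply: (has_order_ext (g := fun x => f (tr_u x) *
     defect (A (tr_eps x)) (tr_u x) (tr_m x) (tr_v x)
   - (f (tr_m x) - f (tr_u x)) * A (tr_eps x) (tr_m x) (tr_v x))).
  by move=> x _; rewrite /defect; ring.
apply: has_orderB.
  rewrite -[3 * alpha]add0r; apply: has_orderM => //.
  by have [] := holder_has_order0 ler01 ht (@subinterval_um _ t0 t1) hf.
apply: (@has_order_weaken _ _ _ _ (1 + alpha)) => //.
  by have := alpha_le; lra.
apply: has_orderM => //.
exact: (holder_bound_has_order ler01 (@subinterval_um _ t0 t1) hf).
Qed.

(** In the defect, the product of the increments of p and q is cancelled to second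
    order by the product of increments of Z coming from Chen's relation; what is
    left pairs each first-order factor with a remainder. *)
Lemma pairing_additive (p q : cpath R K R) :
  controlled alpha t0 t1 Z p -> controlled alpha t0 t1 Z q ->
  unif_additive (3 * alpha) (fun _ u v => p u * (q v - q u) +
    \sum_i \sum_j rp_area Z u v i j * (cp_der p i u * cp_der q j u)).
Proof.
move=> hp hq; have a2 : 0 <= 2 * alpha by rewrite mulr_ge0.
have um := @subinterval_um _ t0 t1; have mv := @subinterval_mv _ t0 t1.
pose dZ x i := (Z (tr_m x) - Z (tr_u x)) 0 i.
pose dZ' x i := (Z (tr_v x) - Z (tr_m x)) 0 i.
pose rp x := p (tr_m x) - p (tr_u x) - \sum_i dZ x i * cp_der p i (tr_u x).
pose rq x := q (tr_v x) - q (tr_m x) - \sum_i dZ' x i * cp_der q i (tr_m x).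
pose sp x := \sum_i dZ x i * cp_der p i (tr_u x).
apply: (has_order_ext (g := fun x =>
   - (rp x * (q (tr_v x) - q (tr_m x))) - sp x * rq x
   - sp x * (\sum_j dZ' x j * (cp_der q j (tr_m x) - cp_der q j (tr_u x)))
   - \sum_i \sum_j rp_area Z (tr_m x) (tr_v x) i j *
       (cp_der p i (tr_m x) * (cp_der q j (tr_m x) - cp_der q j (tr_u x)) +
        (cp_der p i (tr_m x) - cp_der p i (tr_u x)) * cp_der q j (tr_u x)))).
  move=> x hx.
  have e1 : \sum_j dZ' x j * (cp_der q j (tr_m x) - cp_der q j (tr_u x)) =
      \sum_j dZ' x j * cp_der q j (tr_m x) - \sum_j dZ' x j * cp_der q j (tr_u x).
    by rewrite -sumrB; apply: eq_bigr => j _; rewrite mulrBr.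
  have e2 : \sum_i \sum_j rp_area Z (tr_u x) (tr_v x) i j *
         (cp_der p i (tr_u x) * cp_der q j (tr_u x)) =
      \sum_i \sum_j rp_area Z (tr_u x) (tr_m x) i j *
         (cp_der p i (tr_u x) * cp_der q j (tr_u x)) +
      \sum_i \sum_j rp_area Z (tr_m x) (tr_v x) i j *
         (cp_der p i (tr_u x) * cp_der q j (tr_u x)) +
      sp x * \sum_j dZ' x j * cp_der q j (tr_u x).
    rewrite /sp mulr_suml -!big_split /=; apply: eq_bigr => i _.
    rewrite mulr_sumr -!big_split /=; apply: eq_bigr => j _.
    rewrite rough_area_chen// /dZ /dZ'.
    by move: (Z (tr_v x) - Z (tr_m x)) (Z (tr_m x) - Z (tr_u x)) => A B; ring.
  have e3 : \sum_i \sum_j rp_area Z (tr_m x) (tr_v x) i j *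
       (cp_der p i (tr_m x) * (cp_der q j (tr_m x) - cp_der q j (tr_u x)) +
        (cp_der p i (tr_m x) - cp_der p i (tr_u x)) * cp_der q j (tr_u x)) =
      \sum_i \sum_j rp_area Z (tr_m x) (tr_v x) i j *
         (cp_der p i (tr_m x) * cp_der q j (tr_m x)) -
      \sum_i \sum_j rp_area Z (tr_m x) (tr_v x) i j *
         (cp_der p i (tr_u x) * cp_der q j (tr_u x)).
    rewrite -sumrB; apply: eq_bigr => i _; rewrite -sumrB; apply: eq_bigr => j _.
    ring.
  rewrite /defect e1 e2 e3 /rp /rq -/(sp x).
  move: (\sum_i \sum_j _) (\sum_i \sum_j _) (\sum_i \sum_j _) (sp x).
  by move: (\sum_j _) (\sum_j _) => *; ring.
have dZo i : has_order alpha (fun x => dZ x i) by exact: rough_path_order.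
have dZ'o i : has_order alpha (fun x => dZ' x i) by exact: rough_path_order.
have pu i : has_order 0 (fun x => cp_der p i (tr_u x)).
  by have [] := controlled_der_bounded i hp um.
have pm i : has_order 0 (fun x => cp_der p i (tr_m x)).
  by have [] := controlled_der_bounded i hp um.
have qu i : has_order 0 (fun x => cp_der q i (tr_u x)).
  by have [] := controlled_der_bounded i hq um.
have spo : has_order alpha sp.
  apply: has_order_sum => i; rewrite -[alpha]addr0.
  exact: has_orderM.
have E3 : 3 * alpha = 2 * alpha + alpha by ring.
have E3' : 3 * alpha = alpha + 2 * alpha by ring.
have E2 : 2 * alpha = alpha + alpha by ring.
apply: has_orderB; last first.
  apply: has_order_sum => i; apply: has_order_sum => j; rewrite E3.
  apply: has_orderM => //; first exact: rough_area_order.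
  apply: has_orderD.
    rewrite -[alpha]add0r; apply: has_orderM => //.
    exact: controlled_der_order.
  rewrite -[alpha]addr0; apply: has_orderM => //.
  exact: controlled_der_order.
apply: has_orderB; last first.
  rewrite E3'; apply: has_orderM => //; apply: has_order_sum => j.
  by rewrite E2; apply: has_orderM => //; exact: controlled_der_order.
apply: has_orderB; last first.
  rewrite E3'; apply: has_orderM => //.
  exact: (controlled_remainder_order hq mv).
apply: has_orderN; rewrite E3; apply: has_orderM => //.
  exact: (controlled_remainder_order hp um).
exact: (controlled_increment_order hq mv).
Qed.

End Germs.

(** * The germ of the Hamiltonian terms *)

Section HamiltonianGerm.
Context {R : realType} {K N : nat}.
Local Notation E := ('rV[R]_N * 'rV[R]_N)%type.

(** The germ of the integral of F0 dt plus F dZ along X. Treating the drift as one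
    more term of the germ avoids a separate treatment of the Lebesgue integral
    when the action is varied. *)
Definition ham_germ (Z : rpath R K) (F0 : E -> R) (F : 'I_K -> E -> R)
    (X : R -> E) (X' : 'I_K -> R -> E) (u v : R) : R :=
  (v - u) * F0 (X u) +
  (\sum_j (Z v - Z u) 0 j * F j (X u) +
   \sum_i \sum_j rp_area Z u v i j * 'D_(X' i u) (F j) (X u)).

Variables (alpha t0 t1 : R).
Hypotheses (alpha_gt0 : 0 < alpha) (alpha_le : alpha <= 2^-1) (ht : t0 <= t1).
Variable Z : rpath R K.
Hypothesis hZ : geometric_rough_path alpha t0 t1 Z.
Variables (Y : cpath R K E) (dY : R -> E).
Hypothesis hY : controlled alpha t0 t1 Z Y.
Hypothesis hdY : holder 1 t0 t1 dY.
Local Notation has_order := (has_order t0 t1).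
Local Notation subinterval := (subinterval t0 t1).
Local Notation unif_additive := (unif_additive t0 t1).
Local Notation X := (fun e t => Y t + e *: dY t).

Let alpha_ge0 : 0 <= alpha. Proof. exact: ltW. Qed.

Lemma eps_bounded : has_order 0 (fun x => tr_eps x).
Proof.
by exists 1; split => // -[e u m v] [/= h _ _ _ _]; rewrite powRr0 mulr1 ltW.
Qed.

Lemma shifted_bounded s t : subinterval s t ->
  has_order 0 (fun x => X (tr_eps x) (s x)) /\ has_order 0 (fun x => X (tr_eps x) (t x)).
Proof.
move=> st.
have [y1 y2] := holder_has_order0 alpha_ge0 ht st (controlled_holder alpha_gt0 ht hZ hY).
have [d1 d2] := holder_has_order0 ler01 ht st hdY.
split; apply: has_orderD => //; rewrite -[X in has_order X _]addr0.
  by apply: has_orderZ => //; exact: eps_bounded.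
by apply: has_orderZ => //; exact: eps_bounded.
Qed.

Lemma shifted_radius s t : subinterval s t -> exists r, forall x, admissible t0 t1 x ->
  `|X (tr_eps x) (s x)| <= r /\ `|X (tr_eps x) (t x)| <= r.
Proof.
move=> st; have [[C [C0 hC]] [C' [C'0 hC']]] := shifted_bounded st.
exists (C + C') => x hx.
have := hC x hx; have := hC' x hx; rewrite powRr0 !mulr1 => h1 h2.
by split; lra.
Qed.

(** A Lipschitz perturbation has order 1, hence order 2 alpha since
    alpha is at most 1/2; so Y + eps dY is controlled with the derivative of Y,
    uniformly in eps. *)
Lemma shifted_remainder_order s t : subinterval s t ->
  has_order (2 * alpha) (fun x => X (tr_eps x) (t x) - X (tr_eps x) (s x) -
    \sum_i (Z (t x) - Z (s x)) 0 i *: cp_der Y i (s x)).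
Proof.
move=> st.
apply: (has_order_ext (g := fun x => (Y (t x) - Y (s x) -
    \sum_i (Z (t x) - Z (s x)) 0 i *: cp_der Y i (s x)) +
    tr_eps x *: (dY (t x) - dY (s x)))).
  move=> x _; rewrite [RHS]addrAC; congr (_ - _).
  by rewrite scalerBr opprD addrACA.
apply: has_orderD; first exact: controlled_remainder_order.
apply: (@has_order_weaken _ _ _ _ (0 + 1)); [by rewrite mulr_ge0| |].
  by have := alpha_le; lra.
apply: has_orderZ => //; first exact: eps_bounded.
exact: (holder_bound_has_order ler01 st hdY).
Qed.

Lemma shifted_increment_order s t : subinterval s t ->
  has_order alpha (fun x => X (tr_eps x) (t x) - X (tr_eps x) (s x)).
Proof.
move=> st.
apply: (has_order_ext (g := fun x => (X (tr_eps x) (t x) - X (tr_eps x) (s x) -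
    \sum_i (Z (t x) - Z (s x)) 0 i *: cp_der Y i (s x)) +
    \sum_i (Z (t x) - Z (s x)) 0 i *: cp_der Y i (s x))).
  by move=> x _; rewrite subrK.
apply: has_orderD.
  apply: has_order_weaken (shifted_remainder_order st) => //.
  by have := alpha_ge0; lra.
apply: has_order_sum => i; rewrite -[alpha]addr0; apply: has_orderZ => //.
  exact: rough_path_order.
by have [] := controlled_der_bounded alpha_gt0 ht i hY st.
Qed.

Section Composition.
Variable F : E -> R.
Hypothesis hF : smooth F.

Lemma comp_bounded s t : subinterval s t ->
  has_order 0 (fun x => F (X (tr_eps x) (s x))).
Proof.
move=> st; have [r hr] := shifted_radius st.
have [M M0 hM] := continuous_bounded_ball r (smooth_continuous hF).
exists M; split => // x hx; rewrite powRr0 mulr1; apply: hM.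
by have [] := hr x hx.
Qed.

Lemma comp_increment_order s t : subinterval s t ->
  has_order alpha (fun x => F (X (tr_eps x) (t x)) - F (X (tr_eps x) (s x))).
Proof.
move=> st; have [r hr] := shifted_radius st.
have [M hM] := smooth_C2_bounded r hF.
apply: (has_order_dominated (proj1 hM) _ (shifted_increment_order st)) => x hx.
have [h1 h2] := hr x hx.
have := @C2_bounded_increment _ _ F r M _ (X (tr_eps x) (t x) - X (tr_eps x) (s x)) hF hM h1.
by rewrite [X in F X](addrC (X (tr_eps x) (s x))) subrK; apply; rewrite addrC subrK.
Qed.

Lemma comp_der_bounded i s t : subinterval s t ->
  has_order 0 (fun x => 'D_(cp_der Y i (s x)) F (X (tr_eps x) (s x))).
Proof.
move=> st; have [r hr] := shifted_radius st.
have [M hM] := smooth_C2_bounded r hF.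
have [d1 _] := controlled_der_bounded alpha_gt0 ht i hY st.
apply: (has_order_dominated (proj1 hM) _ d1) => x hx.
have [h1 _] := hr x hx.
by have [h _] := (proj2 hM) _ h1; exact: h.
Qed.

Lemma deriveBr (y z w : E) : 'D_(z - w) F y = 'D_z F y - 'D_w F y.
Proof.
have dF := smooth_differentiable y hF.
by rewrite !deriveE// linearB.
Qed.

Lemma comp_der_increment_order i s t : subinterval s t ->
  has_order alpha (fun x => 'D_(cp_der Y i (t x)) F (X (tr_eps x) (t x)) -
                            'D_(cp_der Y i (s x)) F (X (tr_eps x) (s x))).
Proof.
move=> st; have [r hr] := shifted_radius st.
have [M hM] := smooth_C2_bounded r hF.
have [d1 _] := controlled_der_bounded alpha_gt0 ht i hY st.
apply: (has_order_ext (g := fun x =>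
   'D_(cp_der Y i (t x) - cp_der Y i (s x)) F (X (tr_eps x) (t x)) +
   ('D_(cp_der Y i (s x)) F (X (tr_eps x) (t x)) -
    'D_(cp_der Y i (s x)) F (X (tr_eps x) (s x))))).
  by move=> x _; rewrite deriveBr addrA subrK.
apply: has_orderD.
  apply: (has_order_dominated (proj1 hM) _ (controlled_der_order alpha_gt0 i hY st)) => x hx.
  have [_ h1] := hr x hx.
  by have [h _] := (proj2 hM) _ h1; exact: h.
have o1 : has_order alpha (fun x => `|cp_der Y i (s x)| *:
    (X (tr_eps x) (t x) - X (tr_eps x) (s x))).
  rewrite -[alpha]add0r; apply: has_orderZ => //; last exact: shifted_increment_order.
  by apply: (has_order_dominated ler01 _ d1) => x hx; rewrite normr_id mul1r.
apply: (has_order_dominated (proj1 hM) _ o1) => x hx.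
have [h1 h2] := hr x hx.
have := @C2_bounded_derive_increment _ _ F r M _
   (X (tr_eps x) (t x) - X (tr_eps x) (s x)) (cp_der Y i (s x)) hF hM h1.
rewrite [X in 'D__ F X](addrC (X (tr_eps x) (s x))) subrK normrZ normr_id mulrA.
by apply; rewrite addrC subrK.
Qed.

(** Taylor's formula: the quadratic remainder has order 2 alpha, and in the linear
    term the increment of X may be replaced by its Gubinelli expansion. *)
Lemma comp_remainder_order s t : subinterval s t ->
  has_order (2 * alpha) (fun x => F (X (tr_eps x) (t x)) - F (X (tr_eps x) (s x)) -
    \sum_i (Z (t x) - Z (s x)) 0 i * 'D_(cp_der Y i (s x)) F (X (tr_eps x) (s x))).
Proof.
move=> st; have [r hr] := shifted_radius st.
have [M hM] := smooth_C2_bounded r hF.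
pose inc x := X (tr_eps x) (t x) - X (tr_eps x) (s x).
apply: (has_order_ext (g := fun x =>
   (F (X (tr_eps x) (t x)) - F (X (tr_eps x) (s x)) -
    'D_(inc x) F (X (tr_eps x) (s x))) +
   'D_(inc x - \sum_i (Z (t x) - Z (s x)) 0 i *: cp_der Y i (s x)) F
      (X (tr_eps x) (s x)))).
  move=> x _; rewrite (deriveBr _ (inc x)) addrA subrK; congr (_ - _).
  rewrite (deriveE _ (smooth_differentiable _ hF)) linear_sum.
  apply: eq_bigr => i _.
  by rewrite linearZ /= (deriveE _ (smooth_differentiable _ hF)).
apply: has_orderD; last first.
  apply: (has_order_dominated (proj1 hM) _ (shifted_remainder_order st)) => x hx.
  have [h1 _] := hr x hx.
  by have [h _] := (proj2 hM) _ h1; exact: h.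
have o1 : has_order (2 * alpha) (fun x => `|inc x| *: inc x).
  have -> : 2 * alpha = alpha + alpha by ring.
  apply: has_orderZ => //; last exact: shifted_increment_order.
  apply: (has_order_dominated ler01 _ (shifted_increment_order st)) => x hx.
  by rewrite normr_id mul1r.
apply: (has_order_dominated (proj1 hM) _ o1) => x hx.
have [h1 h2] := hr x hx.
have := @C2_bounded_taylor _ _ F r M _ (inc x) hF hM h1.
rewrite [X in F X](addrC (X (tr_eps x) (s x))) subrK normrZ normr_id mulrA.
by apply; rewrite addrC subrK.
Qed.

End Composition.

Variables (F0 : E -> R) (F : 'I_K -> E -> R).
Hypotheses (hF0 : smooth F0) (hF : forall j, smooth (F j)).

Lemma ham_germ_order s t : subinterval s t ->
  has_order alpha (fun x => ham_germ Z F0 F (X (tr_eps x)) (cp_der Y) (s x) (t x)).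
Proof.
move=> st.
have time : has_order 1 (fun x : triple => t x - s x).
  exists 1; split => // x hx; have [h5 h6 h7] := st x hx.
  case: hx => _ h1 h2 h3 h4.
  by rewrite powRr1 ?mul1r ?ger0_norm; lra.
apply: has_orderD; last apply: has_orderD.
- apply: (@has_order_weaken _ _ _ _ (1 + 0)) => //.
    by have := alpha_le; lra.
  by apply: has_orderM => //; exact: (comp_bounded hF0 st).
- apply: has_order_sum => j; rewrite -[alpha]addr0; apply: has_orderM => //.
    exact: rough_path_order.
  exact: (comp_bounded (hF j) st).
- apply: has_order_sum => i; apply: has_order_sum => j.
  apply: (@has_order_weaken _ _ _ _ (2 * alpha + 0)) => //.
    by have := alpha_ge0; lra.
  apply: has_orderM => //; first by rewrite mulr_ge0.
    exact: rough_area_order.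
  exact: (comp_der_bounded (hF j) i st).
Qed.

(** The algebra of the defect, with the values of F0, F and their derivatives at
    the times u and m left abstract: Chen's relation contributes the double
    product of increments of Z that completes the Gubinelli remainder. *)
Lemma ham_defect_expansion x (a b : R) (f g : 'I_K -> R) (f' g' : 'I_K -> 'I_K -> R) :
  admissible t0 t1 x ->
  let: Triple _ u m v := x in
  (v - u) * a + (\sum_j (Z v - Z u) 0 j * f j +
     \sum_i \sum_j rp_area Z u v i j * f' i j) -
  ((m - u) * a + (\sum_j (Z m - Z u) 0 j * f j +
     \sum_i \sum_j rp_area Z u m i j * f' i j)) -
  ((v - m) * b + (\sum_j (Z v - Z m) 0 j * g j +
     \sum_i \sum_j rp_area Z m v i j * g' i j)) =
  - ((v - m) * (b - a)) -
  \sum_j (Z v - Z m) 0 j * (g j - f j - \sum_i (Z m - Z u) 0 i * f' i j) -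
  \sum_i \sum_j rp_area Z m v i j * (g' i j - f' i j).
Proof.
case: x => e u m v hx.
have -> : \sum_j (Z v - Z u) 0 j * f j =
    \sum_j (Z m - Z u) 0 j * f j + \sum_j (Z v - Z m) 0 j * f j.
  rewrite -big_split /=; apply: eq_bigr => j _; rewrite !mxE; ring.
have -> : \sum_i \sum_j rp_area Z u v i j * f' i j =
    \sum_i \sum_j rp_area Z u m i j * f' i j +
    \sum_i \sum_j rp_area Z m v i j * f' i j +
    \sum_j (Z v - Z m) 0 j * \sum_i (Z m - Z u) 0 i * f' i j.
  have -> : \sum_j (Z v - Z m) 0 j * (\sum_i (Z m - Z u) 0 i * f' i j) =
      \sum_i \sum_j (Z m - Z u) 0 i * (Z v - Z m) 0 j * f' i j.
    rewrite exchange_big /=; apply: eq_bigr => j _; rewrite mulr_sumr.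
    by apply: eq_bigr => i _; rewrite mulrCA mulrA.
  rewrite -!big_split /=; apply: eq_bigr => i _.
  rewrite -!big_split /=; apply: eq_bigr => j _.
  by have /= -> := rough_area_chen hZ i j hx; rewrite -mulrDl -mulrDl.
have -> : \sum_j (Z v - Z m) 0 j * (g j - f j - \sum_i (Z m - Z u) 0 i * f' i j) =
    \sum_j (Z v - Z m) 0 j * g j - \sum_j (Z v - Z m) 0 j * f j -
    \sum_j (Z v - Z m) 0 j * \sum_i (Z m - Z u) 0 i * f' i j.
  by rewrite -!sumrB; apply: eq_bigr => j _; rewrite !mulrBr.
have -> : \sum_i \sum_j rp_area Z m v i j * (g' i j - f' i j) =
    \sum_i \sum_j rp_area Z m v i j * g' i j -
    \sum_i \sum_j rp_area Z m v i j * f' i j.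
  rewrite -sumrB; apply: eq_bigr => i _; rewrite -sumrB; apply: eq_bigr => j _.
  exact: mulrBr.
by ring.
Qed.

(** After Chen's relation the defect splits into an increment of F0 times a time
    step, an increment of Z times a Gubinelli remainder of F(X), and an area term
    times an increment of the Gubinelli derivative. The first has order
    1 + alpha and the others 3 alpha. *)
Lemma ham_germ_additive : unif_additive (3 * alpha)
  (fun e => ham_germ Z F0 F (X e) (cp_der Y)).
Proof.
have um := @subinterval_um _ t0 t1; have mv := @subinterval_mv _ t0 t1.
have a2 : 0 <= 2 * alpha by rewrite mulr_ge0.
have time : has_order 1 (fun x : triple => tr_v x - tr_m x).
  exists 1; split => // x [_ h1 h2 h3 h4].
  by rewrite powRr1 ?mul1r ?ger0_norm; lra.
pose f0 x := F0 (X (tr_eps x) (tr_m x)) - F0 (X (tr_eps x) (tr_u x)).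
pose dZ x i := (Z (tr_m x) - Z (tr_u x)) 0 i.
pose dZ' x i := (Z (tr_v x) - Z (tr_m x)) 0 i.
pose f j x := F j (X (tr_eps x) (tr_u x)).
pose g j x := F j (X (tr_eps x) (tr_m x)).
pose f' i j x := 'D_(cp_der Y i (tr_u x)) (F j) (X (tr_eps x) (tr_u x)).
pose g' i j x := 'D_(cp_der Y i (tr_m x)) (F j) (X (tr_eps x) (tr_m x)).
apply: (has_order_ext (g := fun x =>
   - ((tr_v x - tr_m x) * f0 x)
   - \sum_j dZ' x j * (g j x - f j x - \sum_i dZ x i * f' i j x)
   - \sum_i \sum_j rp_area Z (tr_m x) (tr_v x) i j * (g' i j x - f' i j x))).
  by case=> e u m v hx; exact: (ham_defect_expansion _ _ _ _ _ _ hx).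
have E3 : 3 * alpha = 2 * alpha + alpha by ring.
have E3' : 3 * alpha = alpha + 2 * alpha by ring.
apply: has_orderB; first apply: has_orderB.
- apply: has_orderN; apply: (@has_order_weaken _ _ _ _ (1 + alpha)) => //.
    by rewrite mulr_ge0.
    by have := alpha_le; lra.
  by apply: has_orderM => //; exact: (comp_increment_order hF0 um).
- apply: has_order_sum => j; rewrite E3'; apply: has_orderM => //.
    exact: rough_path_order.
  exact: (comp_remainder_order (hF j) um).
- apply: has_order_sum => i; apply: has_order_sum => j.
  rewrite E3; apply: has_orderM => //; first exact: rough_area_order.
  exact: (comp_der_increment_order (hF j) i um).
Qed.

End HamiltonianGerm.

(** * Lebesgue integrals as sewing limits *)

Section TimeIntegral.
Context {R : realType}.
Local Notation mu := (@lebesgue_measure R).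
Variables (t0 t1 : R).
Implicit Types f : R -> R.

Definition primitive f (t : R) : R := \int[mu]_(r in `[t0, t]) f r.

Lemma integrable_subitv f u v :
  mu.-integrable `[t0, t1] (EFin \o f) -> t0 <= u -> v <= t1 ->
  mu.-integrable `[u, v] (EFin \o f).
Proof.
move=> hf tu vt; apply: integrableS hf => //.
by apply: subset_itv; rewrite bnd_simp.
Qed.

Lemma primitive_incr f u v :
  mu.-integrable `[t0, t1] (EFin \o f) -> t0 <= u -> u <= v -> v <= t1 ->
  incr (primitive f) u v = \int[mu]_(r in `[u, v]) f r.
Proof.
move=> hf tu uv vt; rewrite /incr /primitive Rintegral_itvB.
- rewrite Rintegral_itv_obnd_cbnd//.
  apply: integrableS (integrable_subitv hf tu vt) => //.
  by apply: subset_itv; rewrite bnd_simp.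
- exact: (integrable_subitv hf (lexx _) vt).
- by rewrite bnd_simp.
- by rewrite bnd_simp.
Qed.

Lemma mu_itv (u v : R) : u <= v -> fine (mu `[u, v]) = v - u.
Proof.
move=> uv; rewrite lebesgue_measure_itv /= lte_fin.
move: uv; rewrite le_eqVlt => /orP[/eqP->|uv]; first by rewrite ltxx subrr.
by rewrite uv.
Qed.

Lemma integrable_cst_itv (u v c : R) : mu.-integrable `[u, v] (EFin \o (fun=> c)).
Proof.
apply: continuous_compact_integrable; first exact: segment_compact.
by apply: continuous_subspaceT => x; exact: cvg_cst.
Qed.

Lemma primitive_incr_ge f u v (c : R) :
  mu.-integrable `[t0, t1] (EFin \o f) -> t0 <= u -> u <= v -> v <= t1 ->
  (forall x, u <= x -> x <= v -> c <= f x) ->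
  c * (v - u) <= incr (primitive f) u v.
Proof.
move=> hf tu uv vt hc; rewrite primitive_incr// -(mu_itv uv) -Rintegral_cst//.
apply: le_Rintegral => //; first exact: integrable_cst_itv.
  exact: integrable_subitv hf tu vt.
by move=> x /=; rewrite in_itv /= => /andP[]; exact: hc.
Qed.

Lemma primitive_incr_le f u v (c : R) :
  mu.-integrable `[t0, t1] (EFin \o f) -> t0 <= u -> u <= v -> v <= t1 ->
  (forall x, u <= x -> x <= v -> f x <= c) ->
  incr (primitive f) u v <= c * (v - u).
Proof.
move=> hf tu uv vt hc; rewrite primitive_incr// -(mu_itv uv) -Rintegral_cst//.
apply: le_Rintegral => //; last first.
- by move=> x /=; rewrite in_itv /= => /andP[]; exact: hc.
- exact: integrable_cst_itv.
exact: integrable_subitv hf tu vt.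
Qed.

Lemma holder_continuous_within (W : normedModType R) b (f : R -> W) :
  0 < b -> holder b t0 t1 f -> {within `[t0, t1], continuous f}.
Proof.
move=> b0 [C hC]; apply/subspace_continuousP => x hx.
apply/cvgrPdist_le => e e0.
have b1 : 1 < 1 + b by lra.
have [d d0 hd] := mesh_small b1 (normr_ge0 C) e0.
exists d => //= y /= xy hy.
rewrite distrC (le_trans (hC x y _ _))//; apply: le_trans hd.
have -> : 1 + b - 1 = b by ring.
apply: (@le_trans _ _ (`|C| * `|y - x| `^ b)).
  by rewrite ler_wpM2r ?powR_ge0// ler_norm.
rewrite ler_wpM2l//; apply: ge0_ler_powR; rewrite ?nnegrE; [exact: ltW|by []|exact: ltW|].
by rewrite distrC ltW.
Qed.

Lemma continuous_integrable f : {within `[t0, t1], continuous f} ->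
  mu.-integrable `[t0, t1] (EFin \o f).
Proof. by apply: continuous_compact_integrable; exact: segment_compact. Qed.

(** The oscillation of a b-Hoelder function on [u, v] is O(|v - u|^b), so its
    integral differs from (v - u) f(u) by O(|v - u|^(1 + b)). *)
Lemma primitive_germ_equiv f b c : 0 < b -> 0 < c -> c <= 1 + b ->
  holder b t0 t1 f ->
  germ_equiv c t0 t1 (fun u v => (v - u) * f u) (incr (primitive f)).
Proof.
move=> b0 c0 cb hf.
have fi := continuous_integrable (holder_continuous_within b0 hf).
have [C hC] := hf.
have key u v : t0 <= u -> u <= v -> v <= t1 ->
    `|(v - u) * f u - incr (primitive f) u v| <= `|C| * (v - u) `^ (1 + b).
  move=> tu uv vt.
  have hb x : u <= x -> x <= v -> `|f x - f u| <= `|C| * (v - u) `^ b.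
    move=> ux xv; rewrite (le_trans (hC u x _ _))//.
    - by rewrite in_itv /=; apply/andP; split; lra.
    - by rewrite in_itv /=; apply/andP; split; lra.
    apply: (@le_trans _ _ (`|C| * `|x - u| `^ b)).
      by rewrite ler_wpM2r ?powR_ge0// ler_norm.
    rewrite ler_wpM2l// ger0_norm ?subr_ge0//.
    by apply: ge0_ler_powR; rewrite ?nnegrE; lra.
  have -> : (v - u) `^ (1 + b) = (v - u) * (v - u) `^ b.
    have [->|w0] := eqVneq (v - u) 0.
      by rewrite mul0r powR0// gt_eqF//; lra.
    by rewrite powRD ?w0 ?implybT// powRr1// subr_ge0.
  have h1 : (f u - `|C| * (v - u) `^ b) * (v - u) <= incr (primitive f) u v.
    apply: primitive_incr_ge => // x ux xv; have := hb x ux xv.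
    by rewrite ler_norml => /andP[]; lra.
  have h2 : incr (primitive f) u v <= (f u + `|C| * (v - u) `^ b) * (v - u).
    apply: primitive_incr_le => // x ux xv; have := hb x ux xv.
    by rewrite ler_norml => /andP[]; lra.
  by rewrite ler_norml; apply/andP; split; lra.
exists (`|C| * (t1 - t0) `^ (1 + b - c)); split.
  by rewrite mulr_ge0// powR_ge0.
move=> u v tu uv vt; rewrite (le_trans (key u v tu uv vt))// -mulrA ler_wpM2l//.
move: cb; rewrite le_eqVlt => /orP[/eqP<-|cb].
  by rewrite subrr powRr0 mul1r.
have -> : (v - u) `^ (1 + b) = (v - u) `^ (1 + b - c) * (v - u) `^ c.
  rewrite -powRD subrK//; by apply/implyP => /eqP h; exfalso; lra.
rewrite ler_wpM2r ?powR_ge0//; apply: ge0_ler_powR; rewrite ?nnegrE; lra.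
Qed.

End TimeIntegral.

(** * Varying the Hamiltonian germ *)

Section HamiltonianGermDerivative.
Context {R : realType} {K N : nat}.
Local Notation E := ('rV[R]_N * 'rV[R]_N)%type.
Variables (Z : rpath R K) (Y : R -> E) (X' : 'I_K -> R -> E) (dY : R -> E).
Local Notation X := (fun e t => Y t + e *: dY t).

Lemma smooth_line_derive (F : E -> R) (x d : E) (e : R) : smooth F ->
  is_derive e (1 : R) (fun e : R => F (x + e *: d))
    (\sum_k pcoord k d * 'D_(pbasis k) F (x + e *: d)).
Proof.
move=> hF; rewrite -derive_pcoord; last exact: smooth_differentiable.
exact/is_derive_line/smooth_derivable.
Qed.

Lemma is_derive_scale (f : R -> R) (k x df : R) : is_derive x (1 : R) f df ->
  is_derive x (1 : R) (fun e => k * f e) (k * df).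
Proof. by move=> h; exact: (is_deriveZ k). Qed.

(** Differentiating along eps commutes with taking Gubinelli derivatives by
    [derive_comm], so the derivative is again a combination of Hamiltonian germs,
    for the partial derivatives of F0 and F. In particular its defect is covered
    by the estimates already proved. *)
Lemma ham_germ_is_derive (F0 : E -> R) (F : 'I_K -> E -> R) (e u v : R) :
  smooth F0 -> (forall j, smooth (F j)) ->
  is_derive e (1 : R) (fun e : R => ham_germ Z F0 F (X e) X' u v)
    (\sum_k pcoord k (dY u) * ham_germ Z (fun x => 'D_(pbasis k) F0 x)
       (fun j x => 'D_(pbasis k) (F j) x) (X e) X' u v).
Proof.
move=> hF0 hF.
have d0 := is_derive_scale (v - u) (smooth_line_derive (Y u) (dY u) e hF0).
have d1 : is_derive e (1 : R)
    (fun e : R => \sum_j (Z v - Z u) 0 j * F j (Y u + e *: dY u))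
    (\sum_j (Z v - Z u) 0 j *
       \sum_k pcoord k (dY u) * 'D_(pbasis k) (F j) (Y u + e *: dY u)).
  apply: is_derive_sumf => j; apply: is_derive_scale.
  exact: smooth_line_derive.
have d2 : is_derive e (1 : R)
    (fun e : R => \sum_i \sum_j rp_area Z u v i j *
        'D_(X' i u) (F j) (Y u + e *: dY u))
    (\sum_i \sum_j rp_area Z u v i j * \sum_k pcoord k (dY u) *
        'D_(X' i u) (fun x => 'D_(pbasis k) (F j) x) (Y u + e *: dY u)).
  apply: is_derive_sumf => i; apply: is_derive_sumf => j; apply: is_derive_scale.
  under eq_bigr do rewrite (derive_comm _ _ _ (hF j)).
  by apply: smooth_line_derive; exact: smooth_derive.
have dd := is_deriveD d0 (is_deriveD d1 d2).
suff <- : (v - u) * (\sum_k pcoord k (dY u) * 'D_(pbasis k) F0 (Y u + e *: dY u)) +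
   ((\sum_j (Z v - Z u) 0 j *
       \sum_k pcoord k (dY u) * 'D_(pbasis k) (F j) (Y u + e *: dY u)) +
    (\sum_i \sum_j rp_area Z u v i j * \sum_k pcoord k (dY u) *
        'D_(X' i u) (fun x => 'D_(pbasis k) (F j) x) (Y u + e *: dY u))) =
   \sum_k pcoord k (dY u) * ham_germ Z (fun x => 'D_(pbasis k) F0 x)
       (fun j x => 'D_(pbasis k) (F j) x) (X e) X' u v by exact: dd.
rewrite mulr_sumr.
under [X in _ + (X + _)]eq_bigr do rewrite mulr_sumr.
under [X in _ + (_ + X)]eq_bigr do under eq_bigr do rewrite mulr_sumr.
rewrite exchange_big /=.
under [X in _ + (_ + X)]eq_bigr do rewrite exchange_big /=.
rewrite [X in _ + (_ + X)]exchange_big /= -!big_split /=; apply: eq_bigr => k _.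
rewrite /ham_germ !mulrDr; congr (_ + (_ + _)); first by rewrite mulrCA.
  by rewrite mulr_sumr; apply: eq_bigr => j _; rewrite mulrCA.
rewrite mulr_sumr; apply: eq_bigr => i _; rewrite mulr_sumr; apply: eq_bigr => j _.
by rewrite mulrCA.
Qed.

End HamiltonianGermDerivative.

(** * Smooth variations *)

Section TestPaths.
Context {R : realType}.
Variables (t0 t1 : R).
Hypothesis ht : t0 < t1.

Lemma lipschitz_of_derive (f df : R -> R) :
  {within `[t0, t1], continuous f} -> {within `[t0, t1], continuous df} ->
  (forall t, t0 < t -> t < t1 -> is_derive t (1 : R) f (df t)) ->
  holder 1 t0 t1 f.
Proof.
move=> cf cdf hd.
have /compact_bounded[M [_ hM]] : compact (df @` `[t0, t1]).
  by apply: continuous_compact => //; exact: segment_compact.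
have bd t : t0 <= t -> t <= t1 -> `|df t| <= `|M| + 1.
  move=> h1 h2; apply: (hM (`|M| + 1)); first by have := ler_norm M; lra.
  by exists t => //=; rewrite in_itv /= h1 h2.
have key s t : t0 <= s -> s <= t -> t <= t1 -> `|f t - f s| <= (`|M| + 1) * (t - s).
  move=> h1 h2 h3.
  have cst : {within `[s, t], continuous f}.
    apply: continuous_subspaceW cf => x /=; rewrite !in_itv /= => /andP[? ?].
    by apply/andP; split; lra.
  have hd' x : x \in `]s, t[ -> is_derive x (1 : R) f (df x).
    by rewrite in_itv /= => /andP[? ?]; apply: hd; lra.
  have [c] := MVT_segment h2 hd' cst.
  rewrite in_itv /= => /andP[sc ct] ->.
  rewrite normrM (ger0_norm (_ : 0 <= t - s)) ?subr_ge0// ler_wpM2r ?subr_ge0//.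
  by apply: bd; lra.
exists (`|M| + 1) => s t; rewrite !in_itv /= => /andP[s0 s1] /andP[r0 r1].
rewrite powRr1//; have [st|/ltW ts] := leP s t.
  by rewrite [X in _ * X]ger0_norm ?subr_ge0//; exact: key.
by rewrite distrC (distrC t) [X in _ * X]ger0_norm ?subr_ge0//; exact: key.
Qed.

(** The only property of smooth variations that the analysis uses. The
    one-sided difference quotients give continuity up to the endpoints and true
    derivatives inside. *)
Lemma smooth_on_lipschitz (n : nat) (f : R -> 'rV[R]_n) :
  smooth_on t0 t1 f -> holder 1 t0 t1 f.
Proof.
move=> [d [d0 dS]].
pose g (k : nat) (i : 'I_n) (t : R) : R := d k t 0 i.
have gS k i t : t \in `[t0, t1] ->
    (s - t)^-1 * (g k i s - g k i t) @[s --> within `[t0, t1] t^'] --> g k.+1 i t.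
  move=> tt.
  have := cvg_comp _ _ (dS k t tt) (@coord_continuous R 1 n 0 i (d k.+1 t)).
  apply: cvg_trans; apply: near_eq_cvg; near=> s.
  by rewrite /g /= !mxE.
have gC k i : {within `[t0, t1], continuous (g k i)}.
  apply/subspace_continuousP => t tt.
  apply/cvgrPdist_lt => e e0.
  have FF : Filter (within `[t0, t1] t^') by exact: within_filter.
  have H1 : \forall s \near within `[t0, t1] t^',
      `|g k.+1 i t - (s - t)^-1 * (g k i s - g k i t)| < 1.
    by have /cvgrPdist_lt := gS k i t tt; apply.
  pose M := `|g k.+1 i t| + 1.
  have M0 : 0 < M by rewrite /M; have := normr_ge0 (g k.+1 i t); lra.
  move: H1; rewrite /within /= /dnbhs /= => /nbhs_ballP[r /= r0 hr].
  apply/nbhs_ballP; exists (Num.min r (e / M)) => /=.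
    by rewrite lt_min r0 divr_gt0.
  move=> s; rewrite -ball_normE /= lt_min => /andP[sr se] hs.
  have [->|st] := eqVneq s t; first by rewrite subrr normr0.
  have st0 : s - t != 0 by rewrite subr_eq0.
  have := hr s; rewrite -ball_normE /= => /(_ sr st hs) h.
  have h1 : `|(s - t)^-1 * (g k i s - g k i t)| < M.
    rewrite -(subKr (g k.+1 i t) ((s - t)^-1 * _)) /M.
    rewrite (le_lt_trans (ler_normB _ _))//; lra.
  have -> : g k i t - g k i s = - ((s - t) * ((s - t)^-1 * (g k i s - g k i t))).
    by rewrite mulrA mulfV// mul1r opprB.
  rewrite normrN normrM.
  have n0 : 0 < `|s - t| by rewrite normr_gt0.
  have h2 : `|s - t| * M < e by rewrite -ltr_pdivlMr// distrC.
  by apply: lt_trans h2; rewrite ltr_pM2l.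
have gD k i t : t0 < t -> t < t1 -> is_derive t (1 : R) (g k i) (g k.+1 i t).
  move=> h1 h2.
  have tt : t \in `[t0, t1] by rewrite in_itv /= !ltW.
  have H : h^-1 *: (g k i (h *: (1 : R) + t) - g k i t) @[h --> (0 : R)^'] --> g k.+1 i t.
    apply/cvgrPdist_lt => e e0.
    have /cvgrPdist_lt/(_ e e0) := gS k i t tt.
    rewrite /within /= /dnbhs /= => /nbhs_ballP[r /= r0 hr].
    apply/nbhs_ballP; exists (Num.min r (Num.min (t - t0) (t1 - t))) => /=.
      by rewrite !lt_min r0 !subr_gt0 h1 h2.
    move=> h; rewrite -ball_normE /= sub0r normrN !lt_min => /and3P[hh1 hh2 hh3] hn0.
    have := hr (h + t); rewrite -ball_normE /= opprD addrC addrNK normrN => /(_ hh1).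
    have -> : h *: (1 : R) + t = h + t by rewrite /GRing.scale /= mulr1.
    rewrite addrK; apply.
      by rewrite -subr_eq0 addrK.
    rewrite in_itv /=; move: hh2 hh3; rewrite !ltr_norml => /andP[? ?] /andP[? ?].
    by apply/andP; split; lra.
  apply: DeriveDef; first by apply/cvg_ex; exists (g k.+1 i t).
  exact: cvg_lim H.
have gL i : holder 1 t0 t1 (g 0%N i).
  exact: (lipschitz_of_derive (gC 0%N i) (gC 1%N i) (gD 0%N i)).
have [C hC] := choice gL.
exists (\sum_i `|C i|) => s t hs hr.
rewrite -(d0 s hs) -(d0 t hr).
apply: row_norm_le => [|i].
  by rewrite mulr_ge0 ?powR_ge0// sumr_ge0.
rewrite !mxE (le_trans (hC i s t hs hr))// ler_wpM2r ?powR_ge0//.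
rewrite (le_trans (ler_norm _))// (bigD1 i)//= lerDl sumr_ge0//.
Unshelve. all: by end_near. Qed.

(** Polynomial variations suffice as test paths. The difference quotient of a
    polynomial at t is itself a polynomial in s, by the factor theorem, so no
    distinction between interior points and endpoints is needed. *)
Lemma horner_smooth_on (n : nat) (P : {poly R}) (w : 'rV[R]_n) :
  smooth_on t0 t1 (fun t => P.[t] *: w).
Proof.
exists (fun k t => (P^`(k)).[t] *: w); split; first by move=> t _.
move=> k t _; rewrite derivnS; move: (P^`(k))%R => Q.
have /factor_theorem[S hS] : root (Q - Q.[t]%:P) t.
  by rewrite /root !hornerE subrr.
have Qs s : Q.[s] - Q.[t] = S.[s] * (s - t).
  by have := congr1 (fun p => p.[s]) hS; rewrite /= hornerD hornerN hornerC hornerM hornerXsubC.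
have Qt : Q^`().[t] = S.[t].
  have := congr1 (fun p => p^`().[t]) hS.
  rewrite /= derivB derivC subr0 derivM derivXsubC mulr1 hornerD hornerM.
  by rewrite hornerXsubC subrr mulr0 add0r.
rewrite Qt.
have FF : Filter (within `[t0, t1] t^') by exact: within_filter.
have H : S.[s] @[s --> within `[t0, t1] t^'] --> S.[t].
  by apply: cvg_within_filter; apply: cvg_within_filter; exact: continuous_horner.
have := @cvgZr_tmp R 'rV[R]_n R _ FF (horner S) S.[t] w H.
apply: cvg_trans; apply: near_eq_cvg; near=> s.
have st : s - t != 0.
  by rewrite subr_eq0; near: s; exact: (cvg_within _ (nbhs_dnbhs_neq t)).
by rewrite -scalerBl Qs scalerA mulrC mulfK.
Unshelve. all: by end_near. Qed.

End TestPaths.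

(** * The fundamental lemma of the calculus of variations *)

Section FundamentalLemma.
Context {R : realType}.
Variables (t0 t1 : R).
Hypothesis ht : t0 < t1.
Local Notation mu := (@lebesgue_measure R).
Local Notation has_order := (has_order t0 t1).
Local Notation um := (@subinterval_um R t0 t1).

Lemma antiderivative (P : {poly R}) (a : R) : exists Q, Q.[a] = 0 /\ Q^`() = P.
Proof.
pose Q : {poly R} := \poly_(i < (size P).+1) (P`_i.-1 / i%:R).
have dQ : Q^`() = P.
  apply/polyP => i; rewrite coef_deriv coef_poly ltnS /=.
  case: ltnP => [hi|hi]; last by rewrite mul0rn nth_default.
  by rewrite -[LHS]mulr_natr divfK// pnatr_eq0.
exists (Q - Q.[a]%:P); split; first by rewrite !hornerE subrr.
by rewrite derivB derivC subr0.
Qed.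

Lemma holder_weaken (W : normedModType R) b c (f : R -> W) :
  0 <= c -> c <= b -> holder b t0 t1 f -> holder c t0 t1 f.
Proof.
move=> c0 cb hf; apply: has_order_holder; apply: (has_order_weaken c0 cb).
by apply: (holder_bound_has_order _ um hf); lra.
Qed.

Lemma holderM b (f g : R -> R) : 0 <= b -> holder b t0 t1 f -> holder b t0 t1 g ->
  holder b t0 t1 (fun t => f t * g t).
Proof.
move=> b0 hf hg; apply: has_order_holder.
apply: (has_order_ext (g := fun x => f (tr_m x) * (g (tr_m x) - g (tr_u x)) +
   g (tr_u x) * (f (tr_m x) - f (tr_u x)))).
  by move=> x _; ring.
have [_ fm] := holder_has_order0 b0 (ltW ht) um hf.
have [gu _] := holder_has_order0 b0 (ltW ht) um hg.
apply: has_orderD; rewrite -[b]add0r; apply: has_orderM => //.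
  exact: (holder_bound_has_order b0 um hg).
exact: (holder_bound_has_order b0 um hf).
Qed.

Lemma holder_bounded b (f : R -> R) : 0 <= b -> holder b t0 t1 f ->
  exists2 B, 0 <= B & forall t, t0 <= t -> t <= t1 -> `|f t| <= B.
Proof.
move=> b0 hf; have [[B [B0 hB]] _] := holder_has_order0 b0 (ltW ht) um hf.
exists B => // t h1 h2; have := hB (Triple 0 t t t); rewrite powRr0 mulr1; apply.
by split; rewrite ?normr0.
Qed.

Lemma holder_horner (P : {poly R}) : holder 1 t0 t1 (horner P).
Proof.
apply: (lipschitz_of_derive (df := horner P^`())).
- by apply: continuous_subspaceT => x; exact: continuous_horner.
- by apply: continuous_subspaceT => x; exact: continuous_horner.
Qed.

Lemma holder_near_ge b (f : R -> R) s : 0 < b -> holder b t0 t1 f ->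
  t0 <= s -> s <= t1 -> 0 < f s -> exists2 r, 0 < r &
    forall x, t0 <= x -> x <= t1 -> `|x - s| <= r -> f s / 2 <= f x.
Proof.
move=> b0 [C hC] ts st fs.
have b1 : 1 < 1 + b by lra.
have f2 : 0 < f s / 2 by lra.
have [r r0 hr] := mesh_small b1 (normr_ge0 C) f2.
exists r => // x tx xt xs.
have : `|f x - f s| <= f s / 2.
  apply: le_trans (hC s x _ _) _; rewrite ?in_itv /= ?ts ?tx//.
  apply: le_trans hr; have -> : 1 + b - 1 = b by ring.
  apply: (@le_trans _ _ (`|C| * `|x - s| `^ b)).
    by rewrite ler_wpM2r ?powR_ge0// ler_norm.
  by rewrite ler_wpM2l//; apply: ge0_ler_powR; rewrite ?nnegrE ?normr_ge0// ltW.
by rewrite ler_norml => /andP[]; lra.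
Qed.

Lemma bernoulli_ineq (x : R) n : 0 <= x -> 1 + n%:R * x <= (1 + x) ^+ n.
Proof.
move=> x0; elim: n => [|n IHn]; first by rewrite mul0r addr0 expr0.
rewrite exprS -natr1.
have n0 : 0 <= n%:R :> R by exact: ler0n.
have := mulr_ge0 (mulr_ge0 n0 x0) x0.
have := ler_wpM2l (_ : 0 <= 1 + x) IHn; move=> /(_ ltac:(lra)); lra.
Qed.

(** Landau's kernel. With k a parabola that exceeds 1 near s and lies in [0, 1]
    away from s, the integral of f k^n is bounded below by a constant plus a
    multiple of rho^n with rho > 1 if f is positive near s, so it cannot vanish
    for all n. *)
Lemma orthogonal_to_polynomials_le0 b (f : R -> R) s : 0 < b -> holder b t0 t1 f ->
  (forall P : {poly R}, \int[mu]_(r in `[t0, t1]) (f r * P.[r]) = 0) ->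
  t0 <= s -> s <= t1 -> f s <= 0.
Proof.
move=> b0 hf orth ts st; rewrite leNgt; apply/negP => fs.
have [r' r'0 hr'] := holder_near_ge b0 hf ts st fs.
pose L := t1 - t0; have L0 : 0 < L by rewrite subr_gt0.
pose r := Num.min r' L.
have r0 : 0 < r by rewrite lt_min r'0.
have rL : r <= L by rewrite ge_min lexx orbT.
have hr x : t0 <= x -> x <= t1 -> `|x - s| <= r -> f s / 2 <= f x.
  by move=> h1 h2 h3; apply: hr' => //; apply: le_trans h3 _; rewrite ge_min lexx.
have [B B0 hB] := holder_bounded (ltW b0) hf.
(* The kernel 1 + eta - ((x - s) / L)^2 is at least 0 on [t0, t1] because
   |x - s| <= L, at most 1 where |x - s| >= r by the choice of eta, and at least
   1 + 3 eta / 4 where |x - s| <= r / 2. *)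
pose eta := (r / L) ^+ 2.
have rL0 : 0 < r / L by rewrite divr_gt0.
have eta0 : 0 < eta by rewrite exprn_gt0.
pose k x := 1 + eta - ((x - s) / L) ^+ 2.
pose Kp : {poly R} := (1 + eta)%:P - (L^-1)%:P ^+ 2 * ('X - s%:P) ^+ 2.
have KpE x : Kp.[x] = k x.
    by rewrite /Kp /k hornerD hornerN hornerM !horner_exp !hornerC hornerXsubC exprMn [in RHS]mulrC.
have sq x y : `|x| <= y -> (x / L) ^+ 2 <= (y / L) ^+ 2.
  move=> xy; rewrite -[leLHS]real_normK ?num_real// ler_sqr ?nnegrE//.
    by rewrite normrM normfV (gtr0_norm L0) ler_wpM2r// invr_ge0 ltW.
  by rewrite divr_ge0 ?(ltW L0)// (le_trans _ xy).
have k0 x : t0 <= x -> x <= t1 -> 0 <= k x.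
  move=> h1 h2; rewrite /k.
  have : ((x - s) / L) ^+ 2 <= (L / L) ^+ 2.
    by apply: sq; rewrite ler_norml /L; apply/andP; split; lra.
  by rewrite divff ?gt_eqF// expr1n; lra.
have kout x : r <= `|x - s| -> k x <= 1.
  move=> h; rewrite /k.
  suff : eta <= ((x - s) / L) ^+ 2 by lra.
  rewrite -[leRHS]real_normK ?num_real// /eta ler_sqr ?nnegrE ?(ltW rL0)//.
  by rewrite normrM normfV (gtr0_norm L0) ler_wpM2r// invr_ge0 ltW.
have kin x : `|x - s| <= r / 2 -> 1 + eta * (3 / 4) <= k x.
  move=> h; rewrite /k.
  have : ((x - s) / L) ^+ 2 <= (r / 2 / L) ^+ 2 by apply: sq.
  have -> : (r / 2 / L) ^+ 2 = eta * (1 / 4) by rewrite /eta; field; rewrite gt_eqF.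
  by lra.
pose rho := 1 + eta * (3 / 4).
have rho0 : 0 <= rho by rewrite /rho; lra.
(* [c1, d1] is the part of [s - r / 2, s + r / 2] inside [t0, t1]; its length is at
   least r / 2 even when s is an endpoint, since r <= L. *)
pose c1 := Num.max t0 (s - r / 2); pose d1 := Num.min t1 (s + r / 2).
have tc1 : t0 <= c1 by rewrite le_max lexx.
have d1t : d1 <= t1 by rewrite ge_min lexx.
have c1s : s - r / 2 <= c1 by rewrite le_max lexx orbT.
have d1s : d1 <= s + r / 2 by rewrite ge_min lexx orbT.
have cd : r / 2 <= d1 - c1.
  rewrite /c1 /d1 lerBrDr; rewrite le_min; apply/andP; split.
    by rewrite -lerBrDl ge_max; apply/andP; split; rewrite /L in rL; lra.
  by rewrite -lerBrDl ge_max; apply/andP; split; lra.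
have c1d1 : c1 <= d1 by rewrite -subr_ge0 (le_trans _ cd)// divr_ge0// ltW.
have c1t : c1 <= t1 by exact: le_trans d1t.
have td1 : t0 <= d1 by exact: le_trans c1d1.
have f2 : 0 <= f s / 2 by rewrite divr_ge0// ltW.
have main n : rho ^+ n * (f s / 2) * (r / 2) <= B * L.
  pose g x := f x * (Kp ^+ n).[x].
  have gE x : g x = f x * k x ^+ n by rewrite /g horner_exp KpE.
  have hg : holder (Num.min b 1) t0 t1 g.
    have m0 : 0 <= Num.min b 1 by rewrite le_min ltW//= ler01.
    apply: holderM => //.
      by apply: holder_weaken hf => //; rewrite ge_min lexx.
    by apply: (holder_weaken (b := 1)) => //; rewrite ?ge_min ?lexx ?orbT//; exact: holder_horner.
  have gi : mu.-integrable `[t0, t1] (EFin \o g).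
    apply: continuous_integrable; apply: holder_continuous_within hg.
    by rewrite lt_min b0 ltr01.
  have gB x : t0 <= x -> x <= t1 -> - B <= g x.
    move=> h1 h2; rewrite gE; have kn := exprn_ge0 n (k0 x h1 h2).
    have [h|h] := leP (`|x - s|) r.
      have := hr x h1 h2 h => h3.
      rewrite (le_trans (_ : - B <= 0)) ?oppr_le0//.
      by rewrite mulr_ge0// (le_trans f2).
    have k1 : k x ^+ n <= 1.
      by rewrite exprn_ile1 ?k0// kout// ltW.
    have := hB x h1 h2; rewrite ler_norml => /andP[h3 h4].
    have := ler_wpM2r kn h3; have := ler_wpM2l B0 k1; lra.
  have i1 := primitive_incr_ge gi (lexx t0) tc1 c1t
    (fun x h1 h2 => gB x h1 (le_trans h2 c1t)).
  have i3 := primitive_incr_ge gi td1 d1t (lexx t1)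
    (fun x h1 h2 => gB x (le_trans td1 h1) h2).
  have i2 := primitive_incr_ge gi tc1 c1d1 d1t (c := rho ^+ n * (f s / 2)).
  have {i2} i2 : rho ^+ n * (f s / 2) * (d1 - c1) <= incr (primitive t0 g) c1 d1.
    apply: i2 => x h1 h2; rewrite gE [leRHS]mulrC.
    have sx := le_trans c1s h1; have xs' := le_trans h2 d1s.
    have xs : `|x - s| <= r / 2.
      by rewrite ler_norml lerBrDl sx lerBlDl.
    have tx := le_trans tc1 h1; have xt := le_trans h2 d1t.
    have fx : f s / 2 <= f x.
      by apply: hr => //; apply: le_trans xs _; rewrite ler_pdivrMr// ler_peMr ?ler1n// ltW.
    apply: (ler_pM (exprn_ge0 n rho0) f2 _ fx).
    by apply: lerXn2r; rewrite ?nnegrE ?rho0 ?k0//; exact: kin.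
  have P0 : primitive t0 g t1 = 0 by exact: orth.
  have P1 : primitive t0 g t0 = 0.
    by rewrite /primitive set_itv1 Rintegral_set1.
  move: i1 i2 i3; rewrite /incr P0 P1.
  have := ler_wpM2l (mulr_ge0 (exprn_ge0 n rho0) f2) cd.
  have := mulr_ge0 B0 (_ : 0 <= d1 - c1); rewrite subr_ge0 => /(_ c1d1).
  move: (primitive _ _ _) (primitive _ _ _) (rho ^+ n * (f s / 2)); clear.
  by rewrite /L => *; lra.
pose q := f s / 2 * (r / 2) * (eta * (3 / 4)).
have q0 : 0 < q by rewrite /q !mulr_gt0 ?invr_gt0 ?ltr0n.
pose n := (Num.truncn (B * L / q)).+1.
have hn : B * L / q < n%:R by exact: truncnS_gt.
have := main n.
have e0 : 0 <= eta * (3 / 4) by lra.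
have fr : 0 <= f s / 2 * (r / 2) by rewrite mulr_ge0// divr_ge0// ltW.
have := ler_wpM2r fr (bernoulli_ineq n e0).
move: hn; rewrite ltr_pdivrMr// /q -/rho => hn h1 h2.
by move: (n%:R : R) hn h1 h2 => nn hn h1 h2; lra.
Qed.

Lemma orthogonal_to_polynomials b (f : R -> R) s : 0 < b -> holder b t0 t1 f ->
  (forall P : {poly R}, \int[mu]_(r in `[t0, t1]) (f r * P.[r]) = 0) ->
  t0 <= s -> s <= t1 -> f s = 0.
Proof.
move=> b0 hf orth ts st; apply/eqP; rewrite eq_le.
rewrite (orthogonal_to_polynomials_le0 b0 hf orth ts st) /= -oppr_le0.
apply: (orthogonal_to_polynomials_le0 (f := fun x => - f x) b0) => //.
  have [C hC] := hf; exists C => x y hx hy.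
  by rewrite -opprD normrN; exact: hC.
move=> P; rewrite -[RHS](orth (- P)); apply: eq_Rintegral => x _.
by rewrite hornerN; ring.
Qed.

(** Integration by parts for a smooth integrand against a Hoelder integrator:
    P_u (f_v - f_u) is the increment of P f minus f_v (P_v - P_u), and the latter
    is equivalent to f_u P'_u (v - u). *)
Lemma by_parts_germ_equiv b c (f : R -> R) (P : {poly R}) : 0 < b -> b <= 1 ->
  0 < c -> c <= 1 + b -> holder b t0 t1 f ->
  germ_equiv c t0 t1 (fun u v => P.[u] * (f v - f u))
    (incr (fun t => P.[t] * f t - primitive t0 (fun r => f r * P^`().[r]) t)).
Proof.
move=> b0 b1 c0 cb hf; have b0' := ltW b0.
have uv := @subinterval_uv R t0 t1.
have hP' := holder_weaken b0' b1 (holder_horner P^`()).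
have [C1 [C10 h1]] := primitive_germ_equiv b0 c0 cb (holderM b0' hf hP').
have [C2 [C20 h2]] : has_order c (fun x => (tr_v x - tr_u x) *
    (f (tr_v x) * P^`().[tr_m x] - f (tr_u x) * P^`().[tr_u x])).
  apply: (has_order_weaken (ltW c0) cb); apply: has_orderM => //.
    exists 1; split => // x [_ k1 k2 k3 k4].
    by rewrite powRr1 ?mul1r ?ger0_norm; lra.
  apply: (has_order_ext (g := fun x => (f (tr_v x) - f (tr_u x)) * P^`().[tr_m x] +
     f (tr_u x) * (P^`().[tr_m x] - P^`().[tr_u x]))).
    by move=> x _; ring.
  have [_ pm] := holder_has_order0 b0' (ltW ht) um hP'.
  have [fu _] := holder_has_order0 b0' (ltW ht) um hf.
  apply: has_orderD.
    rewrite -[b]addr0; apply: has_orderM => //.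
    exact: (holder_bound_has_order b0' uv hf).
  rewrite -[b]add0r; apply: has_orderM => //.
  exact: (holder_bound_has_order b0' um hP').
exists (C2 + C1); split; first exact: addr_ge0.
move=> u v tu uv' vt.
have cP : {within `[u, v], continuous (horner P)}.
  by apply: continuous_subspaceT => x; exact: continuous_horner.
(* The mean value point plays the role of the middle time of a triple. *)
have [m] := MVT_segment uv' (fun x _ => is_derive_poly P x) cP.
rewrite in_itv /= => /andP[hum hmv] hm.
have adm : admissible t0 t1 (Triple 0 u m v) by split; rewrite ?normr0.
have /= H2 := h2 _ adm.
have := h1 u v tu uv' vt; rewrite /incr => H1.
rewrite mulrDl.
have -> : P.[u] * (f v - f u) -
    (P.[v] * f v - primitive t0 (fun r => f r * P^`().[r]) v -
     (P.[u] * f u - primitive t0 (fun r => f r * P^`().[r]) u)) =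
   - ((v - u) * (f v * P^`().[m] - f u * P^`().[u])) -
   ((v - u) * (f u * P^`().[u]) - (primitive t0 (fun r => f r * P^`().[r]) v -
      primitive t0 (fun r => f r * P^`().[r]) u)).
  have -> : (v - u) * (f v * P^`().[m] - f u * P^`().[u]) =
      f v * (P.[v] - P.[u]) - (v - u) * (f u * P^`().[u]) by rewrite hm; ring.
  ring.
by rewrite (le_trans (ler_normB _ _))// lerD// normrN.
Qed.

(** The lemma of du Bois-Reymond. After subtracting from f its value at the
    endpoint d where the test polynomial is free, the boundary terms of
    [by_parts_germ_equiv] vanish at both ends, and the derivative of the test
    polynomial is arbitrary. *)
Lemma constant_of_stationary_pairing b c (f : R -> R) (a d : R) :
  0 < b -> b <= 1 -> 1 < c -> c <= 1 + b -> holder b t0 t1 f ->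
  (a = t0 /\ d = t1) \/ (a = t1 /\ d = t0) ->
  (forall P : {poly R}, P.[a] = 0 ->
     sewing_lim t0 t1 (fun u v => P.[u] * (f v - f u)) = 0) ->
  forall t, t0 <= t -> t <= t1 -> f t = f d.
Proof.
move=> b0 b1 c1 cb hf ad hP t tt0 tt1.
pose g r := f r - f d.
have hg : holder b t0 t1 g.
  have [C hC] := hf; exists C => x y hx hy; rewrite /g opprB addrA subrK.
  exact: hC.
suff : g t = 0 by move/eqP; rewrite subr_eq0 => /eqP.
apply: (orthogonal_to_polynomials b0 hg) => // P.
have [Q [Qa dQ]] := antiderivative P a.
have c0 : 0 < c by lra.
have := germ_equiv_sewing_lim c1 (by_parts_germ_equiv Q b0 b1 c0 cb hg)
  (lexx t0) (ltW ht) (lexx t1).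
have -> : (fun u v => Q.[u] * (g v - g u)) = (fun u v => Q.[u] * (f v - f u)).
  by apply/funext => u; apply/funext => v; rewrite /g opprB addrA subrK.
rewrite hP// dQ.
have p0 : primitive t0 (fun r => g r * P.[r]) t0 = 0.
  by rewrite /primitive set_itv1 Rintegral_set1.
have e1 : Q.[t1] * g t1 = 0.
  case: ad => -[ea ed]; first by rewrite /g -ed subrr mulr0.
  by rewrite -ea Qa mul0r.
have e0 : Q.[t0] * g t0 = 0.
  case: ad => -[ea ed]; first by rewrite -ea Qa mul0r.
  by rewrite /g -ed subrr mulr0.
rewrite p0 e1 e0 sub0r !subr0 => /eqP; rewrite eq_sym oppr_eq0 => /eqP.
exact.
Qed.

End FundamentalLemma.

(** * Components of vector-valued germs *)

Section SmoothComponents.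
Context {R : realType}.

Lemma smooth_coord (V : normedModType R) (n : nat) (f : V -> 'rV[R]_n) j :
  smooth f -> smooth (fun x => f x 0 j : R).
Proof.
move=> hf k; move: f {hf} (hf k); elim: k => [|k IHk] f /=.
  move=> cf x; exact: (cvg_comp _ _ (cf x) (@coord_continuous R 1 n 0 j (f x))).
move=> [df hf]; split=> [x|v].
  exact: (differentiable_comp (df x) (differentiable_coord (f x) 0 j)).
have -> : (fun x => 'D_v (fun x => f x 0 j : R) x) = (fun x => 'D_v f x 0 j).
  apply/funext => x; rewrite derive_mx ?mxE//.
  exact: diff_derivable.
exact/IHk/hf.
Qed.

Variables (V : normedModType R) (n : nat) (B : 'I_n -> V).

Lemma differentiable_gradient (f : V -> R) x : smooth f ->
  differentiable (fun x => \row_i 'D_(B i) f x) x.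
Proof.
move=> hf.
have -> : (fun x => \row_i 'D_(B i) f x) =
    \sum_(i < n) (fun x => 'D_(B i) f x *: delta_mx 0 i : 'rV[R]_n).
  apply/funext => y; rewrite fct_sumE {1}(row_sum_delta (\row_i 'D_(B i) f y)).
  by apply: eq_bigr => i _; rewrite mxE.
apply: differentiable_sum => i; apply: differentiableZl.
exact/smooth_differentiable/smooth_derive.
Qed.

Lemma diff_gradient (f : V -> R) x w i : smooth f ->
  'd (fun x => \row_i 'D_(B i) f x) x w 0 i = 'D_w (fun x => 'D_(B i) f x) x.
Proof.
move=> hf; have dg := differentiable_gradient x hf.
rewrite -deriveE// (derive_mx (diff_derivable dg)) [LHS]mxE.
apply: (congr1 (fun g : V -> R => 'D_w g x)).
by apply/funext => y; rewrite mxE.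
Qed.

End SmoothComponents.

Section GermEquivalence.
Context {R : realType}.
Variables t0 t1 : R.

Lemma germ_equiv_row (n : nat) b (A B : 'I_n -> R -> R -> R) :
  (forall i, germ_equiv b t0 t1 (A i) (B i)) ->
  germ_equiv b t0 t1 (fun u v => \row_i A i u v) (fun u v => \row_i B i u v).
Proof.
move=> h; have [C hC] := choice h.
exists (\sum_i C i); split; first by apply: sumr_ge0 => i _; case: (hC i).
move=> u v tu uv vt; apply: row_norm_le => [|i].
  by rewrite mulr_ge0 ?powR_ge0// sumr_ge0// => i _; case: (hC i).
rewrite !mxE; have [_ /(_ u v tu uv vt) /le_trans] := hC i; apply.
rewrite ler_wpM2r ?powR_ge0// (bigD1 i)//= lerDl sumr_ge0// => k _.
by case: (hC k).
Qed.

Lemma unif_additive_sewing b A e : 1 < b -> unif_additive t0 t1 b A -> `|e| < 1 ->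
  exists J, germ_equiv b t0 t1 (A e) (incr J).
Proof.
move=> b1 /unif_additiveP[C [C0 hC]] e1.
have [J hJ] := sewing b1 C0 (hC e e1).
exists J, (sewing_cst b * C); split=> //.
by apply: mulr_ge0 => //; exact: sewing_cst_ge0.
Qed.

Lemma is_derive_near0_eq (f g : R -> R) l : (forall e, `|e| < 1 -> f e = g e) ->
  is_derive (0 : R) (1 : R) f l -> is_derive (0 : R) (1 : R) g l.
Proof.
move=> fg /is_derive_near0P hf; apply/is_derive_near0P => e e0.
have [d d0 hd] := hf e e0; exists (Num.min d 1); first by rewrite lt_min d0 ltr01.
move=> h; rewrite lt_min => /andP[hd' h1].
by rewrite -!fg ?normr0//; exact: hd.
Qed.

End GermEquivalence.

(** * Drift plus rough integral along a controlled path *)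

Section HamiltonianSystem.
Context {R : realType} {K N : nat}.
Local Notation V := 'rV[R]_N.
Local Notation E := (V * V)%type.
Local Notation mu := (@lebesgue_measure R).
Variables (alpha t0 t1 : R).
Hypotheses (alpha_gt : 3^-1 < alpha) (alpha_le : alpha <= 2^-1) (ht : t0 < t1).
Variable Z : rpath R K.
Hypothesis hZ : geometric_rough_path alpha t0 t1 Z.

Let alpha_gt0 : 0 < alpha. Proof. by apply: lt_trans alpha_gt; rewrite invr_gt0. Qed.
Let alpha3 : 1 < 3 * alpha. Proof. by have := alpha_gt; lra. Qed.

Definition rough_germ (F : 'I_K -> E -> R) (X : R -> E) (X' : 'I_K -> R -> E) (u v : R) : R :=
  \sum_j (Z v - Z u) 0 j * F j (X u) +
  \sum_i \sum_j rp_area Z u v i j * 'D_(X' i u) (F j) (X u).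

(** Subtracting the drift, whose germ is equivalent to a Lebesgue integral,
    from the Hamiltonian germ. *)
Lemma rough_germ_equiv (F0 : E -> R) F X X' J :
  holder alpha t0 t1 (F0 \o X) ->
  germ_equiv (3 * alpha) t0 t1 (ham_germ Z F0 F X X') (incr J) ->
  germ_equiv (3 * alpha) t0 t1 (rough_germ F X X')
    (incr (fun t => J t - primitive t0 (F0 \o X) t)).
Proof.
move=> hF0 /germ_equivP hJ; apply/germ_equivP.
have a3 : 3 * alpha <= 1 + alpha by have := alpha_le; lra.
have a0 : 0 < 3 * alpha by have := alpha_gt0; lra.
have /germ_equivP hp := primitive_germ_equiv alpha_gt0 a0 a3 hF0.
apply: has_order_ext (has_orderB hJ hp) => x _.
by rewrite /ham_germ /rough_germ /incr /=; ring.
Qed.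

Variables (Y : cpath R K E) (dY : R -> E).
Hypothesis hY : controlled alpha t0 t1 Z Y.
Hypothesis hdY : holder 1 t0 t1 dY.
Local Notation X := (fun e t => Y t + e *: dY t).

Lemma shifted_comp_holder (F0 : E -> R) e : smooth F0 -> `|e| < 1 ->
  holder alpha t0 t1 (F0 \o X e).
Proof.
move=> hF0; apply: (has_order_holder_family (f := fun e => F0 \o X e)).
by apply: (comp_increment_order alpha_gt0 alpha_le (ltW ht) hZ hY hdY hF0);
  exact: subinterval_um.
Qed.

End HamiltonianSystem.

Section Variation.
Context {R : realType} {K N : nat}.
Local Notation V := 'rV[R]_N.
Local Notation E := (V * V)%type.
Local Notation mu := (@lebesgue_measure R).
Variables (alpha t0 t1 : R).
Hypotheses (alpha_gt : 3^-1 < alpha) (alpha_le : alpha <= 2^-1) (ht : t0 < t1).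
Variable Z : rpath R K.
Hypothesis hZ : geometric_rough_path alpha t0 t1 Z.
Variables (H : E -> R) (calH : E -> 'rV[R]_K).
Hypotheses (hH : smooth H) (hcalH : smooth calH).
Variables (q p : cpath R K V).
Hypotheses (hq : controlled alpha t0 t1 Z q) (hp : controlled alpha t0 t1 Z p).

Local Notation Y := (cpath_pair q p).
Local Notation h := (Hcomp calH).
Local Notation um := (@subinterval_um R t0 t1).

Let alpha_gt0 : 0 < alpha. Proof. by apply: lt_trans alpha_gt; rewrite invr_gt0. Qed.
Let alpha3 : 1 < 3 * alpha. Proof. by have := alpha_gt; lra. Qed.
Let hY : controlled alpha t0 t1 Z Y. Proof. exact: controlled_pair. Qed.
Let hh j : smooth (h j). Proof. exact: smooth_coord. Qed.
Let n01 : `|0 : R| < 1. Proof. by rewrite normr0. Qed.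

Lemma holder_cst (W : normedModType R) b (w : W) : holder b t0 t1 (fun=> w).
Proof. by exists 0 => s t _ _; rewrite subrr normr0 mul0r. Qed.

Let path_unshifted : (fun t => Y t + 0 *: (0 : E)) = Y.
Proof. by apply/funext => t; rewrite scaler0 addr0. Qed.

Lemma ham_germ_path (F0 : E -> R) (F : 'I_K -> E -> R) :
  smooth F0 -> (forall j, smooth (F j)) ->
  exists J, germ_equiv (3 * alpha) t0 t1 (ham_germ Z F0 F Y (cp_der Y)) (incr J).
Proof.
move=> hF0 hF.
have A := ham_germ_additive alpha_gt0 alpha_le (ltW ht) hZ hY (holder_cst 1 (0 : E)) hF0 hF.
rewrite -path_unshifted.
exact: (unif_additive_sewing alpha3 A n01).
Qed.

Lemma path_comp_holder (F0 : E -> R) : smooth F0 -> holder alpha t0 t1 (F0 \o Y).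
Proof.
move=> hF0.
rewrite -path_unshifted.
exact: (shifted_comp_holder alpha_gt alpha_le ht hZ hY (holder_cst 1 (0 : E)) hF0 n01).
Qed.

(** The right-hand sides of the rough Hamilton equations are increments of paths:
    component by component, Lebesgue and rough integral recombine into the sewing
    limit of a Hamiltonian germ. *)
Lemma drift_rough_int_incr (B : 'I_N -> E) (J : 'I_N -> R -> R) a b :
  (forall i, germ_equiv (3 * alpha) t0 t1
     (ham_germ Z (fun x => 'D_(B i) H x) (fun j x => 'D_(B i) (h j) x) Y (cp_der Y))
     (incr (J i))) ->
  t0 <= a -> a <= b -> b <= t1 ->
  drift_rough_int Z a b (fun x => \row_i 'D_(B i) H x)
    (fun j x => \row_i 'D_(B i) (h j) x) q p = \row_i (J i b - J i a).
Proof.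
move=> hJ ta ab bt.
have hD i : smooth (fun x => 'D_(B i) H x) by exact: smooth_derive.
have hG i := rough_germ_equiv alpha_gt alpha_le (path_comp_holder (hD i)) (hJ i).
pose L t := \row_i (J i t - primitive t0 ((fun x => 'D_(B i) H x) \o Y) t).
rewrite /drift_rough_int /rough_int.
rewrite (germ_equiv_sewing_lim (J := L) alpha3 _ ta ab bt); last first.
  have := germ_equiv_row hG.
  have -> : (fun u v => \row_i incr (fun t => J i t -
      primitive t0 ((fun x => 'D_(B i) H x) \o Y) t) u v) = incr L.
    by apply/funext => u; apply/funext => v; apply/rowP => i; rewrite !mxE.
  move=> hrow; rewrite [X in germ_equiv _ _ _ X _](_ : _ = (fun u v =>
    \row_i rough_germ Z (fun j x => 'D_(B i) (h j) x) Y (cp_der Y) u v)) //.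
  apply/funext => u; apply/funext => v; apply/rowP => i.
  rewrite /rough_germ !mxE !summxE; congr (_ + _).
    by apply: eq_bigr => j _; rewrite !mxE.
  apply: eq_bigr => k _; rewrite summxE; apply: eq_bigr => j _.
  by rewrite mxE /= diff_gradient.
apply/rowP => i; rewrite !mxE.
have -> : \int[mu]_(r in `[a, b]) (\row_i0 'D_(B i0) H (q r, p r)) 0 i =
    incr (primitive t0 ((fun x => 'D_(B i) H x) \o Y)) a b.
  rewrite (@primitive_incr R t0 t1)//; last first.
    apply: continuous_integrable; apply: (holder_continuous_within alpha_gt0).
    exact: path_comp_holder.
  by apply: eq_Rintegral => r _; rewrite mxE.
by rewrite /incr; ring.
Qed.

Variables (dq dp : R -> V).
Hypotheses (hdq : holder 1 t0 t1 dq) (hdp : holder 1 t0 t1 dp).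
Local Notation dY := (fun t => (dq t, dp t) : E).
Local Notation X := (fun e t => Y t + e *: dY t).

Let hdY : holder 1 t0 t1 dY.
Proof.
apply: has_order_holder.
apply: has_order_pair.
  exact: (holder_bound_has_order ler01 um hdq).
exact: (holder_bound_has_order ler01 um hdp).
Qed.

(** Adding the drift back to the rough integral lets the varied action be
    differentiated through a single germ. *)
Lemma energy_sewing e : `|e| < 1 ->
  \int[mu]_(t in `[t0, t1]) H (cpath_shift q e dq t, cpath_shift p e dp t) +
  rough_int Z t0 t1 (fun j => cpath_comp (h j)
    (cpath_pair (cpath_shift q e dq) (cpath_shift p e dp))) =
  sewing_lim t0 t1 (ham_germ Z H h (X e) (cp_der Y)).
Proof.
move=> e1.
have A := ham_germ_additive alpha_gt0 alpha_le (ltW ht) hZ hY hdY hH hh.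
have [J hJ] := unif_additive_sewing alpha3 A e1.
have hHX := shifted_comp_holder alpha_gt alpha_le ht hZ hY hdY hH e1.
have hG := rough_germ_equiv alpha_gt alpha_le hHX hJ.
rewrite (germ_equiv_sewing_lim alpha3 hJ (lexx t0) (ltW ht) (lexx t1)).
rewrite /rough_int.
rewrite (germ_equiv_sewing_lim (J := fun t => J t - primitive t0 (H \o X e) t)
   alpha3 _ (lexx t0) (ltW ht) (lexx t1)); last first.
  rewrite [X in germ_equiv _ _ _ X _](_ : _ = rough_germ Z h (X e) (cp_der Y)) //.
  apply/funext => u; apply/funext => v; rewrite /rough_germ; congr (_ + _).
  apply: eq_bigr => i _; apply: eq_bigr => j _.
  by rewrite deriveE//; exact: smooth_differentiable.
have -> : primitive t0 (H \o X e) t0 = 0 by rewrite /primitive set_itv1 Rintegral_set1.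
rewrite -[X in X + _ = _]/(primitive t0 (H \o X e) t1).
by ring.
Qed.

End Variation.

(** * The pairing of momenta and positions *)

Section DotProduct.
Context {R : realType} {N : nat}.
Implicit Types x y z : 'rV[R]_N.

Lemma dotpDl x y z : dotp (x + y) z = dotp x z + dotp y z.
Proof. by rewrite /dotp -big_split; apply: eq_bigr => i _; rewrite mxE mulrDl. Qed.

Lemma dotpDr x y z : dotp z (x + y) = dotp z x + dotp z y.
Proof. by rewrite /dotp -big_split; apply: eq_bigr => i _; rewrite mxE mulrDr. Qed.

Lemma dotpZl (k : R) x y : dotp (k *: x) y = k * dotp x y.
Proof. by rewrite /dotp mulr_sumr; apply: eq_bigr => i _; rewrite mxE mulrA. Qed.

Lemma dotpZr (k : R) x y : dotp x (k *: y) = k * dotp x y.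
Proof. by rewrite /dotp mulr_sumr; apply: eq_bigr => i _; rewrite mxE mulrCA. Qed.

Lemma dotpNr x y : dotp x (- y) = - dotp x y.
Proof. by rewrite -scaleN1r dotpZr mulN1r. Qed.

End DotProduct.

Section Pairing.
Context {R : realType} {K N : nat}.
Local Notation V := 'rV[R]_N.
Variables (alpha t0 t1 : R).
Hypotheses (alpha_gt0 : 0 < alpha) (alpha_le : alpha <= 2^-1) (ht : t0 < t1).
Variable Z : rpath R K.
Hypothesis hZ : geometric_rough_path alpha t0 t1 Z.

Lemma holder_coord (n : nat) b (f : R -> 'rV[R]_n) i :
  holder b t0 t1 f -> holder b t0 t1 (fun t => f t 0 i).
Proof.
move=> [C hC]; exists C => s t hs hr; apply: le_trans (hC s t hs hr).
by have := row_coord_le (f t - f s) i; rewrite !mxE.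
Qed.

Definition cpath_coord (Y : cpath R K V) (k : 'I_N) : cpath R K R :=
  CPath (fun t => Y t 0 k) (fun i t => cp_der Y i t 0 k).

Lemma controlled_coord (Y : cpath R K V) k :
  controlled alpha t0 t1 Z Y -> controlled alpha t0 t1 Z (cpath_coord Y k).
Proof.
move=> [hd [C hC]]; split=> [i|]; first exact: holder_coord.
exists C => s t hs hr; apply: le_trans (hC s t hs hr).
apply: le_trans (row_coord_le _ k); rewrite !mxE summxE /=.
by under [X in _ <= `|_ - X|]eq_bigr do rewrite mxE.
Qed.

Definition pairing_germ (p q : cpath R K V) (u v : R) : R :=
  dotp (p u) (q v - q u) +
  \sum_i \sum_j rp_area Z u v i j * dotp (cp_der p i u) (cp_der q j u).

Lemma pairing_germ_additive (p q : cpath R K V) :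
  controlled alpha t0 t1 Z p -> controlled alpha t0 t1 Z q ->
  unif_additive t0 t1 (3 * alpha) (fun=> pairing_germ p q).
Proof.
move=> hp hq.
have A := unif_additive_sum (fun k => pairing_additive alpha_gt0 (ltW ht) hZ
  (controlled_coord k hp) (controlled_coord k hq)).
apply: (has_order_ext _ A) => x _; congr (defect _ _ _ _).
apply/funext => u; apply/funext => v.
rewrite /pairing_germ /dotp big_split /=; congr (_ + _).
  by apply: eq_bigr => k _; rewrite !mxE.
rewrite [RHS]exchange_big /=; apply: eq_bigr => i _.
rewrite [RHS]exchange_big /=; apply: eq_bigr => j _.
by rewrite mulr_sumr.
Qed.

Lemma dotp_germ_additive a b (f g : R -> V) :
  0 <= a -> 0 <= b -> 3 * alpha <= a + b ->
  holder a t0 t1 f -> holder b t0 t1 g ->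
  unif_additive t0 t1 (3 * alpha) (fun _ u v => dotp (f u) (g v - g u)).
Proof.
move=> a0 b0 ab hf hg.
have A := unif_additive_sum (fun k => holder_product_additive alpha_gt0 a0 b0 ab
  (holder_coord k hf) (holder_coord k hg)).
apply: (has_order_ext _ A) => x _; congr (defect _ _ _ _).
apply/funext => u; apply/funext => v; rewrite /dotp.
by apply: eq_bigr => k _; rewrite !mxE.
Qed.

Lemma has_order_dotp a b (f g : triple -> V) : 0 <= a -> 0 <= b ->
  has_order t0 t1 a f -> has_order t0 t1 b g ->
  has_order t0 t1 (a + b) (fun x => dotp (f x) (g x)).
Proof.
move=> a0 b0 hf hg; apply: has_order_sum => i.
by apply: has_orderM => //; exact: has_order_coord.
Qed.

(** Variations leave the Gubinelli derivatives unchanged, so only the first-order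
    part of the pairing depends on eps, polynomially. *)
Lemma pairing_germ_shift (p q : cpath R K V) (dp dq : R -> V) e u v :
  pairing_germ (cpath_shift p e dp) (cpath_shift q e dq) u v =
  pairing_germ p q u v +
  e * (dotp (p u) (dq v - dq u) + dotp (dp u) (q v - q u)) +
  e * (e * dotp (dp u) (dq v - dq u)).
Proof.
rewrite /pairing_germ /=.
have -> : q v + e *: dq v - (q u + e *: dq u) = (q v - q u) + e *: (dq v - dq u).
  by rewrite opprD addrACA scalerBr.
by rewrite !(dotpDl, dotpDr, dotpZl, dotpZr); ring.
Qed.

End Pairing.

(** * The first variation of the action *)

Section Action.
Context {R : realType} {K N : nat}.
Local Notation V := 'rV[R]_N.
Local Notation E := (V * V)%type.
Variables (alpha t0 t1 : R).
Hypotheses (alpha_gt : 3^-1 < alpha) (alpha_le : alpha <= 2^-1) (ht : t0 < t1).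
Variable Z : rpath R K.
Hypothesis hZ : geometric_rough_path alpha t0 t1 Z.
Variables (H : E -> R) (calH : E -> 'rV[R]_K).
Hypotheses (hH : smooth H) (hcalH : smooth calH).
Variables (q p : cpath R K V).
Hypotheses (hq : controlled alpha t0 t1 Z q) (hp : controlled alpha t0 t1 Z p).

Local Notation Y := (cpath_pair q p).
Local Notation h := (Hcomp calH).
Local Notation um := (@subinterval_um R t0 t1).
Local Notation mv := (@subinterval_mv R t0 t1).
Local Notation uv := (@subinterval_uv R t0 t1).

Let alpha_gt0 : 0 < alpha. Proof. by apply: lt_trans alpha_gt; rewrite invr_gt0. Qed.
Let alpha3 : 1 < 3 * alpha. Proof. by have := alpha_gt; lra. Qed.
Let alpha1 : 3 * alpha <= 1 + alpha. Proof. by have := alpha_le; lra. Qed.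
Let alpha1' : 3 * alpha <= alpha + 1. Proof. by rewrite addrC; exact: alpha1. Qed.
Let alpha2 : 3 * alpha <= 1 + 1. Proof. by have := alpha_le; lra. Qed.
Let alpha_ge0 : 0 <= alpha. Proof. exact: ltW. Qed.
Let hY : controlled alpha t0 t1 Z Y. Proof. exact: controlled_pair. Qed.
Let hh j : smooth (h j). Proof. exact: smooth_coord. Qed.

(** The germ of the k-th component of the gradient of the Hamiltonians: for
    k = inl i the derivative in q_i, for k = inr i the one in p_i. *)
Definition gradient_germ (k : 'I_N + 'I_N) (X : R -> E) (X' : 'I_K -> R -> E) :=
  ham_germ Z (fun x => 'D_(pbasis k) H x) (fun j x => 'D_(pbasis k) (h j) x) X X'.

Variable J : 'I_N + 'I_N -> R -> R.
Hypothesis hJ : forall k,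
  germ_equiv (3 * alpha) t0 t1 (gradient_germ k Y (cp_der Y)) (incr (J k)).

(** J (inl i) is the integrated i-th position derivative of the Hamiltonians, so this
    path is constant exactly when the momentum equation holds. *)
Definition momentum_defect (t : R) : V := p t + \row_i J (inl i) t.
(** This path is constant exactly when the position equation holds. *)
Definition position_defect (t : R) : V := \row_i J (inr i) t - q t.

Lemma gradient_path_order k : has_order t0 t1 alpha
  (fun x => J k (tr_m x) - J k (tr_u x)).
Proof.
have hc : holder 1 t0 t1 (fun=> 0 : E) by exact: holder_cst.
have a3 : alpha <= 3 * alpha by have := alpha_ge0; lra.
have o1 := ham_germ_order alpha_gt0 alpha_le (ltW ht) hZ hY hc
  (smooth_derive (pbasis k) hH) (fun j => smooth_derive (pbasis k) (hh j)) um.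
have o2 : has_order t0 t1 (3 * alpha) (fun x =>
    gradient_germ k Y (cp_der Y) (tr_u x) (tr_m x) - incr (J k) (tr_u x) (tr_m x)).
  have [C [C0 hC]] := hJ k; exists C; split => // x [_ h1 h2 h3 h4].
  apply: le_trans (hC _ _ h1 h2 (le_trans h3 h4)) _.
  rewrite ler_wpM2l//; apply: ge0_ler_powR; rewrite ?nnegrE; have := alpha3; lra.
apply: (has_order_ext _ (has_orderB o1 (has_order_weaken alpha_ge0 a3 o2))) => x _.
rewrite /gradient_germ.
have -> : (fun t => Y t + tr_eps x *: (0 : E)) = Y.
  by apply/funext => t; rewrite scaler0 addr0.
by rewrite subKr.
Qed.

Lemma defect_order : has_order t0 t1 alpha
    (fun x => momentum_defect (tr_m x) - momentum_defect (tr_u x)) /\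
  has_order t0 t1 alpha
    (fun x => position_defect (tr_m x) - position_defect (tr_u x)).
Proof.
have row (k : 'I_N -> 'I_N + 'I_N) : has_order t0 t1 alpha
    (fun x => (\row_i J (k i) (tr_m x)) - \row_i J (k i) (tr_u x) : V).
  have [C hC] := choice (fun i => gradient_path_order (k i)).
  exists (\sum_i C i); split; first by apply: sumr_ge0 => i _; case: (hC i).
  move=> x hx; apply: row_norm_le => [|i].
    by rewrite mulr_ge0 ?powR_ge0// sumr_ge0// => i _; case: (hC i).
  rewrite !mxE; have [_ /(_ x hx) /le_trans] := hC i; apply.
  rewrite ler_wpM2r ?powR_ge0// (bigD1 i)//= lerDl sumr_ge0// => l _.
  by case: (hC l).
split.
  apply: (has_order_ext _ (has_orderD (controlled_increment_order alpha_gt0 (ltW ht) hZ hp um)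
    (row inl))) => x _.
  by rewrite /momentum_defect opprD addrACA.
apply: (has_order_ext _ (has_orderB (row inr)
  (controlled_increment_order alpha_gt0 (ltW ht) hZ hq um))) => x _.
by rewrite /position_defect opprB opprB addrACA [X in _ + X]addrC addrACA (addrC (q _)).
Qed.

Section Derivative.
Variables (dq dp : R -> V).
Hypotheses (hdq : holder 1 t0 t1 dq) (hdp : holder 1 t0 t1 dp).
Hypotheses (dq0 : dq t0 = 0) (dp1 : dp t1 = 0).
Local Notation dY := (fun t => (dq t, dp t) : E).
Local Notation X := (fun e t => Y t + e *: dY t).

(** The first variation of the action in Euler-Lagrange form, as a germ: the
    integral of dq against the momentum defect plus that of dp against the
    position defect. *)
Definition variation_germ (u v : R) : R :=
  dotp (dq u) (momentum_defect v - momentum_defect u) +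
  dotp (dp u) (position_defect v - position_defect u).

Definition action_germ (e u v : R) : R :=
  ham_germ Z H h (X e) (cp_der Y) u v -
  pairing_germ Z (cpath_shift p e dp) (cpath_shift q e dq) u v.

Definition action_germ_derivative (e u v : R) : R :=
  \sum_k pcoord k (dY u) * gradient_germ k (X e) (cp_der Y) u v -
  (dotp (p u) (dq v - dq u) + dotp (dp u) (q v - q u) +
   e * (2 * dotp (dp u) (dq v - dq u))).

Let hdY : holder 1 t0 t1 dY.
Proof.
apply: has_order_holder; apply: has_order_pair.
  exact: (holder_bound_has_order ler01 um hdq).
exact: (holder_bound_has_order ler01 um hdp).
Qed.

Lemma action_germ_additive : unif_additive t0 t1 (3 * alpha) action_germ.
Proof.
have hp' := controlled_holder alpha_gt0 (ltW ht) hZ hp.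
have hq' := controlled_holder alpha_gt0 (ltW ht) hZ hq.
have A0 := ham_germ_additive alpha_gt0 alpha_le (ltW ht) hZ hY hdY hH hh.
have A1 := pairing_germ_additive alpha_gt0 ht hZ hp hq.
have A2 := dotp_germ_additive alpha_gt0 alpha_ge0 ler01 alpha1' hp' hdq.
have A3 := dotp_germ_additive alpha_gt0 ler01 alpha_ge0 alpha1 hdp hq'.
have A4 := dotp_germ_additive alpha_gt0 ler01 ler01 alpha2 hdp hdq.
have A := unif_additiveD A0 (unif_additiveN (unif_additiveD (unif_additiveD A1
  (unif_additive_eps (unif_additiveD A2 A3)))
  (unif_additive_eps (unif_additive_eps A4)))).
apply: (has_order_ext _ A) => x _; congr (defect _ _ _ _).
by apply/funext => u; apply/funext => v; rewrite /action_germ pairing_germ_shift.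
Qed.

Lemma action_germ_derivative_additive :
  unif_additive t0 t1 (3 * alpha) action_germ_derivative.
Proof.
have hp' := controlled_holder alpha_gt0 (ltW ht) hZ hp.
have hq' := controlled_holder alpha_gt0 (ltW ht) hZ hq.
have hD k := smooth_derive (pbasis k) hH.
have hDh k j := smooth_derive (pbasis k) (hh j).
have hd k : holder 1 t0 t1 (fun t => pcoord k (dY t)).
  by case: k => i; exact: holder_coord.
have A0 := unif_additive_sum (fun k => additive_scale alpha_gt0 alpha_le (ltW ht) (hd k)
  (ham_germ_additive alpha_gt0 alpha_le (ltW ht) hZ hY hdY (hD k) (hDh k))
  (ham_germ_order alpha_gt0 alpha_le (ltW ht) hZ hY hdY (hD k) (hDh k) mv)).
have A2 := dotp_germ_additive alpha_gt0 alpha_ge0 ler01 alpha1' hp' hdq.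
have A3 := dotp_germ_additive alpha_gt0 ler01 alpha_ge0 alpha1 hdp hq'.
have A4 := dotp_germ_additive alpha_gt0 ler01 ler01 alpha2 hdp hdq.
have A := unif_additiveD A0 (unif_additiveN (unif_additiveD (unif_additiveD A2 A3)
  (unif_additive_eps (unif_additiveD A4 A4)))).
apply: (has_order_ext _ A) => x _; congr (defect _ _ _ _).
apply/funext => u; apply/funext => v; rewrite /action_germ_derivative.
by rewrite [2 * _]mulr_natl mulr2n.
Qed.

Lemma action_germ_is_derive e u v :
  is_derive e (1 : R) (fun e => action_germ e u v) (action_germ_derivative e u v).
Proof.
have d1 := @ham_germ_is_derive _ _ _ Z Y (cp_der Y) dY H h e u v hH hh.
have d2 : is_derive e (1 : R)
  (fun e : R => pairing_germ Z (cpath_shift p e dp) (cpath_shift q e dq) u v)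
  (dotp (p u) (dq v - dq u) + dotp (dp u) (q v - q u) +
   e * (2 * dotp (dp u) (dq v - dq u))).
  have -> : (fun e : R => pairing_germ Z (cpath_shift p e dp) (cpath_shift q e dq) u v) =
     (fun e => pairing_germ Z p q u v +
       e * (dotp (p u) (dq v - dq u) + dotp (dp u) (q v - q u)) +
       e * (e * dotp (dp u) (dq v - dq u))).
    by apply/funext => r; rewrite pairing_germ_shift.
  move: (pairing_germ Z p q u v) (dotp (p u) (dq v - dq u) + dotp (dp u) (q v - q u)).
  move: (dotp (dp u) (dq v - dq u)) => c2 c0 c1.
  have d : is_derive e (1 : R) (cst c0 + (fun e : R => e * c1) +
      ((id : R -> R) * (fun e : R => e * c2))) (0 + c1 + (e *: c2 + (e * c2) *: 1)).
    apply: is_deriveD; last first.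
      by apply: is_deriveM; exact: is_derive_mulr.
    apply: is_deriveD; exact: is_derive_mulr.
  apply: (trigger_derive d).
  by rewrite /GRing.scale /=; ring.
exact: (is_deriveB d1 d2).
Qed.

Lemma action_sewing e : `|e| < 1 ->
  action Z t0 t1 H calH (cpath_shift q e dq) (cpath_shift p e dp) =
  dotp (p t1) (q t1) + e * dotp (p t1) (dq t1) + sewing_lim t0 t1 (action_germ e).
Proof.
move=> e1.
have A0 := ham_germ_additive alpha_gt0 alpha_le (ltW ht) hZ hY hdY hH hh.
have [J1 hJ1] := unif_additive_sewing alpha3 A0 e1.
have [J2 hJ2] := unif_additive_sewing alpha3 action_germ_additive e1.
have hJ3 : germ_equiv (3 * alpha) t0 t1
    (pairing_germ Z (cpath_shift p e dp) (cpath_shift q e dq))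
    (incr (fun t => J1 t - J2 t)).
  move: hJ1 hJ2 => /germ_equivP o1 /germ_equivP o2; apply/germ_equivP.
  apply: (has_order_ext _ (has_orderB o1 o2)) => x _.
  by rewrite /action_germ /incr; ring.
rewrite /action -addrA (energy_sewing alpha_gt alpha_le ht hZ hH hcalH hq hp hdq hdp e1).
rewrite -[rough_pairing_int _ _ _ _ _]/(sewing_lim t0 t1
  (pairing_germ Z (cpath_shift p e dp) (cpath_shift q e dq))).
rewrite (germ_equiv_sewing_lim alpha3 hJ1 (lexx t0) (ltW ht) (lexx t1)).
rewrite (germ_equiv_sewing_lim alpha3 hJ2 (lexx t0) (ltW ht) (lexx t1)).
rewrite (germ_equiv_sewing_lim alpha3 hJ3 (lexx t0) (ltW ht) (lexx t1)).
rewrite /= dp1 scaler0 addr0 dotpDr dotpZr; ring.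
Qed.

(** Summation by parts moves the variation from dq to p: the sum
    p_u (dq_v - dq_u) + dq_u (p_v - p_u) is the increment of p dq up to a product
    of increments, of order 1 + alpha. The boundary term at t1 cancels against
    the Type-II boundary term of the action and the one at t0 vanishes because
    dq t0 = 0. The gradient germs may be replaced by the increments of J at the
    cost of an error of order 3 alpha. *)
Lemma action_germ_derivative_sewing :
  dotp (p t1) (dq t1) + sewing_lim t0 t1 (action_germ_derivative 0) =
  sewing_lim t0 t1 variation_germ.
Proof.
have hp' := controlled_holder alpha_gt0 (ltW ht) hZ hp.
have [oE oD] := defect_order.
have n01 : `|0 : R| < 1 by rewrite normr0.
have A := unif_additiveD
  (dotp_germ_additive alpha_gt0 ler01 alpha_ge0 alpha1 hdq (has_order_holder oE))
  (dotp_germ_additive alpha_gt0 ler01 alpha_ge0 alpha1 hdp (has_order_holder oD)).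
have [L hL] := unif_additive_sewing alpha3 A n01.
have hB : germ_equiv (3 * alpha) t0 t1 (action_germ_derivative 0)
    (incr (fun t => L t - dotp (p t) (dq t))).
  move: hL => /germ_equivP oL; apply/germ_equivP.
  have oG : has_order t0 t1 (3 * alpha) (fun x => \sum_k pcoord k (dY (tr_u x)) *
     (gradient_germ k Y (cp_der Y) (tr_u x) (tr_v x) - incr (J k) (tr_u x) (tr_v x))).
    apply: has_order_sum => k; rewrite -[3 * alpha]add0r; apply: has_orderM => //.
    - by have := alpha3; lra.
    - have [h1 _] := holder_has_order0 ler01 (ltW ht) um hdY.
      by apply: (has_order_dominated ler01 _ h1) => x _; rewrite mul1r pcoord_le.
    - exact/germ_equivP.
  have oP : has_order t0 t1 (3 * alpha) (fun x =>
      dotp (p (tr_v x) - p (tr_u x)) (dq (tr_v x) - dq (tr_u x))).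
    apply: (has_order_weaken _ alpha1'); first by have := alpha3; lra.
    apply: has_order_dotp => //.
      exact: (holder_bound_has_order alpha_ge0 uv hp').
    exact: (holder_bound_has_order ler01 uv hdq).
  apply: (has_order_ext _ (has_orderD oG (has_orderD oL oP))) => x _.
  move: (tr_u x) (tr_v x) => u v.
  rewrite /action_germ_derivative /incr.
  have -> : (fun t => Y t + 0 *: dY t) = Y.
    by apply/funext => t; rewrite scale0r addr0.
  have -> : \sum_k pcoord k (dY u) * (gradient_germ k Y (cp_der Y) u v - (J k v - J k u)) =
      \sum_k pcoord k (dY u) * gradient_germ k Y (cp_der Y) u v -
      (dotp (dq u) (\row_i J (inl i) v - \row_i J (inl i) u) +
       dotp (dp u) (\row_i J (inr i) v - \row_i J (inr i) u)).
    under eq_bigr do rewrite mulrBr.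
    rewrite sumrB; congr (_ - _); rewrite big_sumType /= /dotp; congr (_ + _).
      by apply: eq_bigr => i _; rewrite !mxE.
    by apply: eq_bigr => i _; rewrite !mxE.
  rewrite /momentum_defect /position_defect.
  have N1 (x0 y0 : V) : dotp (- x0) y0 = - dotp x0 y0 by rewrite -scaleN1r dotpZl mulN1r.
  rewrite !(dotpDl, dotpDr, dotpNr, N1).
  have C1 (x0 y0 : V) : dotp x0 y0 = dotp y0 x0.
    by rewrite /dotp; apply: eq_bigr => i _; rewrite mulrC.
  rewrite !(C1 (dq u)).
  by ring.
rewrite (germ_equiv_sewing_lim alpha3 hB (lexx t0) (ltW ht) (lexx t1)).
rewrite (germ_equiv_sewing_lim alpha3 (hL : germ_equiv _ _ _ variation_germ _)
  (lexx t0) (ltW ht) (lexx t1)).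
have -> : dotp (p t0) (dq t0) = 0 by rewrite dq0 -(scale0r 0) dotpZr mul0r.
by ring.
Qed.

(** The first variation formula; both directions of the theorem follow
    from it. *)
Lemma action_is_derive : is_derive (0 : R) (1 : R)
  (fun e : R => action Z t0 t1 H calH (cpath_shift q e dq) (cpath_shift p e dp))
  (sewing_lim t0 t1 variation_germ).
Proof.
have /unif_additiveP[C [C0 hC]] := action_germ_additive.
have /unif_additiveP[C' [C'0 hC']] := action_germ_derivative_additive.
have CC : 0 <= C + C' by exact: addr_ge0.
have wider (A : R -> R -> R) c : c <= C + C' -> almost_additive A c (3 * alpha) t0 t1 ->
    almost_additive A (C + C') (3 * alpha) t0 t1.
  move=> cC hA u m v tu umm mvv vt; apply: le_trans (hA u m v tu umm mvv vt) _.
  by rewrite ler_wpM2r ?powR_ge0.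
have D := sewing_lim_is_derive alpha3 CC (ltW ht)
  (fun e e1 => wider _ _ (_ : C <= C + C') (hC e e1))
  (fun e e1 => wider _ _ (_ : C' <= C + C') (hC' e e1))
  (fun e u v _ _ _ _ => action_germ_is_derive e u v).
have {}D := D ltac:(by move=> *; rewrite lerDl) ltac:(by move=> *; rewrite lerDr).
have D1 := is_derive_mulr (dotp (p t1) (dq t1)) 0.
have D2 := is_deriveD (is_deriveD (is_derive_cst (dotp (p t1) (q t1)) (0 : R) 1) D1) D.
rewrite -action_germ_derivative_sewing.
move: D2; rewrite add0r; apply: is_derive_near0_eq => e e1.
by rewrite action_sewing.
Qed.

End Derivative.
End Action.

(** * Stationarity and the rough Hamilton equations *)

Section Equivalence.
Context {R : realType} {K N : nat}.
Local Notation V := 'rV[R]_N.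
Local Notation E := (V * V)%type.
Variables (alpha t0 t1 : R).
Hypotheses (alpha_gt : 3^-1 < alpha) (alpha_le : alpha <= 2^-1) (ht : t0 < t1).
Variable Z : rpath R K.
Hypothesis hZ : geometric_rough_path alpha t0 t1 Z.
Variables (H : E -> R) (calH : E -> 'rV[R]_K).
Hypotheses (hH : smooth H) (hcalH : smooth calH).
Variables (q p : cpath R K V).
Hypotheses (hq : controlled alpha t0 t1 Z q) (hp : controlled alpha t0 t1 Z p).
Variable J : 'I_N + 'I_N -> R -> R.
Hypothesis hJ : forall k, germ_equiv (3 * alpha) t0 t1
  (gradient_germ Z H calH k (cpath_pair q p) (cp_der (cpath_pair q p))) (incr (J k)).

Local Notation mdefect := (momentum_defect p J).
Local Notation pdefect := (position_defect q J).

Let alpha_gt0 : 0 < alpha. Proof. by apply: lt_trans alpha_gt; rewrite invr_gt0. Qed.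
Let alpha3 : 1 < 3 * alpha. Proof. by have := alpha_gt; lra. Qed.

(** By additivity of the integrals, the position equation says that its defect
    agrees with its value at t0 and the momentum equation that its defect agrees
    with its value at t1, the endpoints from which the two equations integrate. *)
Lemma rough_hamiltonP : rough_hamilton Z t0 t1 H calH q p <->
  forall t, t0 <= t -> t <= t1 -> pdefect t = pdefect t0 /\ mdefect t = mdefect t1.
Proof.
have pos t : t0 <= t -> t <= t1 ->
    drift_rough_int Z t0 t (grad_p H) (fun j => grad_p (Hcomp calH j)) q p =
    \row_i J (inr i) t - \row_i J (inr i) t0.
  move=> h1 h2.
  rewrite (drift_rough_int_incr alpha_gt alpha_le ht hZ hH hcalH hq hp
    (B := fun i => pbasis (inr i)) (fun i => hJ (inr i)) (lexx t0) h1 h2).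
  by apply/rowP => i; rewrite !mxE.
have mom t : t0 <= t -> t <= t1 ->
    drift_rough_int Z t t1 (grad_q H) (fun j => grad_q (Hcomp calH j)) q p =
    \row_i J (inl i) t1 - \row_i J (inl i) t.
  move=> h1 h2.
  rewrite (drift_rough_int_incr alpha_gt alpha_le ht hZ hH hcalH hq hp
    (B := fun i => pbasis (inl i)) (fun i => hJ (inl i)) h1 h2 (lexx t1)).
  by apply/rowP => i; rewrite !mxE.
rewrite /position_defect /momentum_defect.
split=> hh t; last first.
  rewrite in_itv /= => /andP[h1 h2]; have [e1 e2] := hh t h1 h2.
  rewrite pos// mom//; split; apply/rowP => i.
    by move/rowP/(_ i): e1; rewrite !mxE => e1; lra.
  by move/rowP/(_ i): e2; rewrite !mxE => e2; lra.
move=> h1 h2.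
have := hh t; rewrite in_itv /= h1 h2 => /(_ isT).
rewrite pos// mom//; case => e1 e2; split; apply/rowP => i.
  by move/rowP/(_ i): e1; rewrite !mxE => e1; lra.
by move/rowP/(_ i): e2; rewrite !mxE => e2; lra.
Qed.

(** The germ of the first variation is identically zero. *)
Lemma stationary_of_constant_defects :
  (forall t, t0 <= t -> t <= t1 -> pdefect t = pdefect t0 /\ mdefect t = mdefect t1) ->
  stationary Z t0 t1 H calH q p.
Proof.
move=> hc dq dp sq sp dq0 dp1.
have D := action_is_derive alpha_gt alpha_le ht hZ hH hcalH hq hp hJ
  (smooth_on_lipschitz sq) (smooth_on_lipschitz sp) dq0 dp1.
have hg : germ_equiv (3 * alpha) t0 t1 (variation_germ q p J dq dp) (incr (fun=> 0)).
  exists 0; split => // u v tu uv vt.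
  have [e1 e2] := hc u tu (le_trans uv vt).
  have [e3 e4] := hc v (le_trans tu uv) vt.
  rewrite /variation_germ /incr e1 e2 e3 e4 !subrr.
  by rewrite -(scale0r (0 : V)) !dotpZr !mul0r addr0 subrr normr0.
move: D; rewrite (germ_equiv_sewing_lim alpha3 hg (lexx t0) (ltW ht) (lexx t1)).
by rewrite subrr.
Qed.

(** Varying one coordinate of q or of p along a polynomial isolates one component
    of a defect. Variations of q vanish at t0 and are free at t1, those of p the
    other way round. *)
Lemma constant_defects_of_stationary :
  stationary Z t0 t1 H calH q p ->
  forall t, t0 <= t -> t <= t1 -> pdefect t = pdefect t0 /\ mdefect t = mdefect t1.
Proof.
move=> hs t tt0 tt1.
have [oE oD] := defect_order alpha_gt alpha_le ht hZ hH hcalH hq hp hJ.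
have hE := has_order_holder oE; have hD := has_order_holder oD.
have a1 : alpha <= 1 by have := alpha_le; lra.
have a2 : 3 * alpha <= 1 + alpha by have := alpha_le; lra.
have z0 : smooth_on t0 t1 (fun=> 0 : V).
  have := @horner_smooth_on R t0 t1 N 0 0.
  by under eq_fun do rewrite scaler0.
have dotp0 (x : V) : dotp 0 x = 0 by rewrite -(scale0r (0 : V)) dotpZl mul0r.
have dotp_delta (c : R) i (x : V) : dotp (c *: delta_mx 0 i) x = c * x 0 i.
  rewrite dotpZl; congr (_ * _); rewrite /dotp (bigD1 i)//= big1 ?addr0.
    by rewrite !mxE !eqxx mul1r.
  by move=> k ki; rewrite !mxE (negbTE ki) andbF mul0r.
have vanish dq dp : smooth_on t0 t1 dq -> smooth_on t0 t1 dp -> dq t0 = 0 ->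
    dp t1 = 0 -> sewing_lim t0 t1 (variation_germ q p J dq dp) = 0.
  move=> sq sp dq0 dp1.
  have D := action_is_derive alpha_gt alpha_le ht hZ hH hcalH hq hp hJ
    (smooth_on_lipschitz sq) (smooth_on_lipschitz sp) dq0 dp1.
  have D' := hs dq dp sq sp dq0 dp1.
  by rewrite -(@derive_val _ _ _ _ _ _ _ D) (@derive_val _ _ _ _ _ _ _ D').
split; apply/rowP => i.
  apply: (constant_of_stationary_pairing ht alpha_gt0 a1 alpha3 a2 (holder_coord i hD)
    (or_intror (conj erefl erefl))) => // P P1.
  rewrite -[RHS](vanish (fun=> 0) (fun s => P.[s] *: delta_mx 0 i) z0
    (horner_smooth_on _ _ _ _) erefl); last by rewrite P1 scale0r.
  congr sewing_lim; apply/funext => u; apply/funext => v.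
  by rewrite /variation_germ dotp0 add0r dotp_delta !mxE.
apply: (constant_of_stationary_pairing ht alpha_gt0 a1 alpha3 a2 (holder_coord i hE)
  (or_introl (conj erefl erefl))) => // P P1.
rewrite -[RHS](vanish (fun s => P.[s] *: delta_mx 0 i) (fun=> 0)
  (horner_smooth_on _ _ _ _) z0 _ erefl); last by rewrite P1 scale0r.
congr sewing_lim; apply/funext => u; apply/funext => v.
by rewrite /variation_germ dotp0 addr0 dotp_delta !mxE.
Qed.

End Equivalence.

Theorem theorem2p1 (R : realType) (K N : nat) (alpha t0 t1 : R)
    (halpha : 3^-1 < alpha <= 2^-1) (ht : t0 < t1)
    (Z : rpath R K) (hZ : geometric_rough_path alpha t0 t1 Z)
    (H : 'rV[R]_N * 'rV[R]_N -> R) (hH : smooth H)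
    (calH : 'rV[R]_N * 'rV[R]_N -> 'rV[R]_K) (hcalH : smooth calH)
    (a b : 'rV[R]_N) (q p : cpath R K 'rV[R]_N)
    (hq : controlled alpha t0 t1 Z q) (hp : controlled alpha t0 t1 Z p)
    (hqa : q t0 = a) (hpb : p t1 = b) :
  (stationary Z t0 t1 H calH q p -> rough_hamilton Z t0 t1 H calH q p) /\
  (rough_hamilton Z t0 t1 H calH q p -> stationary Z t0 t1 H calH q p).
Proof.
case/andP: halpha => alpha_gt alpha_le.
have [J hJ] := choice (fun k : 'I_N + 'I_N => ham_germ_path alpha_gt alpha_le ht hZ hq hp
  (smooth_derive (pbasis k) hH) (fun j => smooth_derive (pbasis k) (smooth_coord j hcalH))).
have hP := rough_hamiltonP alpha_gt alpha_le ht hZ hH hcalH hq hp hJ.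
split=> [hs|/hP hc].
  by apply/hP; exact: (constant_defects_of_stationary alpha_gt alpha_le ht hZ hH hcalH hq hp hJ hs).
exact: (stationary_of_constant_defects alpha_gt alpha_le ht hZ hH hcalH hq hp hJ hc).
Qed.
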